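(* Suppose $V$ is an irreducible integrable module for $\tau(A)$ and suppose the central element $K$ acts non-trivially on $V$. Then $V$ is a highest weight module or a lowest weight module for $\tau(A)$.
   Context: All vector spaces and tensor products are over $\mathbb{C}$. Let $\mathfrak g$ be a simple finite dimensional Lie algebra with non-degenerate symmetric invariant bilinear form $(\cdot,\cdot)$. Let $\tilde{\mathfrak g}=\mathfrak g\otimes\mathbb{C}[t,t^{-1}]\oplus\mathbb{C}K$ with $K$ central and $[X\otimes t^n,Y\otimes t^m]=[X,Y]\otimes t^{m+n}+n\,\delta_{m+n,0}(X,Y)K$. Let $Vir=\bigoplus_{n\in\mathbb{Z}}\mathbb{C}L_n\oplus\mathbb{C}C_0$ with $C_0$ central and $[L_n,L_m]=(m-n)L_{n+m}+\delta_{n+m,0}\frac{n^3-n}{12}C_0$. Let $\bar\tau=Vir\ltimes\tilde{\mathfrak g}$ with $[L_n,X\otimes t^m]=mX\otimes t^{m+n}$ and $K$, $C_0$ central, and let $\tau=\bar\tau/\mathbb{C}(K-C_0)$. Let $A$ be a commutative associative finitely generated $\mathbb{C}$-algebra with unit. For a Lie algebra (or vector space) $\mathfrak g'$ put $\mathfrak g'(A)=\mathfrak g'\otimes A$ with bracket $[X\otimes a,Y\otimes b]=[X,Y]\otimes ab$, and write $X(a)=X\otimes a$. We regard $\tau\subset\tau(A)$ via $X\mapsto X\otimes 1$. Let $\mathfrak g=\mathfrak n^-\oplus\mathfrak h\oplus\mathfrak n^+$ be a triangular decomposition with Cartan subalgebra $\mathfrak h$; $\tilde{\mathfrak h}=\mathfrak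 h\oplus\mathbb{C}K$, $\bar{\mathfrak h}=\tilde{\mathfrak h}\oplus\mathbb{C}L_0$, $N^{\pm}=\mathfrak n^{\pm}\oplus\bigoplus_{n>0}\mathfrak g\otimes t^{\pm n}$, $L^{\pm}=\bigoplus_{n>0}\mathbb{C}L_{\pm n}$. Put $\tau^{\pm}(A)=N^{\pm}(A)\oplus L^{\pm}(A)$ and $\tau^0(A)=\bar{\mathfrak h}(A)$. A $\tau(A)$-module $V$ is a highest (respectively lowest) weight module if it is generated by a nonzero vector $v$ with $\tau^+(A)v=0$ (respectively $\tau^-(A)v=0$) on which $\tau^0(A)$ acts by scalars, via a linear map $\psi:\tau^0(A)\to\mathbb{C}$. Let $\overset{\circ}{\Delta}$ be the root system of $(\mathfrak g,\mathfrak h)$ and $\Delta^{real}=\{\alpha+n\delta:\alpha\in\overset{\circ}{\Delta},n\in\mathbb{Z}\}$ the real affine roots; a root vector for $\alpha+n\delta$ is an element of $\mathfrak g_\alpha\otimes t^n$. A $\tau(A)$-module $V$ is integrable if: (i) $V=\bigoplus_{\lambda\in\bar{\mathfrak h}^*}V_\lambda$, where $V_\lambda=\{v\in V: hv=\lambda(h)v\ \forall h\in\bar{\mathfrak h}\}$, with $\dim V_\lambda<\infty$ for all $\lambda$; (ii) for any $v\in V$, $\alpha\in\Delta^{real}$, root vector $X_\alpha$ of root $\alpha$, and $a\in A$ there is $N=N(\alpha,v,a)$ such that $(X_\alpha(a))^N v=0$. *)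

(* Defs.v *)
From HB Require Import structures.
From mathcomp Require Import all_boot all_order all_algebra.
From mathcomp Require Import finmap.
From mathcomp.multinomials Require Import monalg.
From mathcomp Require Import boolp ring zify.

Set Implicit Arguments.
Unset Strict Implicit.
Unset Printing Implicit Defensive.

Import GRing.Theory.

Local Open Scope ring_scope.
Local Open Scope quotient_scope.

Reserved Notation "u ⊗ v" (at level 40, left associativity).

Section Linear.
Variable F : fieldType.

Definition bilin (U V W : lmodType F) (f : U -> V -> W) : Prop :=
  (forall v, linear (f^~ v)) /\ (forall u, linear (f u)).

Section Basics.
Variables (U W : lmodType F) (f : U -> W).
Hypothesis fl : linear f.
Lemma linD x y : f (x + y) = f x + f y.
Proof. by have := fl 1 x y; rewrite !scale1r. Qed.
Lemma lin0 : f 0 = 0.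
Proof. by apply: (addrI (f 0)); rewrite -linD !addr0. Qed.
Lemma linZ c x : f (c *: x) = c *: f x.
Proof. by have := fl c x 0; rewrite !addr0 lin0 addr0. Qed.
Lemma linN x : f (- x) = - f x.
Proof. by rewrite -scaleN1r linZ scaleN1r. Qed.
Lemma linB x y : f (x - y) = f x - f y.
Proof. by rewrite linD linN. Qed.
Lemma lin_sum (I : Type) (r : seq I) (E : I -> U) :
  f (\sum_(i <- r) E i) = \sum_(i <- r) f (E i).
Proof.
by elim: r => [|i r IH]; rewrite ?big_nil ?lin0 // !big_cons linD IH.
Qed.
End Basics.

Section Span.
Variable V : lmodType F.

Definition lspan (X : V -> Prop) : {pred V} := fun v =>
  `[< forall S : {pred V}, GRing.submod_closed S ->
        (forall x, X x -> x \in S) -> v \in S >].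

Variable X : V -> Prop.

Lemma lspanP v : reflect (forall S : {pred V}, GRing.submod_closed S ->
  (forall x, X x -> x \in S) -> v \in S) (v \in lspan X).
Proof. exact: asboolP. Qed.

Lemma mem_lspan x : X x -> x \in lspan X.
Proof. by move=> Xx; apply/lspanP => S _; apply. Qed.

Lemma lspan_closed : GRing.submod_closed (lspan X).
Proof.
split=> [|c u v /lspanP Su /lspanP Sv]; apply/lspanP => S Scl XS.
  exact: Scl.1.
by apply: Scl.2; [apply: Su|apply: Sv].
Qed.

HB.instance Definition _ :=
  GRing.isSubmodClosed.Build F V (lspan X) lspan_closed.

Lemma lspan_ind (P : V -> Prop) : P 0 ->
  (forall c u v, P u -> P v -> P (c *: u + v)) ->
  (forall x, X x -> P x) -> forall v, v \in lspan X -> P v.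
Proof.
move=> P0 PD PX v /lspanP /(_ (fun x => `[< P x >])) H.
apply/asboolP; apply: H => [|x Xx]; last exact/asboolP/PX.
by split=> [|c x y /asboolP Px /asboolP Py]; apply/asboolP => //; apply: PD.
Qed.

End Span.

Section Free.
Variables (K : choiceType) (W : lmodType F).

(* The linear map sending each basis vector << k >> to f k. *)
Definition flift (f : K -> W) (g : {malg F[K]}) : W :=
  \sum_(k <- msupp g) g@_k *: f k.

Lemma fliftw (f : K -> W) g (d : {fset K}) : (msupp g `<=` d)%fset ->
  flift f g = \sum_(k <- d) g@_k *: f k.
Proof.
move=> gd; rewrite /flift; apply: big_fset_incl => // k _ /mcoeff_outdom ->.
by rewrite scale0r.
Qed.

Lemma flift_linear f : linear (flift f).
Proof.
move=> c x y; pose d := (msupp x `|` msupp y)%fset.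
have xd : (msupp x `<=` d)%fset by exact: fsubsetUl.
have yd : (msupp y `<=` d)%fset by exact: fsubsetUr.
have sd : (msupp (c *: x + y) `<=` d)%fset.
  apply: (fsubset_trans (msuppD_le _ _)); apply: fsetUSS => //.
  exact: msuppZ_le.
rewrite (fliftw f sd) (fliftw f xd) (fliftw f yd).
rewrite scaler_sumr -big_split /=; apply: eq_bigr => k _.
by rewrite mcoeffD mcoeffZ scalerDl scalerA.
Qed.

Lemma fliftU f k : flift f << k >> = f k.
Proof.
rewrite (fliftw f msuppU_le) big_seq_fset1 mcoeffUU scale1r //.
Qed.

Lemma flift_linear_fun (U : lmodType F) (f : U -> K -> W) g :
  (forall k, linear (f^~ k)) -> linear (fun u => flift (f u) g).
Proof.
move=> fl c u v; rewrite /flift scaler_sumr -big_split /=; apply: eq_bigr.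
by move=> k _; rewrite fl scalerDr !scalerA mulrC.
Qed.

End Free.

Lemma malg_ind (K : choiceType) (P : {malg F[K]} -> Prop) : P 0 ->
  (forall x y, P x -> P y -> P (x + y)) ->
  (forall c k, P (c *: << k >>)) -> forall g, P g.
Proof.
move=> P0 PD PU g.
rewrite (monalgE g); elim/big_ind: _ => // k _.
suff -> : << g@_k *g k >> = g@_k *: << k >> :> {malg F[K]} by [].
by apply/malgP => j; rewrite mcoeffZ !mcoeffU mulrnAr mulr1.
Qed.

Record subspace (V : lmodType F) := Subspace {
  subspace_pred :> {pred V};
  subspace_closed : GRing.submod_closed subspace_pred }.

HB.instance Definition _ (V : lmodType F) (S : subspace V) :=
  GRing.isSubmodClosed.Build F V (subspace_pred S) (subspace_closed S).

Section LmodQuot.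
Variables (V : lmodType F) (S : subspace V).

Record quotient_spec := QuotientSpec {
  quot_lmod : lmodType F;
  quot_pi : V -> quot_lmod;
  quot_repr : quot_lmod -> V;
  quot_reprK : cancel quot_repr quot_pi;
  quot_pi_linear : linear quot_pi;
  quot_pi_eq0 : forall x, (quot_pi x == 0) = (x \in (S : {pred V})) }.

Let lmod_quot := Quotient.quot (subspace_pred S).

HB.instance Definition _ := GRing.Zmodule.on lmod_quot.
HB.instance Definition _ : EqQuotient V (Quotient.equiv (subspace_pred S)) lmod_quot :=
  EqQuotient.on lmod_quot.
HB.instance Definition _ := ZmodQuotient.on lmod_quot.

Let lscaleq c := lift_op1 lmod_quot ( *:%R c).

Let pi_lscaleq c : {morph \pi_lmod_quot : x / c *: x >-> lscaleq c x}.
Proof.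
move=> x; unlock lscaleq; apply/eqP.
rewrite -Quotient.idealrBE -scalerBr rpredZ //.
by rewrite Quotient.idealrBE reprK.
Qed.
Local Canonical pi_lscaleq_morph c := PiMorph1 (pi_lscaleq c).

Let lscaleqA a b v : lscaleq a (lscaleq b v) = lscaleq (a * b) v.
Proof. by rewrite -[v]reprK !piE scalerA. Qed.
Let lscale1q : left_id 1 lscaleq.
Proof. by move=> v; rewrite -[v]reprK !piE scale1r. Qed.
Let lscaleqDr : right_distributive lscaleq +%R.
Proof. by move=> c x y; rewrite -[x]reprK -[y]reprK !piE scalerDr. Qed.
Let lscaleqDl v : {morph lscaleq^~ v : a b / a + b >-> a + b}.
Proof. by move=> a b; rewrite -[v]reprK !piE scalerDl. Qed.

HB.instance Definition _ := GRing.Zmodule_isLmodule.Build F lmod_quot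
  lscaleqA lscale1q lscaleqDr lscaleqDl.

Let lmod_pi_linear : linear (\pi_lmod_quot : V -> lmod_quot).
Proof. by move=> c x y; rewrite !piE. Qed.

Let lmod_pi_eq0 x : (\pi_lmod_quot x == 0) = (x \in S).
Proof.
by rewrite -[x in RHS]subr0 Quotient.idealrBE; congr (_ == _); rewrite piE.
Qed.

(* Opaque, so that V/S is only known through quotient_spec. *)
Lemma quotient_exists : quotient_spec.
Proof.
exact: (@QuotientSpec lmod_quot (fun x => \pi_lmod_quot x) (fun x => repr x)
  (@reprK _ _) lmod_pi_linear lmod_pi_eq0).
Qed.

Definition lquot : Type := quot_lmod quotient_exists.
HB.instance Definition _ := GRing.Lmodule.on lquot.

Definition lpi (x : V) : lquot := quot_pi quotient_exists x.
Definition lrepr (x : lquot) : V := quot_repr x.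

Lemma lreprK : cancel lrepr lpi.
Proof. exact: quot_reprK. Qed.
Lemma lpi_linear : linear lpi.
Proof. exact: quot_pi_linear. Qed.
Lemma lpi_eq0 x : (lpi x == 0) = (x \in (S : {pred V})).
Proof. exact: quot_pi_eq0. Qed.

End LmodQuot.

Section Tensor.
Variables (U V : lmodType F).

Inductive bilin_rel : {malg F[(U * V)%type]} -> Prop :=
| bilin_rel_l c u u' v :
    bilin_rel (<< (c *: u + u', v) >> - (c *: << (u, v) >> + << (u', v) >>))
| bilin_rel_r c u v v' :
    bilin_rel (<< (u, c *: v + v') >> - (c *: << (u, v) >> + << (u, v') >>)).

Definition tensor := lquot (Subspace (lspan_closed bilin_rel)).

HB.instance Definition _ := GRing.Lmodule.on tensor.

Definition tpi (z : {malg F[(U * V)%type]}) : tensor := lpi _ z.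
Definition trepr (x : tensor) : {malg F[(U * V)%type]} := lrepr x.

Lemma treprK : cancel trepr tpi.
Proof. exact: lreprK. Qed.
Lemma tpi_linear : linear tpi.
Proof. exact: lpi_linear. Qed.
Lemma tpi_eq0 z : (tpi z == 0) = (z \in lspan bilin_rel).
Proof. exact: lpi_eq0. Qed.

Definition tens : U -> V -> tensor := locked (fun u v => tpi << (u, v) >>).

Lemma tensE u v : tens u v = tpi << (u, v) >>.
Proof. by rewrite /tens -lock. Qed.

Lemma tens_bilin : bilin tens.
Proof.
have lE x y : x - y \in lspan bilin_rel -> tpi x = tpi y.
  by rewrite -tpi_eq0 (linB tpi_linear) subr_eq0 => /eqP.
split=> [v c u u'|u c v v']; rewrite !tensE -tpi_linear; apply: lE;
  apply: mem_lspan; [exact: bilin_rel_l|exact: bilin_rel_r].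
Qed.

Lemma tensor_ind (P : tensor -> Prop) : P 0 ->
  (forall x y, P x -> P y -> P (x + y)) ->
  (forall u v, P (tens u v)) -> forall x, P x.
Proof.
move=> P0 PD PT x; rewrite -[x]treprK.
elim/malg_ind: (trepr x) => [|y z Py Pz|c [u v]].
- by rewrite (lin0 tpi_linear).
- by rewrite (linD tpi_linear); apply: PD.
- by rewrite (linZ tpi_linear) -tensE -(linZ (tens_bilin.1 v)).
Qed.

(* The linear map on the tensor product induced by f; it is only meaningful
   when f is bilinear. *)
Definition tlift (W : lmodType F) (f : U -> V -> W) (x : tensor) : W :=
  flift (fun p => f p.1 p.2) (trepr x).

Section Lift.
Variables (W : lmodType F) (f : U -> V -> W).
Hypothesis fb : bilin f.

Lemma tlift_pi z : tlift f (tpi z) = flift (fun p => f p.1 p.2) z.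
Proof.
apply/eqP; rewrite /tlift -subr_eq0 -(linB (flift_linear _)).
have: trepr (tpi z) - z \in lspan bilin_rel.
  by rewrite -tpi_eq0 (linB tpi_linear) treprK subrr.
move: (_ - z); apply: lspan_ind => [|c x y /eqP x0 /eqP y0|_ [] c u v w].
- by rewrite (lin0 (flift_linear _)).
- by rewrite flift_linear x0 y0 scaler0 addr0.
- by rewrite (linB (flift_linear _)) flift_linear !fliftU /= fb.1 subrr.
- by rewrite (linB (flift_linear _)) flift_linear !fliftU /= fb.2 subrr.
Qed.

Lemma tliftE u v : tlift f (tens u v) = f u v.
Proof. by rewrite tensE tlift_pi fliftU. Qed.

Lemma tlift_linear : linear (tlift f).
Proof.
move=> c x y; rewrite -[x]treprK -[y]treprK -tpi_linear !tlift_pi.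
exact: flift_linear.
Qed.

End Lift.

Lemma tlift_linear_fun (X W : lmodType F) (f : X -> U -> V -> W) z :
  (forall u v, linear (fun x => f x u v)) ->
  linear (fun x => tlift (f x) z).
Proof.
move=> fl c x y; rewrite /tlift.
by apply: (flift_linear_fun (f := fun x p => f x p.1 p.2)) => k; apply: fl.
Qed.

End Tensor.


Section Multilinear.
Variables U V W : lmodType F.

Lemma lin_add (f g : U -> V) : linear f -> linear g ->
  linear (fun x => f x + g x).
Proof. by move=> fl gl c x y; rewrite fl gl scalerDr addrACA. Qed.

Lemma lin_opp (f : U -> V) : linear f -> linear (fun x => - f x).
Proof. by move=> fl c x y; rewrite fl opprD scalerN. Qed.

Lemma lin_scale (f : U -> V) k : linear f -> linear (fun x => k *: f x).
Proof.
by move=> fl c x y; rewrite fl scalerDr !scalerA mulrC.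
Qed.

Lemma lin_comp (f : V -> W) (g : U -> V) : linear f -> linear g ->
  linear (fun x => f (g x)).
Proof. by move=> fl gl c x y; rewrite gl fl. Qed.

Lemma lin_id : linear (fun x : U => x).
Proof. by []. Qed.

End Multilinear.

Definition lgen (U : lmodType F) (G : U -> Prop) : Prop :=
  forall P : U -> Prop, P 0 ->
    (forall c x y, P x -> P y -> P (c *: x + y)) ->
    (forall x, G x -> P x) -> forall x, P x.

Lemma lgen0 (U W : lmodType F) (G : U -> Prop) (f : U -> W) :
  lgen G -> linear f -> (forall x, G x -> f x = 0) -> forall x, f x = 0.
Proof.
move=> HG fl f0; apply: HG => // [|c x y x0 y0]; first exact: lin0.
by rewrite fl x0 y0 scaler0 addr0.
Qed.

Lemma lgen_alt (U W : lmodType F) (G : U -> Prop) (b : U -> U -> W) :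
  lgen G -> bilin b -> (forall x, G x -> b x x = 0) ->
  (forall x y, G x -> G y -> b x y + b y x = 0) -> forall x, b x x = 0.
Proof.
move=> HG [bl br] bxx bxy.
have bC x y : b x y + b y x = 0.
  apply: (lgen0 HG (f := fun x => b x y + b y x)).
    by apply: lin_add; [exact: bl|exact: br].
  move=> {}x Gx; apply: (lgen0 HG (f := fun y => b x y + b y x)).
    by apply: lin_add; [exact: br|exact: bl].
  by move=> {}y; exact: bxy.
apply: HG => // [|c x y x0 y0]; first by rewrite (lin0 (bl 0)).
rewrite bl !br x0 y0 scaler0 add0r addr0.
by rewrite -scalerDr bC scaler0.
Qed.

Lemma lgen_tri (U V W X : lmodType F) (GU : U -> Prop) (GV : V -> Prop)
    (GW : W -> Prop) (T : U -> V -> W -> X) :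
  lgen GU -> lgen GV -> lgen GW ->
  (forall y z, linear (fun x => T x y z)) ->
  (forall x z, linear (fun y => T x y z)) ->
  (forall x y, linear (fun z => T x y z)) ->
  (forall x y z, GU x -> GV y -> GW z -> T x y z = 0) ->
  forall x y z, T x y z = 0.
Proof.
move=> HU HV HW T1 T2 T3 T0 x y z.
apply: (lgen0 HU (T1 y z)) => {}x Gx; apply: (lgen0 HV (T2 x z)) => {}y Gy.
by apply: (lgen0 HW (T3 x y)) => {}z Gz; apply: T0.
Qed.

Definition jac (U : lmodType F) (b : U -> U -> U) x y z :=
  b x (b y z) + b y (b z x) + b z (b x y).

Lemma lgen_jac (U : lmodType F) (G : U -> Prop) (b : U -> U -> U) :
  lgen G -> bilin b ->
  (forall x y z, G x -> G y -> G z -> jac b x y z = 0) ->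
  forall x y z, jac b x y z = 0.
Proof.
move=> HG [bl br]; apply: lgen_tri => // [y z|x z|x y].
- apply: lin_add; first apply: lin_add; first exact: bl.
    by apply: (lin_comp (f := b y)); [exact: br|exact: br].
  by apply: (lin_comp (f := b z)); [exact: br|exact: bl].
- apply: lin_add; first apply: lin_add.
  + by apply: (lin_comp (f := b x)); [exact: br|exact: bl].
  + exact: bl.
  + by apply: (lin_comp (f := b z)); [exact: br|exact: br].
- apply: lin_add; first apply: lin_add.
  + by apply: (lin_comp (f := b x)); [exact: br|exact: br].
  + by apply: (lin_comp (f := b y)); [exact: br|exact: bl].
  + exact: bl.
Qed.

Lemma lgen_malg (K : choiceType) :
  lgen (fun x : {malg F[K]} => exists k, x = << k >>).
Proof.
move=> P P0 PD PG; have PZ c x : P x -> P (c *: x).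
  by move=> Px; rewrite -[_ *: _]addr0; apply: PD.
apply: malg_ind => // [x y Px Py|c k]; last by apply: PZ; apply: PG; exists k.
by rewrite -[x]scale1r; apply: PD.
Qed.

Lemma lgen_tensor (U V : lmodType F) (GU : U -> Prop) (GV : V -> Prop) :
  lgen GU -> lgen GV ->
  lgen (fun x : tensor U V => exists u v, [/\ GU u, GV v & x = tens u v]).
Proof.
move=> HU HV P P0 PD PG; apply: tensor_ind => // [x y Px Py|u v].
  by rewrite -[x]scale1r; apply: PD.
move: u; apply: HU => [|c x y Px Py|u Gu].
- by rewrite (lin0 ((tens_bilin _ _).1 v)).
- by rewrite (tens_bilin _ _).1; apply: PD.
move: v; apply: HV => [|c x y Px Py|v Gv].
- by rewrite (lin0 ((tens_bilin _ _).2 u)).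
- by rewrite (tens_bilin _ _).2; apply: PD.
- by apply: PG; exists u, v.
Qed.

Lemma lgenT (U : lmodType F) : lgen (fun _ : U => True).
Proof. by move=> P _ _ PG x; apply: PG. Qed.

(* Bilinear extensions of a map given on generators. *)
Definition flift2 (K K' : choiceType) (W : lmodType F) (f : K -> K' -> W)
    (p : {malg F[K]}) (q : {malg F[K']}) : W :=
  flift (fun k => flift (f k) q) p.

Definition tlift2 (U V U' V' W : lmodType F) (f : U -> V -> U' -> V' -> W)
    (x : tensor U V) (y : tensor U' V') : W :=
  tlift (fun u v => tlift (f u v) y) x.

Section Flift2.
Variables (K K' : choiceType) (W : lmodType F) (f : K -> K' -> W).

Lemma flift2_bilin : bilin (flift2 f).
Proof.
split=> [q|p]; first exact: flift_linear.
by apply: flift_linear_fun => k; exact: flift_linear.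
Qed.

Lemma flift2E k k' : flift2 f << k >> << k' >> = f k k'.
Proof. by rewrite /flift2 !fliftU. Qed.
End Flift2.

Section Tlift2.
Variables (U V U' V' W : lmodType F) (f : U -> V -> U' -> V' -> W).
Hypothesis fb : forall u v, bilin (f u v).
Hypothesis fb' : forall u' v', bilin (fun u v => f u v u' v').

Lemma tlift2_bilin_aux y : bilin (fun u v => tlift (f u v) y).
Proof.
split=> [v|u].
  by apply: tlift_linear_fun => u' v'; exact: (fb' u' v').1.
by apply: tlift_linear_fun => u' v'; exact: (fb' u' v').2.
Qed.

Lemma tlift2_bilin : bilin (tlift2 f).
Proof.
split=> [y|x]; first exact: tlift_linear (tlift2_bilin_aux y).
by apply: tlift_linear_fun => u v; exact: tlift_linear.
Qed.

Lemma tlift2E u v u' v' : tlift2 f (tens u v) (tens u' v') = f u v u' v'.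
Proof. by rewrite /tlift2 tliftE ?tliftE //; exact: tlift2_bilin_aux. Qed.
End Tlift2.

End Linear.

Notation "u ⊗ v" := (tens u v) : ring_scope.

HB.mixin Record isLieAlgebra (F : fieldType) L of GRing.Lmodule F L := {
  lie : L -> L -> L;
  lie_bilin : bilin lie;
  liexx : forall x, lie x x = 0;
  lie_jacobi : forall x y z,
    lie x (lie y z) + lie y (lie z x) + lie z (lie x y) = 0
}.

#[short(type="lieAlgType")]
HB.structure Definition LieAlgebra (F : fieldType) :=
  {L of isLieAlgebra F L & GRing.Lmodule F L}.

#[short(type="finLieAlgType")]
HB.structure Definition FinLieAlgebra (F : fieldType) :=
  {L of LieAlgebra F L & Vector F L}.

HB.mixin Record isLieModule (F : fieldType) (L : lieAlgType F) V
    of GRing.Lmodule F V := {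
  lact : L -> V -> V;
  lact_bilin : bilin lact;
  lact_lie : forall x y v,
    lact (lie x y) v = lact x (lact y v) - lact y (lact x v)
}.

#[short(type="lieModType")]
HB.structure Definition LieModule (F : fieldType) (L : lieAlgType F) :=
  {V of isLieModule F L V & GRing.Lmodule F V}.

Section LieTheory.
Variables (F : fieldType) (L : lieAlgType F).
Implicit Types x y z : L.

Lemma lieC x y : lie x y = - lie y x.
Proof.
apply/eqP; rewrite -addr_eq0; apply/eqP; have := liexx (x + y).
rewrite (linD (lie_bilin.1 _)) !(linD (lie_bilin.2 _)) !liexx.
by rewrite add0r addr0.
Qed.

Lemma lieDl z x y : lie (x + y) z = lie x z + lie y z.
Proof. exact: linD (lie_bilin.1 z) _ _. Qed.
Lemma lieDr z x y : lie z (x + y) = lie z x + lie z y.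
Proof. exact: linD (lie_bilin.2 z) _ _. Qed.
Lemma lieNl z x : lie (- x) z = - lie x z.
Proof. exact: linN (lie_bilin.1 z) _. Qed.
Lemma lieNr z x : lie z (- x) = - lie z x.
Proof. exact: linN (lie_bilin.2 z) _. Qed.
Lemma lieBr z x y : lie z (x - y) = lie z x - lie z y.
Proof. by rewrite lieDr lieNr. Qed.
Lemma lie0l z : lie 0 z = 0.
Proof. exact: lin0 (lie_bilin.1 z). Qed.
Lemma lie0r z : lie z 0 = 0.
Proof. exact: lin0 (lie_bilin.2 z). Qed.
End LieTheory.

Notation "u ⊗ v" := (tens u v) : ring_scope.

Section Current.
Variables (F : fieldType) (L : lieAlgType F) (A : comAlgType F).

Definition current := tensor L A.
HB.instance Definition _ := GRing.Lmodule.on current.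

Definition current_lie : current -> current -> current :=
  tlift2 (fun X a Y b => lie X Y ⊗ (a * b)).

Let cur_b1 (X : L) (a : A) : bilin (fun Y b => lie X Y ⊗ (a * b) : current).
Proof.
split=> [b|Y] c x y; rewrite ?lie_bilin.2 ?(tens_bilin _ _).1 //.
by rewrite mulrDr -scalerAr (tens_bilin _ _).2.
Qed.
Let cur_b2 (Y : L) (b : A) : bilin (fun X a => lie X Y ⊗ (a * b) : current).
Proof.
split=> [a|X] c x y; rewrite ?lie_bilin.1 ?(tens_bilin _ _).1 //.
by rewrite mulrDl -scalerAl (tens_bilin _ _).2.
Qed.

Lemma current_lie_bilin : bilin current_lie.
Proof. exact: tlift2_bilin. Qed.

Lemma current_lieE X a Y b :
  current_lie (X ⊗ a) (Y ⊗ b) = lie X Y ⊗ (a * b).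
Proof. exact: tlift2E. Qed.

Lemma lgen_current : lgen (fun x : current => exists X a, x = X ⊗ a).
Proof.
move=> P P0 PD PG; apply: (lgen_tensor (@lgenT F L) (@lgenT F A) P0 PD).
by move=> _ [u [v [_ _ ->]]]; apply: PG; exists u, v.
Qed.

Lemma current_liexx x : current_lie x x = 0.
Proof.
apply: (lgen_alt lgen_current current_lie_bilin) => {x} [_ [X [a ->]]|].
  by rewrite current_lieE liexx (lin0 ((tens_bilin _ _).1 _)).
move=> _ _ [X [a ->]] [Y [b ->]]; rewrite !current_lieE lieC mulrC.
by rewrite -(linD ((tens_bilin _ _).1 _)) addNr (lin0 ((tens_bilin _ _).1 _)).
Qed.

Lemma current_jacobi x y z : current_lie x (current_lie y z) +
  current_lie y (current_lie z x) + current_lie z (current_lie x y) = 0.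
Proof.
apply: (lgen_jac lgen_current current_lie_bilin) => {x y z}.
move=> _ _ _ [X [a ->]] [Y [b ->]] [Z [c ->]]; rewrite /jac !current_lieE.
have -> : b * (c * a) = a * (b * c) by rewrite mulrA mulrC.
have -> : c * (a * b) = a * (b * c) by rewrite mulrC mulrA.
rewrite -!(linD ((tens_bilin _ _).1 _)) lie_jacobi.
exact: (lin0 ((tens_bilin _ _).1 _)).
Qed.

HB.instance Definition _ := isLieAlgebra.Build F current
  current_lie_bilin current_liexx current_jacobi.

End Current.

Section Laurent.
Variable F : fieldType.

(* C[t, t^-1], with << n >> = t^n. *)
Definition laurent := {malg F[int]}.
HB.instance Definition _ := GRing.Lmodule.on laurent.

Definition laurent_mul : laurent -> laurent -> laurent :=
  flift2 (fun n m => << n + m >>).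

Let mulb : bilin laurent_mul := flift2_bilin _.

Let lgL : lgen (fun x : laurent => exists n, x = << n >>).
Proof. exact: lgen_malg. Qed.

Lemma laurent_mulC : commutative laurent_mul.
Proof.
move=> x y; apply/subr0_eq; move: x y.
have T1 y : linear (fun x => laurent_mul x y - laurent_mul y x).
  by apply: lin_add; [exact: mulb.1|apply: lin_opp; exact: mulb.2].
have T2 x : linear (fun y => laurent_mul x y - laurent_mul y x).
  by apply: lin_add; [exact: mulb.2|apply: lin_opp; exact: mulb.1].
move=> x y; apply: (lgen0 lgL (T1 y)) => _ [n ->].
apply: (lgen0 lgL (T2 _)) => _ [m ->].
by rewrite /laurent_mul !flift2E (addrC n m) subrr.
Qed.

Lemma laurent_mulA : associative laurent_mul.
Proof.
move=> x y z; apply/subr0_eq; move: x y z.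
apply: (lgen_tri lgL lgL lgL) => [y z|x z|x y|_ _ _ [n ->] [m ->] [k ->]].
- apply: lin_add; first exact: mulb.1.
  apply: lin_opp; apply: (lin_comp (f := laurent_mul^~ z)); exact: mulb.1.
- apply: lin_add.
    by apply: (lin_comp (f := laurent_mul x)); [exact: mulb.2|exact: mulb.1].
  apply: lin_opp; apply: (lin_comp (f := laurent_mul^~ z)).
    exact: mulb.1.
  exact: mulb.2.
- apply: lin_add; last by apply: lin_opp; exact: mulb.2.
  by apply: (lin_comp (f := laurent_mul x)); exact: mulb.2.
- by rewrite /laurent_mul !flift2E (addrA n m k) subrr.
Qed.

Lemma laurent_mul1 : left_id (<< 0 >> : laurent) laurent_mul.
Proof.
move=> x; apply/subr0_eq; move: x; apply: (lgen0 lgL) => [|_ [n ->]].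
  by apply: lin_add; [exact: mulb.2|exact: lin_opp].
by rewrite /laurent_mul flift2E add0r subrr.
Qed.

Lemma laurent_mulDl : left_distributive laurent_mul +%R.
Proof. by move=> x y z; exact: linD (mulb.1 z) _ _. Qed.

Lemma laurent_nz1 : (<< 0 >> : laurent) != 0.
Proof. by rewrite monalgU_eq0 oner_eq0. Qed.

HB.instance Definition _ := GRing.Zmodule_isComNzRing.Build laurent
  laurent_mulA laurent_mulC laurent_mul1 laurent_mulDl laurent_nz1.

Lemma laurent_scaleAl (c : F) (x y : laurent) : c *: (x * y) = (c *: x) * y.
Proof. by rewrite -(linZ (mulb.1 y)). Qed.

HB.instance Definition _ :=
  GRing.Lmodule_isLalgebra.Build F laurent laurent_scaleAl.
HB.instance Definition _ := GRing.Lalgebra_isComAlgebra.Build F laurent.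

Lemma laurentM n m : (<< n >> : laurent) * << m >> = << n + m >>.
Proof. exact: flift2E. Qed.

End Laurent.

Section CentralExtension.
Variables (F : fieldType) (L : lieAlgType F).

Record cocycle := Cocycle {
  coc :> L -> L -> F^o;
  coc_bilin : bilin coc;
  coc_xx : forall x, coc x x = 0;
  coc_jacobi : forall x y z,
    coc x (lie y z) + coc y (lie z x) + coc z (lie x y) = 0 }.

Definition cext (w : cocycle) : Type := (L * F^o)%type.
HB.instance Definition _ w := GRing.Lmodule.on (cext w).

Variable w : cocycle.

Definition cext_lie (x y : cext w) : cext w := (lie x.1 y.1, w x.1 y.1).

Lemma cext_lie_bilin : bilin cext_lie.
Proof.
split=> [y|x] c u v; apply: injective_projections => /=.
- exact: lie_bilin.1.
- exact: (coc_bilin w).1.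
- exact: lie_bilin.2.
- exact: (coc_bilin w).2.
Qed.

Lemma cext_liexx x : cext_lie x x = 0.
Proof. by rewrite /cext_lie liexx coc_xx. Qed.

Lemma cext_jacobi x y z : cext_lie x (cext_lie y z) +
  cext_lie y (cext_lie z x) + cext_lie z (cext_lie x y) = 0.
Proof.
by apply: injective_projections => /=; [exact: lie_jacobi|exact: coc_jacobi].
Qed.

HB.instance Definition _ := isLieAlgebra.Build F (cext w)
  cext_lie_bilin cext_liexx cext_jacobi.

End CentralExtension.

Section SemiDirect.
Variables (F : fieldType) (L M : lieAlgType F).

Record derAction := DerAction {
  dact :> L -> M -> M;
  dact_bilin : bilin dact;
  dact_lie : forall x y u,
    dact (lie x y) u = dact x (dact y u) - dact y (dact x u);
  dact_der : forall x u v,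
    dact x (lie u v) = lie (dact x u) v + lie u (dact x v) }.

Definition semidirect (d : derAction) : Type := (L * M)%type.
HB.instance Definition _ d := GRing.Lmodule.on (semidirect d).

Variable d : derAction.

Definition semidirect_lie (x y : semidirect d) : semidirect d :=
  (lie x.1 y.1, lie x.2 y.2 + d x.1 y.2 - d y.1 x.2).

Lemma semidirect_lie_bilin : bilin semidirect_lie.
Proof.
have [d1 d2] := dact_bilin d.
split=> [y|x] c u v; apply: injective_projections => /=.
- exact: lie_bilin.1.
- move: c u v; apply: (lin_add (f := fun x => lie x.2 y.2 + d x.1 y.2)).
    by apply: lin_add => c u v /=; [exact: lie_bilin.1|exact: d1].
  by apply: lin_opp => c u v /=; exact: d2.
- exact: lie_bilin.2.
- move: c u v; apply: (lin_add (f := fun y => lie x.2 y.2 + d x.1 y.2)).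
    by apply: lin_add => c u v /=; [exact: lie_bilin.2|exact: d2].
  by apply: lin_opp => c u v /=; exact: d1.
Qed.

Lemma semidirect_liexx x : semidirect_lie x x = 0.
Proof.
by rewrite /semidirect_lie !liexx add0r subrr.
Qed.

Lemma semidirect_jacobi x y z : semidirect_lie x (semidirect_lie y z) +
  semidirect_lie y (semidirect_lie z x) +
  semidirect_lie z (semidirect_lie x y) = 0.
Proof.
apply: injective_projections => /=; first exact: lie_jacobi.
case: x y z => [a u] [b v] [c w] /=.
rewrite !lieBr !lieDr !dact_lie.
rewrite !(linB ((dact_bilin d).2 _)) !(linD ((dact_bilin d).2 _)) !dact_der.
rewrite (lieC (d a v) w) (lieC (d b w) u) (lieC (d c u) v).
rewrite !opprD !opprK !addrA.
rewrite (ACl ((1*10*19) * (2*13) * (3*23) * (4*20) * (5*12) * (6*26) * (7*18) *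
  (8*15) * (9*25) * (11*22) * (14*21) * (16*27) * (17*24))%AC) /=.
by rewrite lie_jacobi !subrr !addNr !addr0.
Qed.

HB.instance Definition _ := isLieAlgebra.Build F (semidirect d)
  semidirect_lie_bilin semidirect_liexx semidirect_jacobi.

End SemiDirect.

Section LieQuotient.
Variables (F : fieldType) (L : lieAlgType F).

Record lieIdeal := LieIdeal {
  ideal_subspace :> subspace L;
  ideal_lie : forall x y, y \in (ideal_subspace : {pred L}) ->
    lie x y \in (ideal_subspace : {pred L}) }.

Variable I : lieIdeal.

Definition lieQuot := lquot I.
HB.instance Definition _ := GRing.Lmodule.on lieQuot.

Definition lie_pi (x : L) : lieQuot := lpi I x.
Definition lie_repr (x : lieQuot) : L := lrepr x.

Lemma lie_reprK : cancel lie_repr lie_pi.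
Proof. exact: lreprK. Qed.
Lemma lie_pi_linear : linear lie_pi.
Proof. exact: lpi_linear. Qed.
Lemma lie_pi_eq0 x : (lie_pi x == 0) = (x \in (I : {pred L})).
Proof. exact: lpi_eq0. Qed.

Definition lieQuot_lie (x y : lieQuot) : lieQuot :=
  lie_pi (lie (lie_repr x) (lie_repr y)).

Lemma lieQuot_lieE x y : lieQuot_lie (lie_pi x) (lie_pi y) = lie_pi (lie x y).
Proof.
have H z : lie_repr (lie_pi z) - z \in (I : {pred L}).
  by rewrite -lie_pi_eq0 (linB lie_pi_linear) lie_reprK subrr.
have Hr u v z : u - v \in (I : {pred L}) -> lie_pi (lie z u) = lie_pi (lie z v).
  move=> /(ideal_lie z); rewrite lieBr -lie_pi_eq0 (linB lie_pi_linear).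
  by rewrite subr_eq0 => /eqP.
rewrite /lieQuot_lie (Hr _ y) // lieC (linN lie_pi_linear) (Hr _ x) //.
by rewrite -(linN lie_pi_linear) -lieC.
Qed.

Lemma lieQuot_lie_bilin : bilin lieQuot_lie.
Proof.
split=> [y|x] c u v.
  rewrite -[y]lie_reprK -[u]lie_reprK -[v]lie_reprK -lie_pi_linear.
  by rewrite !lieQuot_lieE lie_bilin.1 lie_pi_linear.
rewrite -[x]lie_reprK -[u]lie_reprK -[v]lie_reprK -lie_pi_linear.
by rewrite !lieQuot_lieE lie_bilin.2 lie_pi_linear.
Qed.

Lemma lieQuot_liexx x : lieQuot_lie x x = 0.
Proof. by rewrite /lieQuot_lie liexx (lin0 lie_pi_linear). Qed.

Lemma lieQuot_jacobi x y z : lieQuot_lie x (lieQuot_lie y z) +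
  lieQuot_lie y (lieQuot_lie z x) + lieQuot_lie z (lieQuot_lie x y) = 0.
Proof.
rewrite -[x]lie_reprK -[y]lie_reprK -[z]lie_reprK !lieQuot_lieE.
by rewrite -!(linD lie_pi_linear) lie_jacobi (lin0 lie_pi_linear).
Qed.

HB.instance Definition _ := isLieAlgebra.Build F lieQuot
  lieQuot_lie_bilin lieQuot_liexx lieQuot_jacobi.

End LieQuotient.

(* The Witt algebra: << n >> is L_n. *)
Section Witt.
Variable F : fieldType.

Definition witt := {malg F[int]}.
HB.instance Definition _ := GRing.Lmodule.on witt.

Definition witt_lie : witt -> witt -> witt :=
  flift2 (fun n m => (m - n)%:~R *: << n + m >>).

Lemma witt_lie_bilin : bilin witt_lie.
Proof. exact: flift2_bilin. Qed.

Lemma lgen_witt : lgen (fun x : witt => exists n, x = << n >>).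
Proof. exact: lgen_malg. Qed.

Lemma witt_lieE n m :
  witt_lie << n >> << m >> = (m - n)%:~R *: << n + m >>.
Proof. exact: flift2E. Qed.

Lemma witt_liexx x : witt_lie x x = 0.
Proof.
apply: (lgen_alt lgen_witt witt_lie_bilin) => {x} [_ [n ->]|].
  by rewrite witt_lieE subrr scale0r.
move=> _ _ [n ->] [m ->]; rewrite !witt_lieE (addrC m n) -scalerDl -intrD.
by rewrite addrA subrK subrr scale0r.
Qed.

Lemma witt_jacobi x y z : witt_lie x (witt_lie y z) +
  witt_lie y (witt_lie z x) + witt_lie z (witt_lie x y) = 0.
Proof.
apply: (lgen_jac lgen_witt witt_lie_bilin) => {x y z}.
move=> _ _ _ [n ->] [m ->] [k ->]; rewrite /jac !witt_lieE.
rewrite !(linZ (witt_lie_bilin.2 _)) !witt_lieE !scalerA.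
rewrite -!intrM.
have -> : m + (k + n) = n + (m + k) by ring.
have -> : k + (n + m) = n + (m + k) by ring.
rewrite -!scalerDl -!intrD.
set e := (X in X%:~R); have -> : e = 0 by rewrite /e; ring.
by rewrite scale0r.
Qed.

HB.instance Definition _ := isLieAlgebra.Build F witt
  witt_lie_bilin witt_liexx witt_jacobi.

Definition vir_coc : witt -> witt -> F^o := flift2 (fun n m =>
  if n + m == 0 then (n ^+ 3 - n)%:~R / 12%:R else 0 : F^o).

Lemma vir_coc_bilin : bilin vir_coc.
Proof. exact: flift2_bilin. Qed.

Lemma vir_cocE n m : vir_coc << n >> << m >> =
  if n + m == 0 then (n ^+ 3 - n)%:~R / 12%:R else 0.
Proof. exact: flift2E. Qed.

Lemma vir_coc_xx x : vir_coc x x = 0.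
Proof.
apply: (lgen_alt lgen_witt vir_coc_bilin) => {x} [_ [n ->]|].
  rewrite vir_cocE; case: eqP => // nn; have -> : n = 0 by lia.
  by rewrite expr0n subrr mul0r.
move=> _ _ [n ->] [m ->]; rewrite !vir_cocE (addrC m n).
case: eqP => [nm|_]; last by rewrite addr0.
have -> : m = - n by lia.
rewrite -mulrDl -intrD; set e := (X in X%:~R).
have -> : e = 0 by rewrite /e; ring.
by rewrite mulr0z mul0r.
Qed.

Lemma vir_coc_jacobi (x y z : witt) : vir_coc x (lie y z) +
  vir_coc y (lie z x) + vir_coc z (lie x y) = 0.
Proof.
have [b1 b2] := vir_coc_bilin; have [l1 l2] := witt_lie_bilin.
move: x y z; apply: (lgen_tri (T := fun x y z : witt => vir_coc x (lie y z) +
  vir_coc y (lie z x) + vir_coc z (lie x y)) lgen_witt lgen_witt lgen_witt).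
- move=> y z; apply: lin_add; first apply: lin_add; first exact: b1.
  + by apply: (lin_comp (f := vir_coc y)) => //; exact: l2.
  + by apply: (lin_comp (f := vir_coc z)) => //; exact: l1.
- move=> x z; apply: lin_add; first apply: lin_add; last 1 first.
  + by apply: (lin_comp (f := vir_coc z)) => //; exact: l2.
  + by apply: (lin_comp (f := vir_coc x)) => //; exact: l1.
  + exact: b1.
- move=> x y; apply: lin_add; last exact: b1; apply: lin_add.
  + by apply: (lin_comp (f := vir_coc x)) => //; exact: l2.
  + by apply: (lin_comp (f := vir_coc y)) => //; exact: l1.
move=> _ _ _ [n ->] [m ->] [k ->].
have lE i j : lie (<< i >> : witt) << j >> = (j - i)%:~R *: << i + j >>.
  exact: witt_lieE.
rewrite !lE !(linZ (b2 _)) !vir_cocE.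
rewrite (addrA n) (addrC m (k + n)) -(addrA k) (addrC k (n + m)).
case: eqP => [nmk|_]; last by rewrite !scaler0 !addr0.
have -> : k = - (n + m) by lia.
rewrite /GRing.scale /= !mulrA -!mulrDl -!intrM -!intrD.
set e := (X in X%:~R).
have -> : e = 0 by rewrite /e; ring.
by rewrite mulr0z mul0r.
Qed.

Definition vir_cocycle := Cocycle vir_coc_bilin vir_coc_xx vir_coc_jacobi.

Definition vir := cext vir_cocycle.
HB.instance Definition _ := LieAlgebra.on vir.

End Witt.

Record invForm (F : fieldType) (g : lieAlgType F) := InvForm {
  form :> g -> g -> F^o;
  form_bilin : bilin form;
  form_sym : forall x y, form x y = form y x;
  form_inv : forall x y z, form (lie x y) z = form x (lie y z);
  form_nondeg : forall x, (forall y, form x y = 0) -> x = 0 }.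

Section Affine.
Variables (F : fieldType) (g : lieAlgType F) (B : invForm g).

Definition loop := current g (laurent F).
HB.instance Definition _ := LieAlgebra.on loop.

Lemma lgen_loop :
  lgen (fun x : loop => exists X n, x = X ⊗ (<< n >> : laurent F)).
Proof.
move=> P P0 PD PG.
apply: (lgen_tensor (@lgenT F g) (@lgen_malg F int) P0 PD).
by move=> _ [u [v [_ [n ->] ->]]]; apply: PG; exists u, n.
Qed.

(* The residue of (dp/dt) q. *)
Definition laurent_res : laurent F -> laurent F -> F^o :=
  flift2 (fun n m => if n + m == 0 then n%:~R else 0 : F^o).

Definition aff_coc : loop -> loop -> F^o :=
  tlift2 (fun X p Y q => B X Y *: laurent_res p q).

Lemma laurent_resE n m :
  laurent_res << n >> << m >> = if n + m == 0 then n%:~R else 0.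
Proof. exact: flift2E. Qed.

Let res_bilin : bilin laurent_res := flift2_bilin _.

Let aff_b1 (X : g) (p : laurent F) :
  bilin (fun Y q => B X Y *: laurent_res p q).
Proof.
split=> [q|Y] c x y; last by rewrite res_bilin.2 scalerDr !scalerA mulrC.
by rewrite (form_bilin B).2 scalerDl scalerA.
Qed.

Let aff_b2 (Y : g) (q : laurent F) :
  bilin (fun X p => B X Y *: laurent_res p q).
Proof.
split=> [p|X] c x y; last by rewrite res_bilin.1 scalerDr !scalerA mulrC.
by rewrite (form_bilin B).1 scalerDl scalerA.
Qed.

Lemma aff_coc_bilin : bilin aff_coc.
Proof. exact: tlift2_bilin. Qed.

Lemma aff_cocE X n Y m : aff_coc (X ⊗ << n >>) (Y ⊗ << m >>) =
  if n + m == 0 then B X Y * n%:~R else 0.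
Proof.
rewrite /aff_coc tlift2E // laurent_resE.
by case: eqP => // _; rewrite scaler0.
Qed.

Lemma aff_coc_xx x : aff_coc x x = 0.
Proof.
apply: (lgen_alt lgen_loop aff_coc_bilin) => {x} [_ [X [n ->]]|].
  rewrite aff_cocE; case: eqP => // nn; have -> : n = 0 by lia.
  by rewrite mulr0.
move=> _ _ [X [n ->]] [Y [m ->]].
rewrite 2!aff_cocE.
rewrite (addrC m n).
case: eqP => [nm|_]; last by rewrite addr0.
rewrite (form_sym B Y X).
by rewrite -mulrDr -intrD nm mulr0.
Qed.

Lemma loop_lieE (X Y : g) n m :
  lie (X ⊗ (<< n >> : laurent F) : loop) (Y ⊗ (<< m >> : laurent F)) =
  lie X Y ⊗ (<< n + m >> : laurent F).
Proof. by rewrite -laurentM; exact: current_lieE. Qed.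

Lemma aff_coc_jacobi (x y z : loop) : aff_coc x (lie y z) +
  aff_coc y (lie z x) + aff_coc z (lie x y) = 0.
Proof.
have [b1 b2] := aff_coc_bilin; have [l1 l2] := @lie_bilin F loop.
move: x y z; apply: (lgen_tri (T := fun x y z : loop => aff_coc x (lie y z) +
  aff_coc y (lie z x) + aff_coc z (lie x y)) lgen_loop lgen_loop lgen_loop).
- move=> y z; apply: lin_add; first apply: lin_add; first exact: b1.
  + by apply: (lin_comp (f := aff_coc y)) => //; exact: l2.
  + by apply: (lin_comp (f := aff_coc z)) => //; exact: l1.
- move=> x z; apply: lin_add; first apply: lin_add; last 1 first.
  + by apply: (lin_comp (f := aff_coc z)) => //; exact: l2.
  + by apply: (lin_comp (f := aff_coc x)) => //; exact: l1.
  + exact: b1.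
- move=> x y; apply: lin_add; last exact: b1; apply: lin_add.
  + by apply: (lin_comp (f := aff_coc x)) => //; exact: l2.
  + by apply: (lin_comp (f := aff_coc y)) => //; exact: l1.
move=> _ _ _ [X [n ->]] [Y [m ->]] [Z [k ->]].
rewrite !loop_lieE !aff_cocE.
rewrite (addrA n) (addrC m (k + n)) -(addrA k) (addrC k (n + m)).
case: eqP => [nmk|_]; last by rewrite !addr0.
rewrite -(form_inv B Y) (form_sym B (lie Y Z)).
rewrite (form_sym B Z) (form_inv B X).
by rewrite -!mulrDr -!intrD nmk mulr0.
Qed.

Definition aff_cocycle := Cocycle aff_coc_bilin aff_coc_xx aff_coc_jacobi.

Definition affine := cext aff_cocycle.
HB.instance Definition _ := LieAlgebra.on affine.

(* L_n acts on C[t, t^-1] as t^(n+1) d/dt. *)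
Definition witt_der : witt F -> laurent F -> laurent F :=
  flift2 (fun n m => m%:~R *: << m + n >>).

Let der_bilin : bilin witt_der := flift2_bilin _.

Definition witt_loop (w : witt F) : loop -> loop :=
  tlift (fun X p => X ⊗ witt_der w p).

Let wl_b (w : witt F) : bilin (fun X p => X ⊗ witt_der w p : loop).
Proof.
split=> [p|X] c x y; first exact: (tens_bilin _ _).1.
by rewrite der_bilin.2 (tens_bilin _ _).2.
Qed.

Lemma witt_loop_bilin : bilin witt_loop.
Proof.
split=> [x|w]; last exact: tlift_linear.
apply: tlift_linear_fun => X p c u v.
by rewrite der_bilin.1 (tens_bilin _ _).2.
Qed.

Lemma witt_loopE n X m : witt_loop << n >> (X ⊗ (<< m >> : laurent F)) =
  m%:~R *: (X ⊗ (<< m + n >> : laurent F)).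
Proof.
rewrite /witt_loop tliftE // /witt_der flift2E.
exact: (linZ ((tens_bilin _ _).2 X)).
Qed.

Lemma witt_loop_lie (a b : witt F) (x : loop) : witt_loop (lie a b) x =
  witt_loop a (witt_loop b x) - witt_loop b (witt_loop a x).
Proof.
have [w1 w2] := witt_loop_bilin; have [l1 l2] := @lie_bilin F (witt F).
apply/subr0_eq; move: a b x.
apply: (lgen_tri (T := fun (a b : witt F) x => witt_loop (lie a b) x -
  (witt_loop a (witt_loop b x) - witt_loop b (witt_loop a x)))
  (@lgen_witt F) (@lgen_witt F) lgen_loop).
- move=> b x; apply: lin_add; last apply: lin_opp; last apply: lin_add.
  + by apply: (lin_comp (f := witt_loop^~ x)); [exact: w1|exact: l1].
  + exact: w1.
  + by apply: lin_opp; apply: (lin_comp (f := witt_loop b)); [exact: w2|exact: w1].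
- move=> a x; apply: lin_add; last apply: lin_opp; last apply: lin_add.
  + by apply: (lin_comp (f := witt_loop^~ x)); [exact: w1|exact: l2].
  + by apply: (lin_comp (f := witt_loop a)); [exact: w2|exact: w1].
  + by apply: lin_opp; exact: w1.
- move=> a b; apply: lin_add; last apply: lin_opp; last apply: lin_add.
  + exact: w2.
  + by apply: (lin_comp (f := witt_loop a)); exact: w2.
  + by apply: lin_opp; apply: (lin_comp (f := witt_loop b)); exact: w2.
move=> _ _ _ [n ->] [m ->] [X [k ->]].
have -> : lie (<< n >> : witt F) << m >> = (m - n)%:~R *: << n + m >>.
  exact: witt_lieE.
have w1Z c w (x : loop) : witt_loop (c *: w) x = c *: witt_loop w x.
  exact: linZ (w1 x) _ _.
have w2Z c w (x : loop) : witt_loop w (c *: x) = c *: witt_loop w x.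
  exact: linZ (w2 w) _ _.
rewrite w1Z (witt_loopE (n + m)) (witt_loopE m) (witt_loopE n) w2Z w2Z.
rewrite (witt_loopE n) (witt_loopE m).
rewrite !scalerA.
have -> : k + m + n = k + (n + m) by ring.
have -> : k + n + m = k + (n + m) by ring.
rewrite -!intrM.
move: (X ⊗ _) => T.
rewrite -[X in _ - X]scalerBl.
rewrite -[LHS]scalerBl.
rewrite -!intrB; set e := (X in X%:~R).
have -> : e = 0 by rewrite /e; ring.
by rewrite mulr0z scale0r.
Qed.

Lemma witt_loop_der (a : witt F) (x y : loop) : witt_loop a (lie x y) =
  lie (witt_loop a x) y + lie x (witt_loop a y).
Proof.
have [w1 w2] := witt_loop_bilin; have [l1 l2] := @lie_bilin F loop.
apply/subr0_eq; move: a x y.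
apply: (lgen_tri (T := fun a (x y : loop) => witt_loop a (lie x y) -
  (lie (witt_loop a x) y + lie x (witt_loop a y)))
  (@lgen_witt F) lgen_loop lgen_loop).
- move=> x y; apply: lin_add; last apply: lin_opp; last apply: lin_add.
  + exact: w1.
  + by apply: (lin_comp (f := lie^~ y)); [exact: l1|exact: w1].
  + by apply: (lin_comp (f := lie x)); [exact: l2|exact: w1].
- move=> a y; apply: lin_add; last apply: lin_opp; last apply: lin_add.
  + by apply: (lin_comp (f := witt_loop a)); [exact: w2|exact: l1].
  + by apply: (lin_comp (f := lie^~ y)); [exact: l1|exact: w2].
  + exact: l1.
- move=> a x; apply: lin_add; last apply: lin_opp; last apply: lin_add.
  + by apply: (lin_comp (f := witt_loop a)); [exact: w2|exact: l2].
  + exact: l2.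
  + by apply: (lin_comp (f := lie x)); [exact: l2|exact: w2].
move=> _ _ _ [n ->] [X [m ->]] [Y [k ->]].
have l1Z c (x y : loop) : lie (c *: x) y = c *: lie x y.
  exact: linZ (l1 y) _ _.
have l2Z c (x y : loop) : lie x (c *: y) = c *: lie x y.
  exact: linZ (l2 x) _ _.
rewrite (loop_lieE X Y m k) (witt_loopE n (lie X Y)) (witt_loopE n X).
rewrite (witt_loopE n Y) l1Z l2Z (loop_lieE X Y (m + n)).
rewrite (loop_lieE X Y m (k + n)).
have -> : m + n + k = m + k + n by ring.
have -> : m + (k + n) = m + k + n by ring.
move: (lie X Y ⊗ _) => T.
by rewrite -scalerDl -intrD subrr.
Qed.

Lemma aff_coc_witt (a : witt F) (x y : loop) :
  aff_coc (witt_loop a x) y + aff_coc x (witt_loop a y) = 0.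
Proof.
have [w1 w2] := witt_loop_bilin; have [b1 b2] := aff_coc_bilin.
move: a x y; apply: (lgen_tri (T := fun a x y => aff_coc (witt_loop a x) y +
  aff_coc x (witt_loop a y)) (@lgen_witt F) lgen_loop lgen_loop).
- move=> x y; apply: lin_add.
  + by apply: (lin_comp (f := aff_coc^~ y)); [exact: b1|exact: w1].
  + by apply: (lin_comp (f := aff_coc x)); [exact: b2|exact: w1].
- move=> a y; apply: lin_add.
  + by apply: (lin_comp (f := aff_coc^~ y)); [exact: b1|exact: w2].
  + exact: b1.
- move=> a x; apply: lin_add; first exact: b2.
  by apply: (lin_comp (f := aff_coc x)); [exact: b2|exact: w2].
move=> _ _ _ [n ->] [X [m ->]] [Y [k ->]].
have b1Z c (x y : loop) : aff_coc (c *: x) y = c *: aff_coc x y.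
  exact: linZ (b1 y) _ _.
have b2Z c (x y : loop) : aff_coc x (c *: y) = c *: aff_coc x y.
  exact: linZ (b2 x) _ _.
rewrite (witt_loopE n X) (witt_loopE n Y) b1Z b2Z (aff_cocE X (m + n)).
rewrite (aff_cocE X m).
have -> : m + (k + n) = m + n + k by ring.
case: eqP => [mnk|_]; last by rewrite !scaler0 addr0.
have -> : m + n = - k by lia.
rewrite /GRing.scale /= !(mulrCA _ (B X Y)) -mulrDr -!intrM -intrD.
set e := (X in X%:~R).
have -> : e = 0 by rewrite /e; ring.
by rewrite mulr0z mulr0.
Qed.

Definition vir_act (w : vir F) (x : affine) : affine :=
  (witt_loop w.1 x.1, 0).

Lemma vir_act_bilin : bilin vir_act.
Proof.
split=> [y|x] c u v; apply: injective_projections => /=.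
- exact: witt_loop_bilin.1.
- by rewrite scaler0 addr0.
- exact: witt_loop_bilin.2.
- by rewrite scaler0 addr0.
Qed.

Lemma vir_act_lie (a b : vir F) (x : affine) :
  vir_act (lie a b) x = vir_act a (vir_act b x) - vir_act b (vir_act a x).
Proof.
apply: injective_projections => /=; first exact: witt_loop_lie.
by rewrite subrr.
Qed.

Lemma vir_act_der (a : vir F) (x y : affine) :
  vir_act a (lie x y) = lie (vir_act a x) y + lie x (vir_act a y).
Proof.
apply: injective_projections => /=; first exact: witt_loop_der.
by rewrite aff_coc_witt.
Qed.

Definition vir_derAction := DerAction vir_act_bilin vir_act_lie vir_act_der.

Definition taubar := semidirect vir_derAction.
HB.instance Definition _ := LieAlgebra.on taubar.

Definition taubar_K : taubar := (0, (0, 1)).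
Definition taubar_C0 : taubar := ((0, 1), 0).

Definition KC_subspace : subspace taubar :=
  Subspace (lspan_closed (fun x => x = taubar_K - taubar_C0)).

Lemma KC_ideal (x y : taubar) : y \in (KC_subspace : {pred taubar}) ->
  lie x y \in (KC_subspace : {pred taubar}).
Proof.
move=> Hy; suff -> : lie x y = 0 by exact: (subspace_closed KC_subspace).1.
move: y Hy; apply: lspan_ind => [|c u v u0 v0|_ ->]; first exact: lie0r.
  by rewrite lie_bilin.2 u0 v0 scaler0 addr0.
apply: injective_projections; apply: injective_projections;
  rewrite /= !subrr.
- exact: lie0r.
- exact: lin0 ((@vir_coc_bilin F).2 _).
- rewrite lie0r (lin0 (witt_loop_bilin.1 _)) (lin0 (witt_loop_bilin.2 _)).
  by rewrite add0r subrr.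
- by rewrite (lin0 (aff_coc_bilin.2 _)) addr0 subrr.
Qed.

Definition KC_lieIdeal := LieIdeal KC_ideal.

Definition tau := lieQuot KC_lieIdeal.
HB.instance Definition _ := LieAlgebra.on tau.

Definition tauX (X : g) (n : int) : tau :=
  lie_pi KC_lieIdeal (0, (X ⊗ (<< n >> : laurent F), 0)).
Definition tauL (n : int) : tau := lie_pi KC_lieIdeal ((<< n >>, 0), 0).
(* The common image of K and C_0. *)
Definition tauK : tau := lie_pi KC_lieIdeal taubar_K.

Lemma tau_C0 : lie_pi KC_lieIdeal taubar_C0 = tauK.
Proof.
apply/esym/eqP; rewrite -subr_eq0 -(linB (@lie_pi_linear _ _ KC_lieIdeal)).
by rewrite lie_pi_eq0; apply: mem_lspan.
Qed.

Lemma tau_lieE (x y : taubar) :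
  lie (lie_pi KC_lieIdeal x) (lie_pi KC_lieIdeal y) =
  lie_pi KC_lieIdeal (lie x y).
Proof. exact: lieQuot_lieE. Qed.

Let tpD := linD (@lie_pi_linear _ _ KC_lieIdeal).
Let tpZ := linZ (@lie_pi_linear _ _ KC_lieIdeal).
Let wl0 (x : loop) : witt_loop 0 x = 0 := lin0 (witt_loop_bilin.1 x).
Let wl0r (w : witt F) : witt_loop w 0 = 0 := lin0 (witt_loop_bilin.2 w).
Let ac0l (x : loop) : aff_coc 0 x = 0 := lin0 (aff_coc_bilin.1 x).
Let ac0r (x : loop) : aff_coc x 0 = 0 := lin0 (aff_coc_bilin.2 x).
Let vc0l (w : witt F) : vir_coc 0 w = 0 := lin0 ((@vir_coc_bilin F).1 w).
Let vc0r (w : witt F) : vir_coc w 0 = 0 := lin0 ((@vir_coc_bilin F).2 w).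
Let tau0s := (@lie0l, @lie0r, wl0, wl0r, ac0l, ac0r, vc0l, vc0r).

Lemma tauXX X Y n m : lie (tauX X n) (tauX Y m) =
  tauX (lie X Y) (n + m) + (if n + m == 0 then n%:~R * B X Y else 0) *: tauK.
Proof.
rewrite tau_lieE -tpZ -tpD; congr lie_pi.
apply: injective_projections; apply: injective_projections; rewrite /= ?tau0s.
- by rewrite scaler0 addr0.
- by rewrite scaler0 addr0.
- by rewrite loop_lieE scaler0 subr0.
- rewrite aff_cocE add0r addr0 subr0 mulrC.
  by case: ifP => _; rewrite /GRing.scale /= ?mulr1 ?mul0r.
Qed.

Lemma tauLX n X m : lie (tauL n) (tauX X m) = m%:~R *: tauX X (m + n).
Proof.
rewrite tau_lieE -tpZ; congr lie_pi.
apply: injective_projections; apply: injective_projections; rewrite /= ?tau0s.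
- by rewrite scaler0.
- by rewrite scaler0.
- by rewrite witt_loopE add0r subr0.
- by rewrite scaler0 addr0 subr0.
Qed.

Lemma tauLL n m : lie (tauL n) (tauL m) = (m - n)%:~R *: tauL (n + m) +
  (if n + m == 0 then (n ^+ 3 - n)%:~R / 12%:R else 0) *: tauK.
Proof.
rewrite -tau_C0 tau_lieE -!tpZ -tpD; congr lie_pi.
apply: injective_projections; apply: injective_projections; rewrite /= ?tau0s.
- by rewrite scaler0 addr0; exact: witt_lieE.
- by rewrite vir_cocE scaler0 add0r /GRing.scale /= mulr1.
- by rewrite !scaler0 !addr0 subrr.
- by rewrite !scaler0 !addr0 subrr.
Qed.

Lemma tauK_central x : lie tauK x = 0.
Proof.
rewrite -[x]lie_reprK tau_lieE; apply/eqP; rewrite lie_pi_eq0.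
suff -> : lie taubar_K (lie_repr x) = 0.
  exact: (subspace_closed KC_subspace).1.
apply: injective_projections; apply: injective_projections; rewrite /= ?tau0s //.
  by rewrite addr0 subrr.
by rewrite addr0 subrr.
Qed.

End Affine.

Section LieDefinitions.
Variables (F : fieldType) (g : finLieAlgType F).

Definition simple_lie : Prop :=
  (exists x y : g, lie x y != 0) /\
  (forall I : {vspace g}, (forall x y, y \in I -> lie x y \in I) ->
    I = 0%VS \/ I = fullv).

Definition lie_subalgebra (h : {vspace g}) : Prop :=
  forall x y, x \in h -> y \in h -> lie x y \in h.

Definition nilpotent_lie (h : {vspace g}) : Prop :=
  exists n, forall (s : seq g) y, size s = n -> {subset s <= h} -> y \in h ->
    foldr (fun x z => lie x z) y s = 0.

Definition cartan_subalgebra (h : {vspace g}) : Prop :=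
  [/\ lie_subalgebra h, nilpotent_lie h &
      forall x, (forall y, y \in h -> lie x y \in h) -> x \in h].

Definition dual (U : vectType F) := 'Hom(U, F^o).

(* A triangular decomposition of g is given by a Cartan subalgebra h and a
   positive system P of roots: n^+ (resp. n^-) is the sum of the root spaces of
   the roots in P (resp. -P). *)
Variable h : {vspace g}.

Definition root_space (alpha : dual (subvs_of h)) (X : g) : Prop :=
  forall H : subvs_of h, lie (vsval H) X = (alpha H : F) *: X.

Definition is_root (alpha : dual (subvs_of h)) : Prop :=
  alpha != 0 /\ exists2 X, X != 0 & root_space alpha X.

Definition positive_system (P : {pred dual (subvs_of h)}) : Prop :=
  [/\ forall alpha, alpha \in P -> is_root alpha,
      forall alpha, is_root alpha -> (alpha \in P) = (- alpha \notin P) &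
      forall alpha beta, alpha \in P -> beta \in P -> is_root (alpha + beta) ->
        alpha + beta \in P].

Definition nil_part (Q : {pred dual (subvs_of h)}) : {pred g} :=
  lspan (fun X => exists2 alpha, alpha \in Q & root_space alpha X).

(* hbar = h + C K + C L_0. *)
Definition hbar : Type := (subvs_of h * F^o * F^o)%type.
HB.instance Definition _ := Vector.on hbar.

Definition fin_gen_alg (A : comAlgType F) : Prop :=
  exists s : seq A, forall S : {pred A}, GRing.subalg_closed S ->
    {subset s <= S} -> forall a, a \in S.

End LieDefinitions.

Section Modules.
Variables (F : fieldType) (L : lieAlgType F) (V : lieModType L).

Definition lie_submodule (S : {pred V}) : Prop :=
  GRing.submod_closed S /\ forall (x : L) v, v \in S -> lact x v \in S.

Definition irreducible_lieMod : Prop :=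
  (exists v : V, v != 0) /\
  forall S : {pred V}, lie_submodule S ->
    (forall v, v \in S -> v = 0) \/ (forall v, v \in S).

Definition generates (v : V) : Prop :=
  forall S : {pred V}, lie_submodule S -> v \in S -> forall w, w \in S.

Definition fin_dim (W : V -> Prop) : Prop :=
  exists s : seq V, forall v, W v -> v \in lspan (fun x => x \in s).

Definition direct_sum (I : eqType) (W : I -> V -> Prop) : Prop :=
  (forall v, exists (r : seq I) (u : I -> V),
     (forall i, W i (u i)) /\ v = \sum_(i <- r) u i) /\
  (forall (r : seq I) (u : I -> V), uniq r -> (forall i, W i (u i)) ->
     \sum_(i <- r) u i = 0 -> forall i, i \in r -> u i = 0).

End Modules.

Section TauModules.
Variables (F : fieldType) (g : finLieAlgType F) (B : invForm g).
Variables (A : comAlgType F) (h : {vspace g}) (P : {pred dual (subvs_of h)}).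

Definition tauA := current (tau B) A.
HB.instance Definition _ := LieAlgebra.on tauA.

Definition hbar_tau (x : hbar h) : tau B :=
  tauX B (vsval x.1.1) 0 + x.1.2 *: tauK B + x.2 *: tauL B 0.

(* The image of W ⊗ A in tau(A). *)
Definition sub_tens (W : {pred tau B}) : {pred tauA} :=
  lspan (fun x => exists2 y, y \in W & exists a, x = y ⊗ a).

(* N^+, resp. N^-, for e = 1, resp. -1. *)
Definition N_part (Q : {pred dual (subvs_of h)}) (e : int) : {pred tau B} :=
  lspan (fun x => (exists2 X, X \in nil_part Q & x = tauX B X 0) \/
    exists X (n : nat), (0 < n)%N /\ x = tauX B X (e * n%:Z)).

Definition L_part (e : int) : {pred tau B} :=
  lspan (fun x => exists2 n : nat, (0 < n)%N & x = tauL B (e * n%:Z)).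

Definition tauA_pos : {pred tauA} := lspan (fun x =>
  x \in sub_tens (N_part P 1) \/ x \in sub_tens (L_part 1)).

Definition tauA_neg : {pred tauA} := lspan (fun x =>
  x \in sub_tens (N_part [pred alpha | - alpha \in P] (-1)) \/
  x \in sub_tens (L_part (-1))).

(* The inclusion of tau^0(A) = hbar ⊗ A into tau(A). *)
Definition tauA0_incl : tensor (hbar h) A -> tauA :=
  tlift (fun x a => hbar_tau x ⊗ a).

Variable V : lieModType tauA.

Definition extremal_weight (T : {pred tauA}) : Prop :=
  exists v : V, [/\ v != 0, generates v,
    forall x, x \in T -> lact x v = 0 &
    exists psi : {linear tensor (hbar h) A -> F^o},
      forall x, lact (tauA0_incl x) v = (psi x : F) *: v].

Definition highest_weight_module : Prop := extremal_weight tauA_pos.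
Definition lowest_weight_module : Prop := extremal_weight tauA_neg.

Definition weight_space (lambda : dual (hbar h)) (v : V) : Prop :=
  forall x : hbar h, lact (hbar_tau x ⊗ 1 : tauA) v = (lambda x : F) *: v.

Definition integrable_module : Prop :=
  [/\ direct_sum weight_space,
      forall lambda, fin_dim (weight_space lambda) &
      forall (v : V) (alpha : dual (subvs_of h)) (n : int) (X : g) (a : A),
        is_root alpha -> root_space alpha X ->
        exists N : nat, iter N (lact (tauX B X n ⊗ a : tauA)) v = 0].

End TauModules.

(* Main.v *)
Require Import Defs.
From HB Require Import structures.
From mathcomp Require Import all_boot all_order all_algebra.
From mathcomp Require Import boolp reals complex ring zify.

(* h acts diagonally on V, on which g acts faithfully, so h is abelian and g is the
   sum of its root spaces; this replaces the use of Cartan's criterion.  Let K act by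
   k and let s be the L_0-degree of a weight, counted with a sign making all the
   numbers l_alpha = +-k (X_alpha, Y_alpha) positive; such a sign exists because the
   form is a multiple of the trace form, which is positive on coroots.  The sl2-triple
   of the real root alpha + n delta acts on the weight a by a(H_alpha) + n l_alpha,
   which is positive for large n; there the lowering operators are injective and
   weight multiplicities decrease along alpha + n delta, so at a place of minimal
   multiplicity the raising operators would be injective as well if no multiplicity
   were 0.  Hence every delta-string of weights is bounded above.  If
   a(H_alpha) < - l_alpha, then a + alpha + delta is again a weight and the norm of a
   has dropped, so every weight can be moved upwards into the finitely many classes
   with |a(H_alpha)| <= l_alpha, and all degrees are bounded above.  In the top degree
   there are finitely many weights; one that is maximal for the positive system has a
   weight space killed by tau^+(A) (or tau^-(A)), and a common eigenvector of the
   commuting family tau^0(A) in this finite dimensional space generates V. *)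

Set Implicit Arguments.
Unset Strict Implicit.
Unset Printing Implicit Defensive.

Import Order.TTheory GRing.Theory Num.Theory.
Local Open Scope ring_scope.

(** * Finite dimensional subspaces and commuting operators *)

Section Subspaces.
Variable F : fieldType.

Definition is_subspace (V : lmodType F) (W : V -> Prop) : Prop :=
  W 0 /\ forall c u v, W u -> W v -> W (c *: u + v).

Section IsSubspace.
Variables (V : lmodType F) (W : V -> Prop).
Hypothesis Ws : is_subspace W.

Lemma is_subspaceZ c v : W v -> W (c *: v).
Proof. by move=> Wv; rewrite -[_ *: _]addr0; apply: Ws.2 => //; exact: Ws.1. Qed.

Lemma is_subspaceD u v : W u -> W v -> W (u + v).
Proof. by move=> Wu Wv; rewrite -[u]scale1r; apply: Ws.2. Qed.

Lemma is_subspaceB u v : W u -> W v -> W (u - v).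
Proof.
by move=> Wu Wv; rewrite -scaleN1r; apply: is_subspaceD => //; apply: is_subspaceZ.
Qed.

Lemma is_subspace_sum (I : Type) (r : seq I) (E : I -> V) :
  (forall i, W (E i)) -> W (\sum_(i <- r) E i).
Proof.
by move=> WE; elim/big_ind: _ => [|x y|i _] //; [exact: Ws.1|exact: is_subspaceD].
Qed.
End IsSubspace.

Lemma lspan_subspace (V : lmodType F) (X W : V -> Prop) : is_subspace W ->
  (forall x, X x -> W x) -> forall v, v \in lspan X -> W v.
Proof. by move=> [W0 WD] XW; apply: lspan_ind. Qed.

(** Dimensions are bounded, so some [U] inside [S] has maximal dimension; a vector of [S] outside
    [U] could be adjoined to it. *)
Lemma vspace_of_subspace (vT : vectType F) (S : vT -> Prop) : is_subspace S ->
  exists U : {vspace vT}, forall x, (x \in U) <-> S x.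
Proof.
move=> Ss.
pose Q n := `[< exists2 U : {vspace vT}, forall x, x \in U -> S x & \dim U = n >].
have exQ : exists n, Q n.
  exists 0%N; apply/asboolP; exists 0%VS; last exact: dimv0.
  by move=> x; rewrite memv0 => /eqP ->; exact: Ss.1.
have bQ n : Q n -> (n <= dim vT)%N.
  by move=> /asboolP[U _ <-]; rewrite -dimvf; apply: dimvS; exact: subvf.
case: (ex_maxnP exQ bQ) => n /asboolP[U US dU] maxn.
exists U => x; split=> [/US //|Sx].
have /maxn : Q (\dim (U + <[x]>)).
  apply/asboolP; exists (U + <[x]>)%VS => // y /memv_addP[u /US Su [_ /vlineP[c ->] ->]].
  by apply: is_subspaceD => //; apply: is_subspaceZ.
rewrite -dU => le_d.
have /eqP -> : U == (U + <[x]>)%VS by rewrite eqEdim addvSl.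
exact/(subvP (addvSr _ _))/memv_line.
Qed.

(** The ambient [V] may be infinite dimensional, so a dimension is witnessed by an explicit
    isomorphism from row vectors onto [W]. *)
Definition hasdim (V : lmodType F) (W : V -> Prop) (n : nat) : Prop :=
  exists phi : 'rV[F]_n -> V,
    [/\ linear phi, injective phi & forall v, W v <-> exists r, v = phi r].

(** Inside the preimage [U] of [W], a complement [D] of the kernel is mapped isomorphically onto
    [W]; coordinates on [D] give the parametrization. *)
Lemma hasdim_of_image (V : lmodType F) (W : V -> Prop) m (psi : 'rV[F]_m -> V) :
  is_subspace W -> linear psi -> (forall v, W v -> exists r, v = psi r) ->
  exists n, hasdim W n.
Proof.
move=> Ws psil Wpsi.
have [U UP] : exists U : {vspace 'rV[F]_m}, forall x, (x \in U) <-> W (psi x).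
  apply: vspace_of_subspace; split=> [|c u v Wu Wv].
    by rewrite (lin0 psil); exact: Ws.1.
  by rewrite psil; apply: Ws.2.
have [K KP] : exists K : {vspace 'rV[F]_m}, forall x, (x \in K) <-> psi x = 0.
  apply: vspace_of_subspace; split=> [|c u v pu pv]; first exact: lin0.
  by rewrite psil pu pv scaler0 addr0.
pose D := (U :\: K)%VS; pose n := \dim D.
pose e (r : 'rV[F]_n) := \sum_i r 0 i *: (vbasis D)`_i.
have el : linear e.
  move=> c u v; rewrite /e scaler_sumr -big_split; apply: eq_bigr => i _ /=.
  by rewrite !mxE scalerDl scalerA.
have eD r : e r \in D.
  apply: rpred_sum => i _; apply: rpredZ; apply: vbasis_mem.
  by apply: mem_nth; rewrite size_tuple.
have DK x : x \in D -> x \in K -> x = 0.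
  move=> xD xK; have : x \in (D :&: K)%VS by rewrite memv_cap xD xK.
  by rewrite capv_diff memv0 => /eqP.
exists n, (fun r => psi (e r)); split.
- by apply: lin_comp.
- move=> r s /eqP; rewrite -subr_eq0 -(linB psil) -(linB el) => /eqP/KP eK.
  have e0 := DK _ (eD _) eK.
  apply/eqP; rewrite -subr_eq0; apply/eqP/rowP => i.
  move: e0; have /andP[_ fD] := vbasisP D.
  by move=> /(freeP fD) /(_ i); rewrite mxE => ->; rewrite mxE.
- move=> v; split=> [Wv|[r ->]]; last first.
    by apply/UP; apply: (subvP (diffvSl U K)); exact: eD.
  have [r vE] := Wpsi _ Wv.
  have : r \in U by apply/UP; rewrite -vE.
  rewrite -(addv_diff_cap U K) => /memv_addP[x xD [y yK rE]].
  have py : psi y = 0 by apply/KP; apply: (subvP (capvSr U K)).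
  exists (\row_i coord (vbasis D) i x).
  rewrite vE rE (linD psil) py addr0; congr psi.
  rewrite {1}(coord_vbasis xD); apply: eq_bigr => i _.
  by rewrite mxE.
Qed.

Lemma hasdim_of_span (V : lmodType F) (W : V -> Prop) (s : seq V) :
  is_subspace W -> (forall v, W v -> v \in lspan (fun x => x \in s)) ->
  exists n, hasdim W n.
Proof.
move=> Ws sW.
pose psi (r : 'rV[F]_(size s)) := \sum_i r 0 i *: s`_i.
have psil : linear psi.
  move=> c u v; rewrite /psi scaler_sumr -big_split; apply: eq_bigr => i _ /=.
  by rewrite !mxE scalerDl scalerA.
apply: (hasdim_of_image Ws psil) => v /sW.
apply: (lspan_subspace (W := fun v => exists r, v = psi r)).
  split; first by exists 0; rewrite (lin0 psil).
  by move=> c _ _ [u ->] [w ->]; exists (c *: u + w); rewrite psil.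
move=> x /nthP-/(_ 0)[i lti <-]; exists (delta_mx 0 (Ordinal lti)).
rewrite /psi (bigD1 (Ordinal lti)) //= mxE !eqxx scale1r big1 ?addr0 // => j ne.
by rewrite mxE eqxx /= (negPf ne) scale0r.
Qed.

Lemma hasdim_inj (V V' : lmodType F) (W : V -> Prop) (W' : V' -> Prop) n m
    (f : V -> V') : linear f -> hasdim W n -> hasdim W' m ->
  (forall v, W v -> W' (f v)) -> (forall v, W v -> f v = 0 -> v = 0) ->
  (n <= m)%N /\ ((m <= n)%N -> forall w, W' w -> exists2 v, W v & w = f v).
Proof.
move=> fl [phi [pl pinj pW]] [phi' [pl' pinj' pW']] fW finj.
have /choice[G GE] : forall r : 'rV[F]_n, exists s, f (phi r) = phi' s.
  by move=> r; apply/pW'/fW/pW; exists r.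
have Gl : linear G.
  by move=> c r s; apply: pinj'; rewrite pl' -!GE pl fl.
have GMl : {M : 'M[F]_(n, m) | forall r, G r = r *m M}.
  exists (\matrix_i G (delta_mx 0 i)) => r.
  rewrite mulmx_sum_row {1}(row_sum_delta r) (lin_sum Gl).
  by apply: eq_bigr => i _; rewrite (linZ Gl) rowK.
case: GMl => M GM.
have Mfree : row_free M.
  rewrite -kermx_eq0; apply/rowV0P => r /sub_kermxP; rewrite -GM => G0.
  apply: pinj; rewrite (lin0 pl); apply: finj; first by apply/pW; exists r.
  by rewrite GE G0 (lin0 pl').
have le_nm : (n <= m)%N by rewrite -(eqP Mfree) rank_leq_col.
split=> // le_mn w /pW'[s ->].
have full : row_full M by rewrite /row_full (eqP Mfree) eqn_leq le_nm le_mn.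
have /submxP[r ->] : (s <= M)%MS by exact: submx_full.
by exists (phi r); [apply/pW; exists r|rewrite GE GM].
Qed.

Lemma hasdim0 (V : lmodType F) (W : V -> Prop) n :
  hasdim W n -> (exists2 v, W v & v <> 0) <-> (0 < n)%N.
Proof.
move=> [phi [pl pinj pW]]; split=> [[v /pW[r ->]]|].
  case: n phi pl pinj pW r => // phi pl _ _ r.
  by rewrite thinmx0 (lin0 pl).
case: n phi pl pinj pW => // n phi pl pinj pW _.
exists (phi (delta_mx 0 0)); first by apply/pW; exists (delta_mx 0 0).
rewrite -(lin0 pl) => /pinj /rowP /(_ 0); rewrite !mxE !eqxx /= => /eqP.
by rewrite oner_eq0.
Qed.

Lemma hasdim_sub (V : lmodType F) (W W' : V -> Prop) n m :
  hasdim W n -> hasdim W' m -> (forall v, W v -> W' v) ->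
  (n <= m)%N /\ ((m <= n)%N -> forall v, W' v -> W v).
Proof.
move=> dW dW' WW'.
have [le_nm H] := hasdim_inj (@lin_id F V) dW dW' WW' (fun _ _ => id).
by split=> // le_mn v /(H le_mn)[w Ww ->].
Qed.

Lemma hasdim_subspace (V : lmodType F) (W W' : V -> Prop) n :
  hasdim W n -> is_subspace W' -> (forall v, W' v -> W v) ->
  exists m, hasdim W' m.
Proof.
move=> [phi [pl _ pW]] W's W'W; apply: (hasdim_of_image W's pl) => v /W'W.
by move/pW.
Qed.

Lemma is_subspace_hasdim (V : lmodType F) (W : V -> Prop) n :
  hasdim W n -> is_subspace W.
Proof.
move=> [phi [pl _ pW]]; split=> [|c u v /pW[r ->] /pW[s ->]]; apply/pW.
  by exists 0; rewrite (lin0 pl).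
by exists (c *: r + s); rewrite pl.
Qed.

Lemma exists_free_sub (vT : vectType F) (s : seq vT) :
  exists t, [/\ free t, {subset t <= s} & <<t>>%VS = <<s>>%VS].
Proof.
elim: s => [|x s [t [ft ts tE]]]; first by exists [::]; split=> //; rewrite nil_free.
case: (boolP (x \in <<t>>%VS)) => xt.
  exists t; split=> // [y /ts ys|]; first by rewrite in_cons ys orbT.
  by rewrite span_cons -tE; apply/esym/addv_idPr; rewrite -memvE.
exists (x :: t); split; first by rewrite free_cons xt.
  by move=> y; rewrite !in_cons => /orP[->//|/ts ->]; rewrite orbT.
by rewrite !span_cons tE.
Qed.

End Subspaces.

(** * Split polynomials of an operator, eigenspace decompositions and common eigenvectors *)

Section Diagonalization.
Variable F : closedFieldType.

(** A polynomial in [f], given by its roots, evaluated at [x]. *)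
Definition sub_prod (U : lmodType F) (f : U -> U) (rs : seq F) (x : U) : U :=
  foldr (fun c y => f y - c *: y) x rs.

Section SubProd.
Variables (U : lmodType F) (f : U -> U).
Hypothesis fl : linear f.

Lemma sub_scale_linear c : linear (fun y => f y - c *: y).
Proof. by apply: lin_add => //; apply: lin_opp; apply: lin_scale; exact: lin_id. Qed.

Lemma sub_scaleC b c y :
  f (f y - c *: y) - b *: (f y - c *: y) = f (f y - b *: y) - c *: (f y - b *: y).
Proof.
rewrite !(linB fl) !(linZ fl) !scalerBr !scalerA [c * b]mulrC !opprB !addrA.
by rewrite [LHS]addrAC [RHS]addrAC; congr (_ + _); rewrite addrAC.
Qed.

Lemma sub_prodC c rs x :
  sub_prod f rs (f x - c *: x) = f (sub_prod f rs x) - c *: sub_prod f rs x.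
Proof. by elim: rs => //= b rs ->; rewrite sub_scaleC. Qed.

Lemma sub_prod_rem c rs x : c \in rs ->
  sub_prod f rs x = sub_prod f (c :: rem c rs) x.
Proof.
elim: rs => //= b rs IH; rewrite in_cons eq_sym.
by case: eqP => [->//|_] /= /IH -> /=; rewrite sub_scaleC.
Qed.

(** The factors commute, so a repeated one can be brought to the front twice; the hypothesis, the
    absence of generalized eigenvectors, cancels one copy. *)
Lemma sub_prod_undup rs x :
  (forall c y, f (f y - c *: y) - c *: (f y - c *: y) = 0 -> f y - c *: y = 0) ->
  sub_prod f rs x = 0 -> sub_prod f (undup rs) x = 0.
Proof.
move=> ss; elim: rs x => // c rs IH x /= H0; case: ifPn => crs /=; last first.
  by rewrite -sub_prodC; apply: IH; rewrite sub_prodC.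
apply: IH; move: H0; rewrite (sub_prod_rem _ crs) /=.
exact: ss.
Qed.

(* Lagrange interpolation: the components are obtained by applying polynomials in f. *)
Lemma sub_prod_decomp (S : U -> Prop) rs x : is_subspace S ->
  (forall y, S y -> S (f y)) -> uniq rs -> S x -> sub_prod f rs x = 0 ->
  exists y : F -> U, x = \sum_(c <- rs) y c /\
    forall c, S (y c) /\ f (y c) = c *: y c.
Proof.
move=> Ss Sf; elim: rs x => [|c rs IH] x /=.
  move=> _ _ ->; exists (fun=> 0); split; first by rewrite big_nil.
  by move=> c; rewrite (lin0 fl) scaler0; split=> //; exact: Ss.1.
move=> /andP[crs urs] Sx; rewrite -sub_prodC => H0.
have Sx' : S (f x - c *: x).
  by apply: is_subspaceB => //; [exact: Sf|exact: is_subspaceZ].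
have [y [yE yP]] := IH _ urs Sx' H0.
(* By induction [y] decomposes the image of [x] under [f - c]. On the [b]-eigenspace that operator
   is multiplication by [b - c], so the [z b] account for [x] up to a [c]-eigenvector [w]. *)
pose z b := (b - c)^-1 *: y b.
have Sz b : S (z b) by apply: is_subspaceZ => //; case: (yP b).
have fz b : f (z b) = b *: z b.
  by rewrite (linZ fl) (yP b).2 !scalerA mulrC.
pose w := x - \sum_(b <- rs) z b.
have fw : f w = c *: w.
  apply/eqP; rewrite -subr_eq0; apply/eqP.
  rewrite (linB (sub_scale_linear c) x) /= yE (lin_sum fl) scaler_sumr.
  rewrite -!sumrB big_seq big1 // => b brs.
  have bc : b - c != 0 by rewrite subr_eq0; apply: contraNneq crs => <-.
  by rewrite fz -scalerBl scalerA divff // scale1r subrr.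
exists (fun b => if b == c then w else z b); split.
  rewrite big_cons eqxx (eq_big_seq z) ?subrK // => b brs.
  by case: eqP brs crs => // -> ->.
move=> b; case: eqP => [->|_]; last by split.
split=> //; apply: is_subspaceB => //; exact: is_subspace_sum.
Qed.
End SubProd.

(** Cayley-Hamilton, the characteristic polynomial being split over a closed field. *)
Lemma sub_prod_mulmx n (M : 'M[F]_n) :
  exists rs, forall v : 'rV[F]_n, sub_prod (mulmx^~ M) rs v = 0.
Proof.
case: n M => [|n] M; first by exists [::] => v; rewrite /= thinmx0.
have [rs pE] := closed_field_poly_normal (char_poly M).
have pmon : lead_coef (char_poly M) = 1 by apply/eqP; exact: char_poly_monic.
exists rs => v; have := Cayley_Hamilton M; rewrite pE pmon scale1r => H0.
have : v *m horner_mx M (\prod_(z <- rs) ('X - z%:P)) = 0 by rewrite H0 mulmx0.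
move=> <-; elim: rs v {pE H0} => [|c rs IH] v.
  by rewrite big_nil rmorph1 mulmx1.
rewrite big_cons mulrC rmorphM /= mulmxA -IH.
by rewrite rmorphB /= horner_mx_X horner_mx_C mulmxBr mul_mx_scalar.
Qed.

Import VectorInternalTheory.

Lemma sub_prod_ann (vT : vectType F) (f : vT -> vT) : linear f ->
  exists rs, forall x, sub_prod f rs x = 0.
Proof.
move=> fl.
pose fr r := v2r (f (r2v r)).
have frl : linear fr by move=> c u v; rewrite /fr linearP fl linearP.
pose M := \matrix_i fr (delta_mx 0 i).
have fM x : v2r (f x) = v2r x *m M.
  rewrite mulmx_sum_row -{1}[x]v2rK -/(fr _) {1}(row_sum_delta (v2r x)).
  by rewrite (lin_sum frl); apply: eq_bigr => i _; rewrite (linZ frl) rowK.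
have [rs H] := sub_prod_mulmx M; exists rs => x.
apply: v2r_inj; rewrite linear0 -(H (v2r x)).
by elim: rs {H} => //= c rs <-; rewrite -fM -linearZ -linearB.
Qed.

(** Induction on the dimension: if some [f i] is not a scalar on [W], one of its eigenspaces in [W]
    is nonzero, strictly smaller and stable under the whole family. *)
Lemma commuting_eigenvector (V : lmodType F) (I : Type) (f : I -> V -> V)
    (W : V -> Prop) n :
  (forall i, linear (f i)) -> hasdim W n -> (0 < n)%N ->
  (forall i v, W v -> W (f i v)) ->
  (forall i j v, W v -> f i (f j v) = f j (f i v)) ->
  exists2 v, W v /\ v <> 0 & forall i, exists c, f i v = c *: v.
Proof.
move=> fl; elim/ltn_ind: n W => n IH W dW n_gt0 Wf fC.
have [W0 WD] := is_subspace_hasdim dW.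
have [v Wv v0] := (hasdim0 dW).2 n_gt0.
case: (pselect (forall i, exists c, forall w, W w -> f i w = c *: w)) => [sc|].
  by exists v => // i; have [c H] := sc i; exists c; exact: H.
move=> /existsNP[i nsc].
have [c [w [Ww w0 fw]]] : exists c w, [/\ W w, w <> 0 & f i w = c *: w].
  have [phi [pl pinj pW]] := dW.
  have /choice[G GE] : forall r : 'rV[F]_n, exists s, f i (phi r) = phi s.
    by move=> r; apply/pW/Wf/pW; exists r.
  have Gl : linear G by move=> c r s; apply: pinj; rewrite pl -!GE pl fl.
  have [rs ann] := sub_prod_ann Gl.
  have [r r0] : exists r : 'rV[F]_n, r <> 0.
    by have /pW[r vE] := Wv; exists r => r0; apply: v0; rewrite vE r0 (lin0 pl).
  (* The factors of an annihilating product are applied one at a time; the last nonzero vector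
     obtained is an eigenvector. *)
  have [c [s [s0 Gs]]] : exists c s, s <> 0 /\ G s = c *: s.
    elim: rs {ann} r r0 (ann r) => [|c rs IHr] r r0 /=; first by move=> /r0.
    rewrite -(sub_prodC Gl) => H.
    case: (pselect (G r - c *: r = 0)) => [/subr0_eq Gr|Gr]; first by exists c, r.
    exact: IHr Gr H.
  exists c, (phi s); split; first by apply/pW; exists s.
    by rewrite -(lin0 pl) => /pinj.
  by rewrite GE Gs (linZ pl).
pose W' u := W u /\ f i u = c *: u.
have W's : is_subspace W'.
  split; first by split=> //; rewrite (lin0 (fl i)) scaler0.
  move=> b x y [Wx fx] [Wy fy]; split; first exact: WD.
  by rewrite fl fx fy scalerDr !scalerA mulrC.
have [m dW'] := hasdim_subspace dW W's (fun _ => @proj1 _ _).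
have [le_mn Heq] := hasdim_sub dW' dW (fun _ => @proj1 _ _).
have lt_mn : (m < n)%N.
  rewrite ltn_neqAle le_mn andbT; apply/eqP => mn; apply: nsc; exists c => u Wu.
  by case: (Heq _ u Wu) => //; rewrite mn.
have m_gt0 : (0 < m)%N by apply/(hasdim0 dW'); exists w.
have [||u [[Wu fu] u0] H] := IH m lt_mn W' dW' m_gt0.
- move=> j u [Wu fu]; split; first exact: Wf.
  by rewrite fC // fu (linZ (fl j)).
- by move=> j k u [Wu _]; exact: fC.
by exists u.
Qed.

End Diagonalization.

(** * Representations of sl2 *)

Section Sl2.
Variables (F : numFieldType) (V : lmodType F) (e f : V -> V).
Hypotheses (el : linear e) (fl : linear f).

(** By induction [f] sends e^(i+1) u to -(i+1)(m+i+1) e^i u. These scalars never vanish, so the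
    chain of raised vectors cannot stop. *)
Lemma sl2_raise_neq0 u m : u <> 0 -> e (f u) = 0 ->
  (forall i, e (f (iter i e u)) - f (e (iter i e u)) =
     (m.+1 + 2 * i)%:R *: iter i e u) ->
  forall i, iter i e u <> 0.
Proof.
move=> u0 efu H.
have fE i : f (iter i.+1 e u) = - (i.+1 * (m + i.+1))%:R *: iter i e u.
  elim: i => [|i IH] /=.
    have := H 0%N => /=; rewrite efu sub0r => /(canRL (@opprK _)) ->.
    by rewrite scaleNr; congr (- (_%:R *: _)); lia.
  have /= fe := H i.+1; rewrite -[LHS](subKr (e (f (e (iter i e u))))) fe.
  rewrite IH (linZ el) -scaleNr -scalerDl; congr (_ *: _).
  by rewrite -opprD -natrD; congr (- _%:R); lia.
elim=> // i IH eu0; apply: IH; have /eqP := fE i.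
rewrite eu0 (lin0 fl) eq_sym scaler_eq0 oppr_eq0 pnatr_eq0 addnS /=.
by move=> /eqP.
Qed.

(** By induction [e] sends f^(i+1) v to [c i.+1] times f^i v. At the last nonzero f^i v this scalar
    has to vanish, which is the stated equation divided by [i.+1]. *)
Lemma sl2_highest_weight v (M q : F) N : v <> 0 -> e v = 0 ->
  (forall i, e (f (iter i f v)) - f (e (iter i f v)) =
     (M - q * i%:R) *: iter i f v) ->
  iter N f v = 0 -> exists i : nat, 2 * M = q * i%:R.
Proof.
move=> v0 ev H fN.
pose c i : F := i%:R * M - q * (i%:R * (i%:R - 1) / 2).
have eE i : e (iter i.+1 f v) = c i.+1 *: iter i f v.
  elim: i => [|i IH] /=.
    have /= := H 0%N => /(canRL (subrK _)) ->; rewrite ev (lin0 fl) addr0.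
    by congr (_ *: _); rewrite /c; field.
  have /= := H i.+1 => /(canRL (subrK _)) ->.
  rewrite IH (linZ fl) -scalerDl; congr (_ *: _).
  by rewrite /c -[i.+2]addn1 -[i.+1]addn1 !natrD; field.
have ex : exists i, (iter i.+1 f v == 0) && (iter i f v != 0).
  elim: N fN => [/v0//|N IH] fN.
  case: (altP (iter N f v =P 0)) => [/IH//|fN0].
  by exists N; rewrite fN0 fN eqxx.
have [i /andP[/eqP fi fi0]] := ex; exists i.
have /eqP := eE i; rewrite fi (lin0 el) eq_sym scaler_eq0 (negPf fi0) orbF => /eqP ci.
have i1 : i.+1%:R != 0 :> F by rewrite pnatr_eq0.
apply/eqP; rewrite -subr_eq0 -(mulrI_eq0 _ (mulfI i1)) -[X in _ == X](mulr0 2) -ci /c.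
by rewrite -[i.+1]addn1 !natrD; apply/eqP; field.
Qed.

Section Triple.
Variables (t : V -> V) (q : F).
Hypothesis ef : forall v, e (f v) - f (e v) = t v.
Hypothesis te : forall v, t (e v) - e (t v) = q *: e v.
Hypothesis tf : forall v, t (f v) - f (t v) = - q *: f v.

Lemma triple_weight_e v M i : t v = M *: v ->
  t (iter i e v) = (M + q * i%:R) *: iter i e v.
Proof.
move=> tv; elim: i => [|i IH] /=; first by rewrite mulr0 addr0.
have /(canRL (subrK _)) -> := te (iter i e v).
rewrite IH (linZ el) -scalerDl; congr (_ *: _).
by rewrite -[i.+1]addn1 natrD; ring.
Qed.

Lemma triple_weight_f v M i : t v = M *: v ->
  t (iter i f v) = (M - q * i%:R) *: iter i f v.
Proof.
move=> tv; elim: i => [|i IH] /=; first by rewrite mulr0 subr0.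
have /(canRL (subrK _)) -> := tf (iter i f v).
rewrite IH (linZ fl) -scalerDl; congr (_ *: _).
by rewrite -[i.+1]addn1 natrD; ring.
Qed.

(** Raising [v] as far as possible gives a vector of weight [M + q * i] killed by [e]. The scalar
    [q] is left free: [q = 2] is an sl2-triple, and [q = 0], where the conclusion reads [M = 0],
    serves to exclude degenerate roots. *)
Lemma triple_weight v M : v <> 0 -> t v = M *: v ->
  (forall u, exists N, iter N e u = 0) -> (forall u, exists N, iter N f u = 0) ->
  exists i j : nat, 2 * (M + q * i%:R) = q * j%:R.
Proof.
move=> v0 tv enil fnil.
have [i [ei0 eiS]] : exists i, iter i e v <> 0 /\ iter i.+1 e v = 0.
  have [N] := enil v; elim: N => [/v0//|N IH] eN.
  by case: (pselect (iter N e v = 0)) => [/IH//|]; exists N.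
have [N fN] := fnil (iter i e v).
exists i; apply: (sl2_highest_weight ei0 eiS _ fN) => j.
by rewrite ef (triple_weight_f _ (triple_weight_e _ tv)).
Qed.
End Triple.

End Sl2.

Section Sl2Triple.
Variables (F : numFieldType) (V : lmodType F) (e f t : V -> V).
Hypotheses (el : linear e) (fl : linear f).
Hypothesis ef : forall v, e (f v) - f (e v) = t v.
Hypothesis te : forall v, t (e v) - e (t v) = 2 *: e v.
Hypothesis tf : forall v, t (f v) - f (t v) = - 2 *: f v.

Lemma sl2_weight_int v M : v <> 0 -> t v = M *: v ->
  (forall u, exists N, iter N e u = 0) -> (forall u, exists N, iter N f u = 0) ->
  exists z : int, M = z%:~R.
Proof.
move=> v0 tv en fn; have [i [j H]] := triple_weight el fl ef te tf v0 tv en fn.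
exists (j%:Z - 2 * i%:Z); rewrite intrB intrM -!pmulrn.
have two0 : 2 != 0 :> F by rewrite pnatr_eq0.
by rewrite -(mulfI two0 H) addrK.
Qed.

(** If [u] were nonzero, its raised vectors would all be nonzero, against the nilpotency of [e] on
    [u]. *)
Lemma sl2_raise_inj u m : t u = m.+1%:R *: u -> e (f u) = 0 ->
  (exists N, iter N e u = 0) -> u = 0.
Proof.
move=> tu efu [N eN]; apply: contrapT => u0.
suff /(sl2_raise_neq0 el fl u0 efu)/(_ N) : forall i,
    e (f (iter i e u)) - f (e (iter i e u)) = (m.+1 + 2 * i)%:R *: iter i e u.
  by rewrite eN.
move=> i; by rewrite ef (triple_weight_e el te i tu) natrD natrM.
Qed.

End Sl2Triple.

(** * Root space decomposition *)

Lemma dual_of_linear (F : fieldType) (U : vectType F) (f : U -> F^o) :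
  linear f -> exists a : dual U, forall x, a x = f x.
Proof.
move=> fl; pose fL := GRing.isLinear.Build _ _ _ _ f fl.
pose fP : {linear U -> F^o} := HB.pack f fL.
by exists (linfun fP) => x; rewrite lfunE.
Qed.

Section Rep.
Variables (F : numClosedFieldType) (g : finLieAlgType F) (h : {vspace g}).
Variable V : lmodType F.

Notation hdual := (dual (subvs_of h)).

Definition rho_weight (rho : g -> V -> V) (a : hdual) (v : V) : Prop :=
  forall H, rho (vsval H) v = (a H : F) *: v.

Record integrable_rep (rho : g -> V -> V) : Prop := IntegrableRep {
  rep_bilin : bilin rho;
  rep_lie : forall x y v,
    rho (lie x y) v = rho x (rho y v) - rho y (rho x v);
  rep_faithful : forall x, (forall v, rho x v = 0) -> x = 0;
  rep_span : forall v, v \in lspan (fun u => exists a, rho_weight rho a u);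
  rep_ss : forall (H : subvs_of h) (c : F) (v : V),
    rho (vsval H) (rho (vsval H) v - c *: v) -
      c *: (rho (vsval H) v - c *: v) = 0 -> rho (vsval H) v - c *: v = 0;
  rep_nil : forall (alpha : hdual) x v, is_root alpha -> root_space alpha x ->
    exists N, iter N (rho x) v = 0 }.

Variable rho : g -> V -> V.
Hypothesis rhoI : integrable_rep rho.
Let rho_bilin := rep_bilin rhoI.
Let rho_lie := rep_lie rhoI.

Lemma rho_eq0 x : (forall a v, rho_weight rho a v -> rho x v = 0) -> x = 0.
Proof.
move=> H; apply: (rep_faithful rhoI) => v; have := rep_span rhoI v.
apply: (lspan_subspace (W := fun v => rho x v = 0)) => [|u [a /H //]].
split=> [|c u w u0 w0]; first exact: (lin0 (rho_bilin.2 x)).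
by rewrite rho_bilin.2 u0 w0 scaler0 addr0.
Qed.

Lemma cartan_abelian (H H' : subvs_of h) : lie (vsval H) (vsval H') = 0.
Proof.
apply: rho_eq0 => a v av.
by rewrite rho_lie !av !(linZ (rho_bilin.2 _)) !av !scalerA mulrC subrr.
Qed.

Lemma lie_cartanC (H H' : subvs_of h) x :
  lie (vsval H) (lie (vsval H') x) = lie (vsval H') (lie (vsval H) x).
Proof.
have := lie_jacobi (vsval H) (vsval H') x.
rewrite cartan_abelian lie0r addr0 [lie x _]lieC lieNr => /eqP.
by rewrite subr_eq0 => /eqP.
Qed.

(** On a weight vector [v] of weight [a], the operator [Y] sends [v] to the image of [rho y v] under
    [rho H - (a H + c)], and [H, Y] = c Y says that the same operator kills [rho Y v]. Hence
    [rep_ss] gives [rho Y v = 0], and faithfulness gives [Y = 0]. *)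
Lemma ad_cartan_ss (H : subvs_of h) c y :
  lie (vsval H) (lie (vsval H) y - c *: y) - c *: (lie (vsval H) y - c *: y) = 0 ->
  lie (vsval H) y - c *: y = 0.
Proof.
set Y := _ - c *: y => /subr0_eq HY; apply: rho_eq0 => a v av.
have YE u : rho Y u = rho (lie (vsval H) y) u - c *: rho y u.
  by rewrite (linB (rho_bilin.1 u)) (linZ (rho_bilin.1 u)).
have YvE : rho Y v = rho (vsval H) (rho y v) - (a H + c) *: rho y v.
  by rewrite YE rho_lie av (linZ (rho_bilin.2 _)) scalerDl opprD addrA.
rewrite YvE; apply: (rep_ss rhoI); rewrite -YvE.
have : rho (lie (vsval H) Y) v = c *: rho Y v by rewrite HY (linZ (rho_bilin.1 v)).
rewrite rho_lie av (linZ (rho_bilin.2 _)) => /(canRL (subrK _)) ->.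
by rewrite -scalerDl [c + _]addrC subrr.
Qed.

Lemma root_space_of_eigen (x : g) :
  (forall H, exists c : F, lie (vsval (H : subvs_of h)) x = c *: x) ->
  exists gam : hdual, root_space gam x.
Proof.
move=> eig; case: (altP (x =P 0)) => [->|x0].
  by exists 0 => H; rewrite lie0r scaler0.
have [c cP] := choice eig.
have cl : linear (c : subvs_of h -> F^o).
  move=> k H H'; apply/eqP; rewrite -subr_eq0.
  have : (c (k *: H + H') - (k * c H + c H')) *: x = 0.
    rewrite scalerBl scalerDl -scalerA -!cP linearP.
    by rewrite (lie_bilin.1 x) subrr.
  by move/eqP; rewrite scaler_eq0 (negPf x0) orbF.
have [gam gamE] := dual_of_linear cl.
by exists gam => H; rewrite gamE.
Qed.

(** Simultaneous diagonalization of the adjoint action of [h], adding one element of [h] at a time;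
    common eigenvectors for a basis of [h] are root vectors. *)
Lemma root_vectors_span (x : g) :
  x \in lspan (fun y => exists gam : hdual, root_space gam y).
Proof.
pose eig (Hs : seq (subvs_of h)) z := forall H, H \in Hs ->
  exists c : F, lie (vsval H) z = c *: z.
have spanE (Hs : seq (subvs_of h)) y : y \in lspan (eig Hs).
  elim: Hs y => [|H Hs IH] y; first by apply: mem_lspan.
  have := IH y; apply: (lspan_subspace (W := fun y => y \in lspan _)).
    by split=> [|c u v Su Sv]; [exact: rpred0|rewrite rpredD ?rpredZ].
  move=> z zP; have [c cP] : exists c : subvs_of h -> F,
      forall H', H' \in Hs -> lie (vsval H') z = c H' *: z.
    have /choice[c cP] : forall H', exists b : F,
        H' \in Hs -> lie (vsval H') z = b *: z.
      move=> H'; case: (boolP (H' \in Hs)) => [/zP[b bP]|_]; last by exists 0.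
      by exists b.
    by exists c.
  (* The joint eigenspace containing [z]. It is stable under [H] because [h] is abelian, so the
     components of [z] under [H] remain eigenvectors for [Hs]. *)
  pose S w := forall H', H' \in Hs -> lie (vsval H') w = c H' *: w.
  have Ss : is_subspace S.
    split=> [H' _|b u v Su Sv H' H'Hs]; first by rewrite lie0r scaler0.
    by rewrite lie_bilin.2 Su // Sv // scalerDr !scalerA mulrC.
  have SH w : S w -> S (lie (vsval H) w).
    by move=> Sw H' H'Hs; rewrite lie_cartanC Sw // (linZ (lie_bilin.2 _)).
  have [rs ann] := sub_prod_ann (lie_bilin.2 (vsval H)).
  have ann' : sub_prod (lie (vsval H)) (undup rs) z = 0.
    by apply: sub_prod_undup => //; [exact: lie_bilin.2|exact: ad_cartan_ss].
  have [w [-> wP]] := sub_prod_decomp (lie_bilin.2 _) Ss SH (undup_uniq rs) cP ann'.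
  apply: rpred_sum => b _; apply: mem_lspan => H'; rewrite in_cons.
  case/orP=> [/eqP ->|H'Hs]; first by exists b; exact: (wP b).2.
  by exists (c H'); exact: (wP b).1.
have := spanE (vbasis fullv) x.
apply: (lspan_subspace (W := fun y => y \in lspan _)).
  by split=> [|c u v Su Sv]; [exact: rpred0|rewrite rpredD ?rpredZ].
move=> z zP; apply: mem_lspan; apply: root_space_of_eigen => H.
pose S H' := exists c : F, lie (vsval (H' : subvs_of h)) z = c *: z.
have Ss : is_subspace S.
  split; first by exists 0; rewrite linear0 lie0l scale0r.
  move=> c H1 H2 [c1 E1] [c2 E2]; exists (c * c1 + c2).
  by rewrite linearP lie_bilin.1 E1 E2 scalerDl scalerA.
rewrite (coord_vbasis (memvf H)); apply: (is_subspace_sum Ss) => i.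
by apply: is_subspaceZ => //; apply: zP; apply: mem_nth; rewrite size_tuple.
Qed.

Lemma root_basis : exists n (b : n.-tuple g) (gam : 'I_n -> hdual),
  basis_of fullv b /\ forall i, root_space (gam i) b`_i.
Proof.
pose rv (y : g) := exists gam : hdual, root_space gam y.
have [s [srv sspan]] : exists s : seq g,
    (forall y, y \in s -> rv y) /\ {subset (vbasis fullv : seq g) <= <<s>>%VS}.
  elim: (vbasis fullv : seq g) => [|x l [s [srv sl]]]; first by exists [::].
  have [s' [s'rv xs']] : exists s' : seq g, (forall y, y \in s' -> rv y) /\ x \in <<s'>>%VS.
    have := root_vectors_span x.
    apply: (lspan_subspace (W := fun x => exists s' : seq g,
      (forall y, y \in s' -> rv y) /\ x \in <<s'>>%VS)).
      split; first by exists [::]; split=> //; exact: mem0v.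
      move=> c u v [s1 [s1r us1]] [s2 [s2r vs2]]; exists (s1 ++ s2); split.
        by move=> y; rewrite mem_cat => /orP[/s1r|/s2r].
      by rewrite span_cat memv_add // memvZ.
    move=> y yr; exists [:: y]; split; last by rewrite memv_span ?mem_head.
    by move=> w; rewrite inE => /eqP ->.
  exists (s' ++ s); split; first by move=> y; rewrite mem_cat => /orP[/s'rv|/srv].
  move=> y; rewrite in_cons span_cat => /orP[/eqP ->|/sl ys].
    exact: (subvP (addvSl _ _)).
  exact: (subvP (addvSr _ _)).
have [t [ft ts tE]] := exists_free_sub s.
have /choice[gam gamP] : forall i : 'I_(size t), rv (in_tuple t)`_i.
  by move=> i; apply: srv; apply: ts; apply: mem_nth.
exists (size t), (in_tuple t), gam; split=> //.
rewrite /basis_of ft andbT tE eqEsubv subvf /=.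
by rewrite -(span_basis (vbasisP fullv)); apply/span_subvP.
Qed.

Lemma root_space_lie (gam gam' : hdual) x y :
  root_space gam x -> root_space gam' y -> root_space (gam + gam') (lie x y).
Proof.
move=> gx gy H; have := lie_jacobi (vsval H) x y.
rewrite [lie y (vsval H)]lieC gx gy lieNr (linZ (lie_bilin.2 _)).
rewrite (linZ (lie_bilin.2 _)) [lie y x]lieC scalerN lfunE /= scalerDl.
by rewrite -addrA -opprD => /subr0_eq ->; rewrite addrC.
Qed.

Lemma cartan_root_space0 (H : subvs_of h) : root_space (0 : hdual) (vsval H).
Proof. by move=> H'; rewrite cartan_abelian lfunE scale0r. Qed.

Lemma rho_weightD (gam a : hdual) x v : root_space gam x ->
  rho_weight rho a v -> rho_weight rho (a + gam) (rho x v).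
Proof.
move=> gx av H; have := rho_lie (vsval H) x v.
rewrite gx (linZ (rho_bilin.1 v)) av (linZ (rho_bilin.2 _)) lfunE /= scalerDl.
by move=> /esym/(canRL (subrK _)) ->; rewrite addrC.
Qed.

End Rep.

(** * Invariant forms and the sl2-triple of a root *)

Definition invariant_form (F : fieldType) (g : lieAlgType F)
    (beta : g -> g -> F^o) : Prop :=
  [/\ bilin beta, forall x y, beta x y = beta y x &
      forall x y z, beta (lie x y) z = beta x (lie y z)].

Definition sl2_triple (F : fieldType) (g : finLieAlgType F) (h : {vspace g})
    (B : invForm g) (alpha : dual (subvs_of h)) (X Y : g) (H : subvs_of h) : Prop :=
  [/\ root_space alpha X, root_space (- alpha) Y, lie X Y = vsval H,
      alpha H = 2 & B X Y != 0].

Lemma form_invariant (F : fieldType) (g : lieAlgType F) (B : invForm g) :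
  invariant_form B.
Proof. by split; [exact: form_bilin|exact: form_sym|exact: form_inv]. Qed.

Section InvariantForms.
Variables (F : fieldType) (g : finLieAlgType F) (h : {vspace g}).
Variable beta : g -> g -> F^o.
Hypothesis betaI : invariant_form beta.
Notation hdual := (dual (subvs_of h)).
Let bl := let: And3 b _ _ := betaI in b.
Let binv := let: And3 _ _ b := betaI in b.

(** Moving [H] from one argument to the other shows that [gam H + gam' H] annihilates [beta x y]. *)
Lemma inv_form_orth (gam gam' : hdual) x y : root_space gam x ->
  root_space gam' y -> gam + gam' != 0 -> beta x y = 0.
Proof.
move=> gx gy ne; apply/eqP; apply: contraNT ne => bxy; apply/eqP/lfunP => H.
have : beta (lie (vsval H) x) y = - beta x (lie (vsval H) y).
  by rewrite lieC (linN (bl.1 y)) binv.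
rewrite gx gy (linZ (bl.1 y)) (linZ (bl.2 x)) => /eqP.
rewrite -addr_eq0 -scalerDl scaler_eq0 (negPf bxy) orbF => /eqP.
by rewrite !lfunE.
Qed.

Lemma inv_form_cartan (alpha : hdual) X Y (H H' : subvs_of h) :
  root_space (- alpha) Y -> lie X Y = vsval H ->
  beta (vsval H) (vsval H') = (alpha H' : F) * beta X Y.
Proof.
move=> aY <-; rewrite binv lieC aY lfunE /= scaleNr opprK.
exact: (linZ (bl.2 X)).
Qed.
End InvariantForms.

Section Triples.
Variables (F : numClosedFieldType) (g : finLieAlgType F) (h : {vspace g}).
Variables (V : lmodType F) (rho : g -> V -> V) (B : invForm g).
Hypotheses (h_cartan : cartan_subalgebra h) (rhoI : integrable_rep h rho).
Notation hdual := (dual (subvs_of h)).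
Let rho_bilin := rep_bilin rhoI.
Let rho_lie := rep_lie rhoI.

(** A vector commuting with [h] normalizes [h], and a Cartan subalgebra is its own normalizer. *)
Lemma root_space0 x : root_space (0 : hdual) x -> exists H : subvs_of h, x = vsval H.
Proof.
case: h_cartan => _ _ norm x0; suff xh : x \in h.
  by exists (vsproj h x); rewrite vsprojK.
apply: norm => y yh; have := x0 (vsproj h y); rewrite vsprojK // lieC lfunE scale0r.
by move/eqP; rewrite oppr_eq0 => /eqP ->; exact: mem0v.
Qed.

(** All root spaces other than that of [- alpha] are orthogonal to [x]; if this one were too, [x]
    would be in the radical of [B]. *)
Lemma form_pairing (alpha : hdual) x : x != 0 -> root_space alpha x ->
  exists2 y, root_space (- alpha) y & B x y != 0.
Proof.
move=> x0 ax; apply: contrapT => /forall2NP H; case/eqP: x0.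
apply: (form_nondeg (i := B)) => y; have := root_vectors_span rhoI y.
apply: (lspan_subspace (W := fun y => B x y = 0)).
  split=> [|c u v u0 v0]; first exact: (lin0 ((form_bilin B).2 x)).
  by rewrite (form_bilin B).2 u0 v0 scaler0 addr0.
move=> z [gam gz]; case: (altP (alpha + gam =P 0)) => [E|ne]; last first.
  exact: (inv_form_orth (form_invariant B) ax gz).
have zE : root_space (- alpha) z by rewrite -[- alpha]addr0 -E addKr.
by have [//|/negP] := H z; rewrite negbK => /eqP.
Qed.

Lemma is_root_opp (alpha : hdual) : is_root alpha -> is_root (- alpha).
Proof.
move=> [a0 [x x0 ax]]; split; first by rewrite oppr_eq0.
have [y ay Bxy] := form_pairing x0 ax; exists y => //.
by apply: contraNneq Bxy => ->; rewrite (lin0 ((form_bilin B).2 x)).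
Qed.

(** The point is that [alpha T] is nonzero for T = [X, Y]. Otherwise [triple_weight] with [q = 0]
    makes [T] act by zero on every weight vector, so [T = 0] by faithfulness, and pairing [T] with
    [h] gives [alpha = 0]. It remains to rescale [Y]. *)
Lemma sl2_triple_exists (alpha : hdual) : is_root alpha ->
  exists X Y H, sl2_triple B alpha X Y H.
Proof.
move=> ra; have [a0 [X X0 aX]] := ra; have [Y aY BXY] := form_pairing X0 aX.
have [T TE] : exists T : subvs_of h, lie X Y = vsval T.
  by apply: root_space0; rewrite -(subrr alpha); exact: root_space_lie.
have BT H : B (vsval T) (vsval H) = (alpha H : F) * B X Y.
  exact: (inv_form_cartan (form_invariant B)).
have aT : alpha T != 0.
  apply: contraNneq a0 => aT0; suff T0 : vsval T = 0.
    apply/eqP/lfunP => H; rewrite lfunE /=; apply/eqP.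
    by rewrite -(mulIr_eq0 _ (mulIf BXY)) -BT T0 (lin0 ((form_bilin B).1 _)).
  apply: (rho_eq0 rhoI) => a v av.
  case: (pselect (v = 0)) => [->|v0]; first exact: (lin0 (rho_bilin.2 _)).
  have ef u : rho X (rho Y u) - rho Y (rho X u) = rho (vsval T) u.
    by rewrite -rho_lie TE.
  have te u : rho (vsval T) (rho X u) - rho X (rho (vsval T) u) = 0 *: rho X u.
    by rewrite -rho_lie aX aT0 (linZ (rho_bilin.1 u)).
  have tf u : rho (vsval T) (rho Y u) - rho Y (rho (vsval T) u) = - 0 *: rho Y u.
    rewrite -rho_lie aY lfunE /= aT0 oppr0.
    exact: (linZ (rho_bilin.1 u)).
  have [||i [j]] := triple_weight (rho_bilin.2 X) (rho_bilin.2 Y) ef te tf v0 (av T).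
  - by move=> u; exact: (rep_nil rhoI u ra aX).
  - by move=> u; exact: (rep_nil rhoI u (is_root_opp ra) aY).
  rewrite !mul0r addr0 => /eqP; rewrite mulf_eq0 pnatr_eq0 /= => /eqP aT.
  by rewrite av aT scale0r.
pose c := 2 / alpha T.
exists X, (c *: Y), (c *: T); split=> //.
- by move=> H; rewrite (linZ (lie_bilin.2 _)) aY !scalerA mulrC.
- by rewrite (linZ (lie_bilin.2 _)) TE linearZ.
- rewrite linearZ /= /c; exact: divfK.
- rewrite (linZ ((form_bilin B).2 X)) mulf_neq0 // mulf_neq0 ?invr_eq0 //.
  by rewrite pnatr_eq0.
Qed.
End Triples.

(** * Trace form and coroots *)

Section TraceForm.
Variables (F : fieldType) (g : finLieAlgType F) (n : nat) (b : n.-tuple g).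
Hypothesis b_basis : basis_of fullv b.

(** Matrices act on rows of coordinates from the right, so a matrix product is the composite in
    reversed order. *)
Definition ad_mx (x : g) : 'M[F]_n := \matrix_(i, j) coord b j (lie x b`_i).

(** The Killing form, computed in the basis [b]. *)
Definition trace_form (x y : g) : F^o := \tr (ad_mx x *m ad_mx y).

Lemma coord_ad x z j : coord b j (lie x z) = \sum_i coord b i z * ad_mx x i j.
Proof.
rewrite {1}(coord_basis b_basis (memvf z)) (lin_sum (lie_bilin.2 x)) linear_sum.
by apply: eq_bigr => i _; rewrite (linZ (lie_bilin.2 x)) linearZ mxE.
Qed.

Lemma ad_mx_mul x y i j :
  (ad_mx x *m ad_mx y) i j = coord b j (lie y (lie x b`_i)).
Proof. by rewrite mxE coord_ad; apply: eq_bigr => k _; rewrite !mxE. Qed.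

Lemma ad_mx_lie x y : ad_mx (lie x y) = ad_mx y *m ad_mx x - ad_mx x *m ad_mx y.
Proof.
apply/matrixP => i j; rewrite 2!mxE [(- (_ *m _)) i j]mxE !ad_mx_mul -linearB /=.
congr (coord b j _); have := lie_jacobi x y b`_i.
rewrite [lie b`_i (lie x y)]lieC [lie b`_i x]lieC lieNr => /eqP.
by rewrite subr_eq0 => /eqP.
Qed.

Lemma ad_mx_linear : linear ad_mx.
Proof.
by move=> c x y; apply/matrixP => i j; rewrite !mxE lie_bilin.1 linearP.
Qed.

Lemma trace_form_invariant : invariant_form trace_form.
Proof.
split; [split=> [y|x] c u v| |].
- by rewrite /trace_form ad_mx_linear mulmxDl -scalemxAl linearP.
- by rewrite /trace_form ad_mx_linear mulmxDr -scalemxAr linearP.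
- by move=> x y; exact: mxtrace_mulC.
move=> x y z; rewrite /trace_form !ad_mx_lie mulmxBl mulmxBr !linearB /=.
congr (_ - _); first by rewrite -mulmxA mxtrace_mulC mulmxA.
by rewrite mulmxA.
Qed.
End TraceForm.

(** * Integrality and positivity of coroots, and the norm of weights *)

Section Killing.
Variables (F : numClosedFieldType) (g : finLieAlgType F) (h : {vspace g}).
Variables (V : lmodType F) (rho : g -> V -> V) (B : invForm g).
Hypotheses (g_simple : simple_lie g) (h_cartan : cartan_subalgebra h).
Hypothesis rhoI : integrable_rep h rho.
Notation hdual := (dual (subvs_of h)).
Variables (eX eY : hdual -> g) (eH : hdual -> subvs_of h).
Hypothesis triple : forall alpha, is_root alpha ->
  sl2_triple B alpha (eX alpha) (eY alpha) (eH alpha).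
Variables (n : nat) (b : n.-tuple g) (gam : 'I_n -> hdual).
Hypotheses (b_basis : basis_of fullv b) (gamP : forall i, root_space (gam i) b`_i).
Let rho_bilin := rep_bilin rhoI.
Let rho_lie := rep_lie rhoI.

Lemma is_root_neq0 (alpha : hdual) X : alpha != 0 -> X != 0 ->
  root_space alpha X -> is_root alpha.
Proof. by move=> a0 X0 aX; split=> //; exists X. Qed.

Lemma basis_neq0 (i : 'I_n) : b`_i != 0.
Proof.
have /andP[_ fb] := b_basis.
have bi : b`_i \in (b : seq g) by apply: mem_nth; rewrite size_tuple.
exact: (free_not0 fb bi).
Qed.

Lemma is_root_gam i : gam i != 0 -> is_root (gam i).
Proof. by move=> g0; apply: (is_root_neq0 g0 (basis_neq0 i)). Qed.

(** Comparing eigenvalues at a nonzero coordinate of [u] identifies [beta]. In particular there are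
    finitely many roots. *)
Lemma root_mem (beta : hdual) u : u != 0 -> root_space beta u ->
  exists i, beta = gam i.
Proof.
move=> u0 bu; have [i ci] : exists i, coord b i u != 0.
  apply: contrapT => /forallNP H; case/eqP: u0.
  rewrite (coord_basis b_basis (memvf u)) big1 // => i _.
  by have /negP := H i; rewrite negbK => /eqP ->; rewrite scale0r.
exists i; apply/lfunP => H; apply: (mulIf ci).
transitivity (coord b i (lie (vsval H) u)); first by rewrite bu linearZ.
rewrite {1}(coord_basis b_basis (memvf u)) (lin_sum (lie_bilin.2 _)) linear_sum.
have /andP[_ fb] := b_basis.
rewrite (bigD1 i) //= big1 => [|j ji].
  by rewrite (linZ (lie_bilin.2 _)) gamP !linearZ /= coord_free // eqxx /= mulr1 addr0 mulrC.
by rewrite (linZ (lie_bilin.2 _)) gamP !linearZ /= coord_free // (negPf ji) /= !mulr0.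
Qed.

(** Otherwise [n.+1] distinct functionals [beta + alpha *+ i] would all occur among the [n]
    functionals [gam j]. *)
Lemma ad_nilpotent (alpha beta : hdual) x u : alpha != 0 ->
  root_space alpha x -> root_space beta u -> exists N, iter N (lie x) u = 0.
Proof.
move=> a0 ax bu; apply: contrapT => /forallNP H.
have wt i : root_space (beta + alpha *+ i) (iter i (lie x) u).
  elim: i => [|i IH]; first by rewrite addr0.
  by rewrite mulrS addrCA /=; exact: root_space_lie.
have /choice[k kP] : forall i : 'I_n.+1, exists j, beta + alpha *+ i = gam j.
  by move=> i; apply: (root_mem _ (wt i)); apply/eqP/H.
suff /leq_card : injective k by rewrite !card_ord ltnn.
move=> i j kij; have : alpha *+ i = alpha *+ j.
  by apply: (addrI beta); rewrite !kP kij.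
move=> E; apply/val_inj => /=; apply: contraNeq a0 => ne; apply/eqP/lfunP => H0.
have : (alpha *+ i) H0 = (alpha *+ j) H0 by rewrite E.
rewrite -!scaler_nat !scale_lfunE lfunE /= => /eqP; rewrite -subr_eq0 -scalerBl.
rewrite scaler_eq0 subr_eq0 eqr_nat (negPf ne) /= => /eqP //.
Qed.
Lemma coroot_int (alpha a : hdual) v : is_root alpha -> v <> 0 ->
  rho_weight rho a v -> exists z : int, a (eH alpha) = z%:~R.
Proof.
move=> ra v0 av; have [aX aY XY aH _] := triple ra.
have ef u : rho (eX alpha) (rho (eY alpha) u) - rho (eY alpha) (rho (eX alpha) u) =
    rho (vsval (eH alpha)) u by rewrite -rho_lie XY.
apply: (sl2_weight_int (rho_bilin.2 _) (rho_bilin.2 _) ef _ _ v0 (av _)).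
- by move=> u; rewrite -rho_lie aX aH (linZ (rho_bilin.1 u)).
- by move=> u; rewrite -rho_lie aY lfunE /= aH (linZ (rho_bilin.1 u)).
- by move=> u; exact: (rep_nil rhoI u ra aX).
- by move=> u; apply: (rep_nil rhoI u _ aY); exact: is_root_opp B rhoI _ ra.
Qed.

(** By faithfulness a root vector of [beta] maps some weight vector to a nonzero one, so [beta] is a
    difference of two weights of [V], both integral on the coroot. *)
Lemma root_coroot_int (alpha beta : hdual) : is_root alpha -> is_root beta ->
  exists z : int, beta (eH alpha) = z%:~R.
Proof.
move=> ra [b0 [x x0 bx]].
have [a [v [av xv]]] : exists (a : hdual) (v : V), rho_weight rho a v /\ rho x v <> 0.
  apply: contrapT => /forallNP H; case/eqP: x0; apply: (rho_eq0 rhoI) => a v av.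
  by apply: contrapT => xv; apply: (H a); exists v.
have v0 : v <> 0 by move=> v0; apply: xv; rewrite v0 (lin0 (rho_bilin.2 x)).
have [z zE] := coroot_int ra v0 av.
have [w wE] := coroot_int ra xv (rho_weightD rhoI bx av).
by exists (w - z); rewrite intrB -wE -zE lfunE /= addrC addKr.
Qed.

(** If [eX alpha] killed [u], then [sl2_raise_inj] with [eX alpha] and [eY alpha] exchanged would
    give [u = 0], because the negated coroot acts on [u] by [m.+1]. *)
Lemma is_rootD (alpha beta : hdual) m : is_root alpha -> is_root beta ->
  beta (eH alpha) = - m.+1%:R -> alpha + beta != 0 -> is_root (alpha + beta).
Proof.
move=> ra [b0 [u u0 bu]] bH ab0; have [aX aY XY aH _] := triple ra.
apply: (is_root_neq0 ab0 (X := lie (eX alpha) u)); last exact: root_space_lie.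
apply: contraNneq u0 => Xu.
have li x := (@lie_bilin _ g).2 x; have lil x := (@lie_bilin _ g).1 x.
have jac x y z : lie x (lie y z) - lie y (lie x z) = lie (lie x y) z.
  have := lie_jacobi x y z; rewrite [lie z x]lieC lieNr [lie z _]lieC.
  by move/subr0_eq.
have ef y : lie (eY alpha) (lie (eX alpha) y) - lie (eX alpha) (lie (eY alpha) y) =
    - lie (vsval (eH alpha)) y by rewrite jac [lie (eY alpha) _]lieC XY lieNl.
have te y : - lie (vsval (eH alpha)) (lie (eY alpha) y) -
    lie (eY alpha) (- lie (vsval (eH alpha)) y) = 2 *: lie (eY alpha) y.
  rewrite lieNr -opprD jac aY lfunE /= aH (linZ (lil y)).
  by rewrite scaleNr opprK.
apply/eqP; apply: (sl2_raise_inj (li (eY alpha)) (li (eX alpha)) ef te (m := m)).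
- by rewrite bu bH scaleNr opprK.
- by rewrite Xu lie0r.
- apply: (ad_nilpotent _ aY bu); rewrite oppr_eq0; exact: ra.1.
Qed.

Notation kap := (trace_form b).
Let kapI : invariant_form kap := trace_form_invariant b_basis.

Lemma trace_form_cartan (H H' : subvs_of h) :
  kap (vsval H) (vsval H') = \sum_i gam i H * gam i H'.
Proof.
apply: eq_bigr => i _; rewrite ad_mx_mul // gamP (linZ (lie_bilin.2 _)) gamP.
have /andP[_ fb] := b_basis.
by rewrite scalerA linearZ /= coord_free // eqxx /= mulr1.
Qed.

(** In the sum of squares [alpha] itself contributes 4, and the other terms are squares of
    integers. *)
Lemma trace_form_coroot (alpha : hdual) : is_root alpha ->
  exists m : nat, kap (vsval (eH alpha)) (vsval (eH alpha)) = m.+1%:R.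
Proof.
move=> ra; have [a0 [x x0 ax]] := ra; have [i aE] := root_mem x0 ax.
rewrite trace_form_cartan (bigD1 i) //= -aE; have [_ _ _ aH _] := triple ra.
rewrite aH; suff [m ->] : exists m : nat,
    \sum_(j | j != i) gam j (eH alpha) * gam j (eH alpha) = m%:R.
  by exists (m + 3)%N; rewrite -natrM -natrD; congr _%:R; lia.
elim/big_ind: _ => [|_ _ [m1 ->] [m2 ->]|j _].
- by exists 0%N.
- by exists (m1 + m2)%N; rewrite natrD.
have [z ->] : exists z : int, gam j (eH alpha) = z%:~R.
  case: (altP (gam j =P 0)) => [->|/is_root_gam rj]; first by exists 0; rewrite lfunE.
  exact: root_coroot_int.
exists (`|z| ^ 2)%N; rewrite -intrM natrX natr_absz -rmorphXn /= real_normK ?num_real //.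
Qed.

Definition coroot_norm (alpha : hdual) : F :=
  kap (vsval (eH alpha)) (vsval (eH alpha)).

Lemma coroot_norm_gt0 (alpha : hdual) : is_root alpha -> 0 < coroot_norm alpha.
Proof. by rewrite /coroot_norm => /trace_form_coroot[m ->]; rewrite ltr0n. Qed.

Lemma inv_form_coroot (beta : g -> g -> F^o) (alpha : hdual) (H : subvs_of h) :
  invariant_form beta -> is_root alpha ->
  2 * beta (vsval (eH alpha)) (vsval H) =
    alpha H * beta (vsval (eH alpha)) (vsval (eH alpha)).
Proof.
move=> bI ra; have [aX aY XY aH _] := triple ra.
by rewrite !(inv_form_cartan bI _ aY XY) aH mulrCA.
Qed.

(** Without roots [g] would equal [h] and be abelian. *)
Lemma exists_root : exists alpha : hdual, is_root alpha.
Proof.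
apply: contrapT => /forallNP nr; have [[x [y xy]] _] := g_simple.
have gh z : exists H : subvs_of h, z = vsval H.
  suff zh : z \in h by exists (vsproj h z); rewrite vsprojK.
  have := root_vectors_span rhoI z; apply: (lspan_subspace (W := fun z => z \in h)).
    by split=> [|c u v uh vh]; [exact: mem0v|rewrite memvD ?memvZ].
  move=> w [beta bw]; case: (altP (beta =P 0)) bw => [-> /(root_space0 h_cartan)[H ->]|b0 bw].
    exact: subvsP.
  case: (altP (w =P 0)) => [->|w0]; first exact: mem0v.
  by case: (nr beta); split=> //; exists w.
case/eqP: xy; have [H ->] := gh x; have [H' ->] := gh y.
exact: (cartan_abelian rhoI).
Qed.

(** The scalar [c] makes [beta], the difference of the two forms, vanish at the pair [(H0, H0)].
    Then [H0] is orthogonal to all of [g], so the radical of [beta] is a nonzero ideal and equals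
    [g]. *)
Lemma trace_form_scale : exists2 c : F, c != 0 & forall x y, kap x y = c * B x y.
Proof.
have [alpha ra] := exists_root; have [aX aY XY aH BXY] := triple ra.
set H0 := vsval (eH alpha).
have B0 : B H0 H0 != 0.
  rewrite (inv_form_cartan (form_invariant B) _ aY XY) aH mulf_neq0 //.
  by rewrite pnatr_eq0.
pose c := coroot_norm alpha / B H0 H0.
pose beta x y : F^o := kap x y - c * B x y.
have bI : invariant_form beta.
  have [[kl kr] ks ki] := kapI; have [[Bl Br] Bs Bi] := form_invariant B.
  split=> [|x y|x y z]; last 2 first.
  - by rewrite /beta ks Bs.
  - by rewrite /beta ki Bi.
  split=> [y|x] k u v; rewrite /beta ?kl ?kr ?Bl ?Br mulrDr opprD addrACA;
    by rewrite scalerBr /GRing.scale /= [k * (c * _)]mulrCA.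
have bH0 z : beta H0 z = 0.
  have [[bl br] _ _] := bI.
  have := root_vectors_span rhoI z; apply: (lspan_subspace (W := fun z => beta H0 z = 0)).
    split=> [|k u v u0 v0]; first exact: (lin0 (br H0)).
    by rewrite br u0 v0 scaler0 addr0.
  move=> w [gm gw]; case: (altP (gm =P 0)) gw => [->|g0] gw.
    have [H ->] := root_space0 h_cartan gw.
    have two0 : 2 != 0 :> F by rewrite pnatr_eq0.
    apply: (mulfI two0); rewrite mulr0 (inv_form_coroot _ bI ra) -/H0.
    by rewrite /beta /c divfK // subrr mulr0.
  apply: (inv_form_orth bI (cartan_root_space0 rhoI _) gw).
  by rewrite add0r.
have [I IP] : exists I : {vspace g}, forall x, (x \in I) <-> forall y, beta x y = 0.
  apply: vspace_of_subspace; have [[bl br] _ _] := bI; split=> [y|k u v u0 v0 y].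
    exact: (lin0 (bl y)).
  by rewrite bl u0 v0 scaler0 addr0.
have Iideal x y : y \in I -> lie x y \in I.
  move=> /IP yI; apply/IP => z; have [[bl br] _ bi] := bI.
  by rewrite lieC (linN (bl z)) bi yI oppr0.
have H0I : H0 \in I by apply/IP.
have kE x y : kap x y = c * B x y.
  have xI : x \in I.
    have [I0|->] := g_simple.2 I Iideal; last exact: memvf.
    move: B0; move: H0I; rewrite I0 memv0 => /eqP ->.
    by rewrite (lin0 ((form_bilin B).1 _)) eqxx.
  by move/IP/(_ y)/subr0_eq : xI.
exists c => //; rewrite /c mulf_neq0 ?invr_eq0 //.
by rewrite gt_eqF // coroot_norm_gt0.
Qed.

(** It suffices to expand [H] itself in coroots. The expansion and [H] have the same trace form with
    [h] by [trace_form_cartan], and the trace form is nondegenerate as a nonzero multiple of [B].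
    Indices with [gam i = 0], where [eH] is unspecified, contribute zero. *)
Lemma coroot_expand (a : hdual) (H : subvs_of h) :
  a H = \sum_i
    2 / coroot_norm (gam i) * gam i H * a (eH (gam i)).
Proof.
pose Z : subvs_of h := \sum_i
  (2 / coroot_norm (gam i) * gam i H) *: eH (gam i) - H.
suff Z0 : Z = 0.
  have /eqP : a Z = 0 by rewrite Z0 linear0.
  rewrite linearB linear_sum /= subr_eq0 => /eqP <-.
  by apply: eq_bigr => i _; rewrite linearZ.
have [[kl kr] ks ki] := kapI; have [c c0 kE] := trace_form_scale.
have kZ (H' : subvs_of h) : kap (vsval Z) (vsval H') = 0.
  have -> : vsval Z = \sum_i (2 / coroot_norm (gam i) * gam i H) *:
      vsval (eH (gam i)) - vsval H.
    by rewrite linearB linear_sum; congr (_ - _); apply: eq_bigr => i _; rewrite linearZ.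
  rewrite (linB (kl _)) (lin_sum (kl _)) trace_form_cartan.
  rewrite -sumrB big1 // => i _; apply/eqP; rewrite subr_eq0; apply/eqP.
  rewrite (linZ (kl _)).
  case: (altP (gam i =P 0)) => [->|/is_root_gam ri].
    by rewrite lfunE /= !mul0r mulr0 scale0r.
  have k0 : coroot_norm (gam i) != 0 by rewrite gt_eqF // coroot_norm_gt0.
  have := inv_form_coroot H' kapI ri; rewrite -/(coroot_norm (gam i)) => kH.
  apply: (mulfI k0); rewrite /GRing.scale /=.
  rewrite [LHS](_ : _ = gam i H * (2 * kap (vsval (eH (gam i))) (vsval H'))).
    by rewrite kH; ring.
  by field.
have kZ' z : kap (vsval Z) z = 0.
  have := root_vectors_span rhoI z.
  apply: (lspan_subspace (W := fun z => kap (vsval Z) z = 0)).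
    split=> [|k u v u0 v0]; first exact: (lin0 (kr _)).
    by rewrite kr u0 v0 scaler0 addr0.
  move=> w [gm gw]; case: (altP (gm =P 0)) gw => [->|g0] gw.
    by have [H' ->] := root_space0 h_cartan gw.
  apply: (inv_form_orth kapI (cartan_root_space0 rhoI _) gw).
  by rewrite add0r.
apply: val_inj => /=; apply: (form_nondeg (i := B)) => y.
by apply: (mulfI c0); rewrite -kE kZ' mulr0.
Qed.

(** The triples of [alpha] and [- alpha] are chosen independently. The combination [Z] is orthogonal
    to all coroots, so every functional vanishes on it by [coroot_expand]; evaluating [alpha] there
    gives [p = q]. *)
Lemma corootN (a alpha : hdual) : is_root alpha -> a (eH (- alpha)) = - a (eH alpha).
Proof.
move=> ra; have rN := is_root_opp B rhoI ra.
have [_ aY XY aH Bp] := triple ra; have [_ aY' XY' aH' Bp'] := triple rN.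
have BI := form_invariant B; have [[Bl Br] Bs _] := BI.
set p := B (eX alpha) _ in Bp; set q := B (eX (- alpha)) _ in Bp'.
pose Z := q *: eH alpha + p *: eH (- alpha).
have aZ (c : hdual) : c Z = 0.
  rewrite coroot_expand big1 // => i _; case: (altP (gam i =P 0)) => [->|/is_root_gam ri].
    by rewrite lfunE /= mulr0 mul0r.
  have Bii : B (vsval (eH (gam i))) (vsval (eH (gam i))) != 0.
    have [_ biY biXY biH Bi] := triple ri.
    by rewrite (inv_form_cartan BI _ biY biXY) biH mulf_neq0 // pnatr_eq0.
  suff -> : gam i Z = 0 by rewrite mulr0 mul0r.
  apply: (mulIf Bii); rewrite mul0r -(inv_form_coroot _ BI ri) Bs.
  have -> : vsval Z = q *: vsval (eH alpha) + p *: vsval (eH (- alpha)).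
    by rewrite linearD !linearZ.
  rewrite (linD (Bl _)) !(linZ (Bl _)) (inv_form_cartan BI _ aY XY).
  rewrite (inv_form_cartan BI _ aY' XY') -/p -/q lfunE /GRing.scale /=.
  by ring.
have E (c : hdual) : q * c (eH alpha) + p * c (eH (- alpha)) = 0.
  by rewrite -(aZ c) linearD !linearZ.
have pq : p = q.
  have := E alpha; rewrite aH; move: aH'; rewrite lfunE /= => /(canRL (@opprK _)) ->.
  move/eqP; rewrite mulrN subr_eq0 => /eqP /mulIf -> //.
  by rewrite pnatr_eq0.
have /eqP := E a; rewrite -pq -mulrDr mulf_eq0 (negPf Bp) /= addrC addr_eq0.
by move=> /eqP ->.
Qed.

(** The squared length of [a] for the form dual to the trace form on [h]: twice the coroot divided
    by its norm is the element of [h] representing [gam i]. *)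
Definition wnorm (a : hdual) : F :=
  \sum_(i | gam i != 0) (2 / coroot_norm (gam i) * a (eH (gam i))) ^+ 2.

(** Expansion of the square: with N the norm of the coroot, (alpha, alpha) is 4 / N and 2 (a, alpha)
    is 4 / N times [a (eH alpha)]. *)
Lemma wnormD (a alpha : hdual) : is_root alpha ->
  wnorm (a + alpha) = wnorm a + 4 / coroot_norm alpha * (a (eH alpha) + 1).
Proof.
move=> ra; have k0 := lt0r_neq0 (coroot_norm_gt0 ra).
have [_ _ _ aH _] := triple ra; have [_ ks _] := kapI.
have aE i : gam i != 0 -> 2 / coroot_norm (gam i) * alpha (eH (gam i)) =
    2 / coroot_norm alpha * gam i (eH alpha).
  move=> /is_root_gam ri; have ki0 := lt0r_neq0 (coroot_norm_gt0 ri).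
  have := inv_form_coroot (eH alpha) kapI ri.
  rewrite ks (inv_form_coroot _ kapI ra) -!/(coroot_norm _) => E.
  apply: (mulfI (mulf_neq0 k0 ki0)).
  rewrite [LHS](_ : _ = 2 * (alpha (eH (gam i)) * coroot_norm alpha)); last by field.
  by rewrite E; field.
have E : \sum_i (2 / coroot_norm alpha * gam i (eH alpha)) *
    (2 / coroot_norm (gam i) * (2 * a (eH (gam i)) + alpha (eH (gam i)))) =
    4 / coroot_norm alpha * (a (eH alpha) + 1).
  transitivity (2 / coroot_norm alpha * (2 * a (eH alpha) + alpha (eH alpha))).
    rewrite !coroot_expand [2 * \sum_i _]mulr_sumr -big_split mulr_sumr /=.
    by apply: eq_bigr => i _; ring.
  by rewrite aH; field.
rewrite -E [X in _ = _ + X](bigID (fun i => gam i != 0)) /= [X in _ = _ + (_ + X)]big1.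
  rewrite addr0 -big_split; apply: eq_bigr => i gi /=; rewrite -aE // lfunE /=.
  by field; rewrite lt0r_neq0 // coroot_norm_gt0 //; exact: is_root_gam.
by move=> i /negbNE /eqP ->; rewrite lfunE /= mulr0 mul0r.
Qed.

(** Coroot norms are positive integers, so the square of their product clears all denominators. A
    decrease of [wnorm] thereby becomes a decrease of a natural number. *)
Lemma wnorm_nat : exists2 K : F, 0 < K & forall a : hdual,
  (forall alpha, is_root alpha -> exists z : int, a (eH alpha) = z%:~R) ->
  exists m : nat, K * wnorm a = m%:R.
Proof.
pose K := \prod_(i | gam i != 0) coroot_norm (gam i).
have normN i : gam i != 0 -> exists m : nat, coroot_norm (gam i) = m.+1%:R.
  by move=> /is_root_gam /trace_form_coroot.
have K0 : 0 < K by apply: prodr_gt0 => i /is_root_gam; exact: coroot_norm_gt0.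
exists (K ^+ 2); first by rewrite exprn_gt0.
move=> a aZ; rewrite /wnorm mulr_sumr.
elim/big_ind: _ => [|_ _ [m1 ->] [m2 ->]|i gi].
- by exists 0%N.
- by exists (m1 + m2)%N; rewrite natrD.
have [z zE] := aZ _ (is_root_gam gi).
have [p pE] : exists p : nat, \prod_(j | (gam j != 0) && (j != i)) coroot_norm (gam j) = p%:R.
  elim/big_ind: _ => [|_ _ [m1 ->] [m2 ->]|j /andP[/normN[m ->] _]].
  - by exists 1%N.
  - by exists (m1 * m2)%N; rewrite natrM.
  - by exists m.+1.
have ki0 := lt0r_neq0 (coroot_norm_gt0 (is_root_gam gi)).
exists (`|(2 * p%:Z * z)%R| ^ 2)%N; rewrite -exprMn /K (bigD1 i) //= pE zE.
rewrite natrX natr_absz -rmorphXn /= real_normK ?num_real // rmorphXn /= !rmorphM /=.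
by rewrite -pmulrn; field.
Qed.

Lemma eq_on_coroots (a a' : hdual) :
  (forall i, gam i != 0 -> a (eH (gam i)) = a' (eH (gam i))) -> a = a'.
Proof.
move=> E; apply/lfunP => H; rewrite !coroot_expand; apply: eq_bigr => i _.
case: (altP (gam i =P 0)) => [->|/E -> //].
by rewrite lfunE /= mulr0 !mul0r.
Qed.

(** If the sum were zero, evaluating it at the coroot of the first root [alpha] would give some
    [beta] in the rest with a negative value. Then [alpha + beta] is a positive root, and replacing
    the two by it gives a shorter list with sum zero. *)
Lemma sum_positive_neq0 (P : {pred hdual}) (s : seq hdual) : positive_system P ->
  s != [::] -> {subset s <= P} -> \sum_(alpha <- s) alpha != 0.
Proof.
move=> [Proot Popp PD]; have [m] := ubnP (size s).
elim: m s => // m IH [|alpha s] // sm _ sP; apply/eqP => S0.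
have aP : alpha \in P by apply: sP; rewrite mem_head.
have ra := Proot _ aP; have [_ _ _ aH _] := triple ra.
have sP' beta : beta \in s -> beta \in P by move=> bs; apply: sP; rewrite in_cons bs orbT.
have [beta bs [z bz]] : exists2 beta, beta \in s &
    exists z : nat, beta (eH alpha) = - z.+1%:R.
  apply: contrapT => /forall2NP nb.
  have : 0 < (\sum_(beta <- alpha :: s) beta) (eH alpha).
    rewrite big_cons lfunE /= aH sum_lfunE ltr_wpDr ?ltr0n //.
    rewrite big_seq sumr_ge0 // => beta bs.
    have [[] z zE] := root_coroot_int ra (Proot _ (sP' _ bs)).
      by rewrite zE ler0n.
    by have [] := nb beta; case=> //; exists z; rewrite zE NegzE rmorphN.
  by rewrite S0 lfunE ltxx.
have rb := Proot _ (sP' _ bs).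
have ab0 : alpha + beta != 0.
  apply/eqP => E; have bE : beta = - alpha by rewrite -[LHS](addKr alpha) E addr0.
  by have := Popp _ ra; rewrite aP -bE (sP' _ bs).
have rab := is_rootD ra rb bz ab0.
have s_gt0 : (0 < size s)%N by case: (s) bs.
have /negP[] : \sum_(gm <- alpha + beta :: rem beta s) gm != 0.
  apply: IH => //=; first by rewrite size_rem // prednK.
  move=> gm; rewrite in_cons => /orP[/eqP ->|/mem_rem/sP' //].
  by apply: PD => //; exact: sP'.
rewrite big_cons -addrA; move: S0; rewrite big_cons (perm_big _ (perm_to_rem bs)) /=.
by rewrite big_cons => ->.
Qed.

End Killing.

(** * Weights of integrable affine modules *)

Lemma finType_repeat (T : finType) (c : nat -> T) :
  exists i j, (i < j)%N /\ c i = c j.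
Proof.
apply: contrapT => H; suff /leq_card : injective (fun i : 'I_#|T|.+1 => c i).
  by rewrite card_ord ltnn.
move=> i j cij; case: (ltngtP (val i) (val j)) => [lt_ij|lt_ji|/val_inj //].
  by case: H; exists (val i), (val j).
by case: H; exists (val j), (val i).
Qed.

Section AffineWeights.
Variables (F : numClosedFieldType) (g : finLieAlgType F) (h : {vspace g}).
Variables (V : lmodType F) (B : invForm g).
Notation hdual := (dual (subvs_of h)).

Definition aff_weight (X : g -> int -> V -> V) (L0 K : V -> V) (a : hdual) (k d : F)
    (v : V) : Prop :=
  [/\ forall H, X (vsval H) 0 v = (a H : F) *: v, K v = k *: v & L0 v = d *: v].

(** What is kept of a [tau(A)]-module when only the coefficient 1 of [A] and the generators X t^n,
    L_0 and K are used. *)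
Record integrable_affine_rep (X : g -> int -> V -> V) (L0 K : V -> V) : Prop :=
  IntegrableAffineRep {
  aff_bilin : forall n, bilin (fun x v => X x n v);
  aff_K_linear : linear K;
  aff_L0_linear : linear L0;
  aff_XX : forall x y n m v, X x n (X y m v) - X y m (X x n v) =
    X (lie x y) (n + m) v + (if n + m == 0 then n%:~R * B x y else 0) *: K v;
  aff_KX : forall x n v, K (X x n v) = X x n (K v);
  aff_L0X : forall x n v, L0 (X x n v) - X x n (L0 v) = n%:~R *: X x n v;
  aff_span : forall v, v \in lspan (fun u => exists a k d, aff_weight X L0 K a k d u);
  aff_ss : forall (H : subvs_of h) (c : F) (v : V),
    X (vsval H) 0 (X (vsval H) 0 v - c *: v) -
      c *: (X (vsval H) 0 v - c *: v) = 0 -> X (vsval H) 0 v - c *: v = 0;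
  aff_fin : forall a k d, exists n, hasdim (aff_weight X L0 K a k d) n;
  aff_nil : forall (alpha : hdual) n x v, is_root alpha -> root_space alpha x ->
    exists N, iter N (X x n) v = 0;
  aff_K_neq0 : exists v, K v <> 0 }.

Variables (X : g -> int -> V -> V) (L0 K : V -> V).
Hypothesis XI : integrable_affine_rep X L0 K.
Hypotheses (g_simple : simple_lie g) (h_cartan : cartan_subalgebra h).
Let X_bilin := aff_bilin XI.
Let XX := aff_XX XI.
Let Xl n v : linear (fun x => X x n v) := (X_bilin n).1 v.
Let Xr n x : linear (X x n) := (X_bilin n).2 x.
Local Notation wt := (aff_weight X L0 K).

Lemma X00 x y v : X x 0 (X y 0 v) - X y 0 (X x 0 v) = X (lie x y) 0 v.
Proof. by rewrite XX addr0 eqxx mul0r scale0r addr0. Qed.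

(** The kernel is an ideal. If it were [g], all [y, z] t^n would act by zero, and bracketing [y, z]
    t with w t^(-1) would leave B([y, z], w) K = 0, against the nontriviality of [K]. *)
Lemma X0_faithful x : (forall v, X x 0 v = 0) -> x = 0.
Proof.
have [I IP] : exists I : {vspace g}, forall x, (x \in I) <-> forall v, X x 0 v = 0.
  apply: vspace_of_subspace; split=> [v|c u w u0 w0 v]; first exact: (lin0 (Xl 0 v)).
  by rewrite Xl u0 w0 scaler0 addr0.
have Iideal y z : z \in I -> lie y z \in I.
  move=> /IP zI; apply/IP => v; rewrite -X00 !zI subr0.
  exact: (lin0 (Xr 0 y)).
move=> /IP; have [->|If] := g_simple.2 I Iideal; first by rewrite memv0 => /eqP.
have X00_0 y v : X y 0 v = 0 by apply: (IP y).1; rewrite If memvf.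
have [[y [z /eqP yz]] _] := g_simple.
have yz0 n v : X (lie y z) n v = 0.
  have := XX y z 0 n v; rewrite !X00_0 (lin0 (Xr n z)) subrr add0r => /esym.
  by case: eqP => _; rewrite ?mul0r scale0r addr0.
have [w Bw] : exists w, B (lie y z) w <> 0.
  apply: contrapT => /forallNP H; apply: yz; apply: (form_nondeg (i := B)) => w.
  exact: contrapT (H w).
have [v Kv] := aff_K_neq0 XI; case: Kv.
have := XX (lie y z) w 1 (- 1) v; rewrite !yz0 (lin0 (Xr (- 1) w)) subrr addrN eqxx.
rewrite X00_0 add0r mul1r => /esym/eqP; rewrite scaler_eq0.
by case: eqP Bw => //= _ _ /eqP.
Qed.

Lemma X0_integrable : integrable_rep h (fun x v => X x 0 v).
Proof.
split.
- exact: X_bilin.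
- by move=> x y v; rewrite X00.
- exact: X0_faithful.
- move=> v; have := aff_span XI v; apply: (lspan_subspace (W := fun v => v \in lspan _)).
    by split=> [|c u w Su Sw]; [exact: rpred0|rewrite rpredD ?rpredZ].
  by move=> u [a [k [d [ua _ _]]]]; apply: mem_lspan; exists a.
- exact: aff_ss XI.
- by move=> alpha x v ra ax; exact: aff_nil XI _ _ _ _ ra ax.
Qed.
Let rhoI := X0_integrable.

Lemma wt_X (gam a : hdual) k d x n v : root_space gam x -> wt a k d v ->
  wt (a + gam) k (d + n%:~R) (X x n v).
Proof.
move=> gx [av kv dv]; split=> [H||].
- have := XX (vsval H) x 0 n v; rewrite add0r mul0r if_same scale0r addr0.
  rewrite gx (linZ (Xl _ _)) av (linZ (Xr _ _)) => /(canRL (subrK _)) ->.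
  by rewrite -scalerDl lfunE addrC.
- by rewrite (aff_KX XI) kv (linZ (Xr _ _)).
- have /(canRL (subrK _)) -> := aff_L0X XI x n v.
  by rewrite dv (linZ (Xr _ _)) -scalerDl addrC.
Qed.

Lemma exists_wt : exists a k d v, [/\ wt a k d v, v <> 0 & k <> 0].
Proof.
have [v Kv] := aff_K_neq0 XI; apply: contrapT => H; apply: Kv.
have := aff_span XI v; apply: (lspan_subspace (W := fun v => K v = 0)).
  have Kl := aff_K_linear XI.
  by split=> [|c u w u0 w0]; rewrite ?(lin0 Kl) // Kl u0 w0 scaler0 addr0.
move=> u [a [k [d uw]]]; have [_ -> _] := uw; apply: contrapT => ku; apply: H.
exists a, k, d, u; split=> // [u0|k0]; apply: ku; first by rewrite u0 scaler0.
by rewrite k0 scale0r.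
Qed.

Variables (eX eY : hdual -> g) (eH : hdual -> subvs_of h).
Hypothesis triple : forall alpha, is_root alpha ->
  sl2_triple B alpha (eX alpha) (eY alpha) (eH alpha).
Variables (n : nat) (b : n.-tuple g) (gam : 'I_n -> hdual).
Hypotheses (b_basis : basis_of fullv b) (gamP : forall i, root_space (gam i) b`_i).

(** * The sl2-triple of the real root alpha + m delta *)

Section AffineTriple.
Variables (alpha : hdual) (m : int).
Hypothesis ra : is_root alpha.

Definition aff_e := X (eX alpha) m.
Definition aff_f := X (eY alpha) (- m).
Definition aff_t v := X (vsval (eH alpha)) 0 v + (m%:~R * B (eX alpha) (eY alpha)) *: K v.

Lemma aff_ef v : aff_e (aff_f v) - aff_f (aff_e v) = aff_t v.
Proof.
by have [_ _ XY _ _] := triple ra; rewrite /aff_e /aff_f XX XY subrr eqxx.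
Qed.

Lemma aff_te v : aff_t (aff_e v) - aff_e (aff_t v) = 2 *: aff_e v.
Proof.
have [aX _ _ aH _] := triple ra.
rewrite /aff_t /aff_e (linD (Xr _ _)) (linZ (Xr _ _)) (aff_KX XI) opprD addrACA subrr addr0.
by rewrite XX mul0r if_same scale0r addr0 add0r aX aH (linZ (Xl _ _)).
Qed.

Lemma aff_tf v : aff_t (aff_f v) - aff_f (aff_t v) = - 2 *: aff_f v.
Proof.
have [_ aY _ aH _] := triple ra.
rewrite /aff_t /aff_f (linD (Xr _ _)) (linZ (Xr _ _)) (aff_KX XI) opprD addrACA subrr addr0.
by rewrite XX mul0r if_same scale0r addr0 add0r aY lfunE /= aH (linZ (Xl _ _)).
Qed.

Lemma aff_t_wt a k d v : wt a k d v ->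
  aff_t v = (a (eH alpha) + m%:~R * (k * B (eX alpha) (eY alpha))) *: v.
Proof.
by move=> [av kv _]; rewrite /aff_t av kv scalerA -scalerDl; congr (_ *: _); ring.
Qed.

Lemma aff_e_nil v : exists N, iter N aff_e v = 0.
Proof. by have [aX _ _ _ _] := triple ra; exact: (aff_nil XI _ _ ra aX). Qed.

Lemma aff_f_nil v : exists N, iter N aff_f v = 0.
Proof.
have [_ aY _ _ _] := triple ra; apply: (aff_nil XI _ _ _ aY).
exact: is_root_opp B rhoI _ ra.
Qed.

Lemma aff_t_int a k d v : wt a k d v -> v <> 0 -> exists z : int,
  a (eH alpha) + m%:~R * (k * B (eX alpha) (eY alpha)) = z%:~R.
Proof.
move=> av v0.
exact: (sl2_weight_int (Xr _ _) (Xr _ _) aff_ef aff_te aff_tf v0 (aff_t_wt av)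
  aff_e_nil aff_f_nil).
Qed.

Lemma aff_f_inj a k d p v : wt a k d v ->
  a (eH alpha) + m%:~R * (k * B (eX alpha) (eY alpha)) = p.+1%:R ->
  aff_e (aff_f v) = 0 -> v = 0.
Proof.
move=> av ap ef0; apply: (sl2_raise_inj (Xr _ _) (Xr _ _) aff_ef aff_te _ ef0 (m := p)).
  by rewrite (aff_t_wt av) ap.
exact: aff_e_nil.
Qed.

(** The argument of [aff_f_inj] for the triple with [aff_e] and [aff_f] exchanged and [aff_t]
    negated. *)
Lemma aff_e_inj a k d p v : wt a k d v ->
  a (eH alpha) + m%:~R * (k * B (eX alpha) (eY alpha)) = - p.+1%:R ->
  aff_e v = 0 -> v = 0.
Proof.
move=> av ap e0.
have fe u : aff_f (aff_e u) - aff_e (aff_f u) = - aff_t u by rewrite -aff_ef opprB.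
have tf u : - aff_t (aff_f u) - aff_f (- aff_t u) = 2 *: aff_f u.
  by rewrite (linN (f := aff_f) (Xr _ _)) -opprD aff_tf scaleNr opprK.
apply: (sl2_raise_inj (Xr _ _) (Xr _ _) fe tf (m := p)).
- by rewrite (aff_t_wt av) ap scaleNr opprK.
- by rewrite -/(aff_e v) e0 (lin0 (Xr _ _)).
- exact: aff_f_nil.
Qed.
End AffineTriple.

(** * Bounds on the weights of a fixed nonzero level *)

Variables (k d0 : F).
Hypothesis k0 : k != 0.
Hypothesis wt0 : exists a v, wt a k d0 v /\ v <> 0.

(** This number is the difference of the eigenvalues of [aff_t] on one weight vector for [m = 1] and
    [m = 0], both integers. *)
Lemma level_int (alpha : hdual) : is_root alpha ->
  exists z : int, k * B (eX alpha) (eY alpha) = z%:~R.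
Proof.
move=> ra; have [a [v [av v0]]] := wt0.
have [z1 z1E] := aff_t_int 1 ra av v0; have [z2 z2E] := aff_t_int 0 ra av v0.
exists (z1 - z2); rewrite intrB -z1E -z2E mul0r addr0 mul1r.
by rewrite addrC addKr.
Qed.

(** Since [B] is a multiple of the trace form, all these numbers are one scalar [r] times the
    positive norms of coroots. Integrality makes [r] real, and [e] is its sign. *)
Lemma level_sign : exists e : int, `|e| = 1 /\
  forall alpha, is_root alpha -> exists p : nat,
    e%:~R * (k * B (eX alpha) (eY alpha)) = p.+1%:R.
Proof.
have [c c0 kE] := trace_form_scale g_simple h_cartan rhoI triple b_basis gamP.
have BE alpha : is_root alpha ->
    k * B (eX alpha) (eY alpha) = k / (2 * c) * coroot_norm eH b alpha.
  move=> ra; have [_ aY XY aH _] := triple ra.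
  rewrite /coroot_norm kE (inv_form_cartan (form_invariant B) _ aY XY) aH.
  by field.
set r := k / (2 * c) in BE.
have r0 : r != 0.
  by rewrite /r mulf_neq0 // invr_eq0 mulf_neq0 // pnatr_eq0.
have [al ral] := exists_root g_simple h_cartan rhoI.
have kp := coroot_norm_gt0 rhoI triple b_basis gamP.
have rreal : r \is Num.real.
  have [z zE] := level_int ral; have := BE _ ral; rewrite zE => E.
  have -> : r = z%:~R / coroot_norm eH b al.
    by rewrite E mulfK // gt_eqF // kp.
  by rewrite realM ?realz // realV gtr0_real // kp.
have [e [e1 er]] : exists e : int, `|e| = 1 /\ 0 < e%:~R * r.
  have [r_gt|r_lt|rE] := real_ltgt0P rreal.
  - by exists 1; rewrite normr1 mul1r.
  - by exists (- 1); rewrite normrN1 mulN1r oppr_gt0.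
  - by rewrite rE eqxx in r0.
exists e; split=> // alpha ra; have [z zE] := level_int ra.
have : 0 < e%:~R * (k * B (eX alpha) (eY alpha)).
  by rewrite (BE _ ra) mulrA mulr_gt0 // kp.
rewrite zE -intrM ltr0z; case: (e * z) => [[|p]|p] // _.
by exists p.
Qed.

Variables (e : int) (lev : hdual -> nat).
Hypothesis levP : forall alpha, is_root alpha ->
  e%:~R * (k * B (eX alpha) (eY alpha)) = (lev alpha).+1%:R.

(* The index s counts multiples of e delta, where the sign e is chosen so that
   e delta points in the direction in which weights turn out to be bounded. *)
Definition lev_wt (a : hdual) (s : int) : V -> Prop := wt a k (d0 + (e * s)%:~R).
Definition has_wt (a : hdual) (s : int) : Prop := exists2 v, lev_wt a s v & v <> 0.

Lemma lev_wt_e (alpha a : hdual) s j v : is_root alpha -> lev_wt a s v ->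
  lev_wt (a + alpha) (s + j) (aff_e alpha (e * j) v).
Proof.
move=> ra av; have [aX _ _ _ _] := triple ra.
by rewrite /lev_wt mulrDr intrD addrA; exact: wt_X.
Qed.

Lemma lev_wt_f (alpha a : hdual) s j v : is_root alpha -> lev_wt (a + alpha) (s + j) v ->
  lev_wt a s (aff_f alpha (e * j) v).
Proof.
move=> ra av; have [_ aY _ _ _] := triple ra.
have := wt_X (- (e * j)) aY av; rewrite addrK -addrA -intrD.
by rewrite mulrDr addrK.
Qed.

Lemma lev_value (alpha a : hdual) j : is_root alpha ->
  a (eH alpha) + (e * j)%:~R * (k * B (eX alpha) (eY alpha)) =
  a (eH alpha) + j%:~R * (lev alpha).+1%:R.
Proof. by move=> ra; rewrite -levP // rmorphM /=; ring. Qed.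

Lemma has_wt_int (alpha a : hdual) s : is_root alpha -> has_wt a s ->
  exists z : int, a (eH alpha) = z%:~R.
Proof.
move=> ra [v av v0]; have [z zE] := aff_t_int 0 ra av v0.
by exists z; rewrite -zE mul0r addr0.
Qed.

Lemma lev_f_inj (alpha a : hdual) s j v : is_root alpha -> lev_wt a s v ->
  0 < a (eH alpha) + j%:~R * (lev alpha).+1%:R ->
  aff_e alpha (e * j) (aff_f alpha (e * j) v) = 0 -> v = 0.
Proof.
move=> ra av gt0; case: (pselect (v = 0)) => // v0.
have [z zE] : exists z : int, a (eH alpha) = z%:~R.
  by apply: (has_wt_int (s := s) ra); exists v.
have [p pE] : exists p : nat, a (eH alpha) + j%:~R * (lev alpha).+1%:R = p.+1%:R.
  move: gt0; rewrite zE pmulrn -rmorphM -rmorphD /= ltr0z.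
  by case: (z + _) => [[|p]|p] // _; exists p.
by apply: (aff_f_inj ra av); rewrite lev_value // pE.
Qed.

Lemma lev_e_inj (alpha a : hdual) s j v : is_root alpha -> lev_wt a s v ->
  a (eH alpha) + j%:~R * (lev alpha).+1%:R < 0 ->
  aff_e alpha (e * j) v = 0 -> v = 0.
Proof.
move=> ra av lt0; case: (pselect (v = 0)) => // v0.
have [z zE] : exists z : int, a (eH alpha) = z%:~R.
  by apply: (has_wt_int (s := s) ra); exists v.
have [p pE] : exists p : nat, a (eH alpha) + j%:~R * (lev alpha).+1%:R = - p.+1%:R.
  move: lt0; rewrite zE pmulrn -rmorphM -rmorphD /= ltrz0.
  by case: (z + _) => // p _; exists p; rewrite NegzE rmorphN.
by apply: (aff_e_inj ra av); rewrite lev_value // pE.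
Qed.

(** The positive number is the weight of [a + alpha] for the triple of [alpha] shifted by [j], as
    [alpha] takes the value 2 on its coroot; lowering is injective there. *)
Lemma has_wt_lower (alpha a : hdual) s j : is_root alpha -> has_wt (a + alpha) (s + j) ->
  0 < a (eH alpha) + 2 + j%:~R * (lev alpha).+1%:R -> has_wt a s.
Proof.
move=> ra [v av v0] gt0; have [_ _ _ aH _] := triple ra.
exists (aff_f alpha (e * j) v); first exact: lev_wt_f.
move=> f0; apply: v0; apply: (lev_f_inj ra av (j := j)); first by rewrite lfunE /= aH.
by rewrite f0; exact: (lin0 (Xr _ _)).
Qed.

Lemma has_wt_raise (alpha a : hdual) s j : is_root alpha -> has_wt a s ->
  a (eH alpha) + j%:~R * (lev alpha).+1%:R < 0 -> has_wt (a + alpha) (s + j).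
Proof.
move=> ra [v av v0] lt0; exists (aff_e alpha (e * j) v); first exact: lev_wt_e.
by move=> /(lev_e_inj ra av lt0).
Qed.

(* If all these spaces were nonzero, start at one of minimal dimension: lowering
   operators are then bijective along the ray in direction alpha + j delta, so the
   raising operator is injective on it, contradicting its local nilpotency. *)
Lemma exists_not_wt (alpha a : hdual) : is_root alpha ->
  exists (p : nat) (s : int), ~ has_wt (a + alpha *+ p) s.
Proof.
move=> ra; have [_ _ _ aH _] := triple ra; apply: contrapT => all_wt.
have {}all_wt p s : has_wt (a + alpha *+ p) s.
  by apply: contrapT => nw; apply: all_wt; exists p, s.
pose Q m := `[< exists (p : nat) s, hasdim (lev_wt (a + alpha *+ p) s) m >].
have exQ : exists m, Q m.
  by have [m mP] := aff_fin XI a k (d0 + (e * 0)%:~R); exists m; apply/asboolP;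
    exists 0%N, 0; rewrite addr0.
case: (ex_minnP exQ) => m /asboolP[p [s dm]] minm.
have [z zE] : exists z : int, a (eH alpha) = z%:~R.
  by apply: (has_wt_int (s := 0) ra); have := all_wt 0%N 0; rewrite addr0.
(* With this slope the weight for the triple is positive at every point of the ray, as
   [lev alpha + 1] is at least 1. *)
pose j := `|z|%N%:Z.
have gt0 q : 0 < (a + alpha *+ q) (eH alpha) + 2 + j%:~R * (lev alpha).+1%:R.
  rewrite lfunE /= -scaler_nat scale_lfunE /= aH zE /GRing.scale /=.
  rewrite -[2]/(2%:~R) -natrM !pmulrn -rmorphM -!rmorphD /= ltr0z.
  by rewrite /j; nia.
have step q t : hasdim (lev_wt (a + alpha *+ q) t) m ->
    hasdim (lev_wt (a + alpha *+ q.+1) (t + j)) m /\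
    forall v, lev_wt (a + alpha *+ q) t v -> aff_e alpha (e * j) v = 0 -> v = 0.
  move=> dq; have aS : a + alpha *+ q.+1 = a + alpha *+ q + alpha by rewrite mulrSr addrA.
  have [m' dm'] := aff_fin XI (a + alpha *+ q.+1) k (d0 + (e * (t + j))%:~R).
  have le_mm' : (m <= m')%N by apply: minm; apply/asboolP; exists q.+1, (t + j).
  have finj v : lev_wt (a + alpha *+ q.+1) (t + j) v ->
      aff_e alpha (e * j) (aff_f alpha (e * j) v) = 0 -> v = 0.
    rewrite aS => vw; apply: (lev_f_inj ra vw).
    by rewrite [_ (eH alpha)]lfunE /= aH gt0.
  have [le_m'm fsurj] : (m' <= m)%N /\ ((m <= m')%N -> forall w, lev_wt (a + alpha *+ q) t w ->
      exists2 v, lev_wt (a + alpha *+ q.+1) (t + j) v & w = aff_f alpha (e * j) v).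
    apply: (hasdim_inj (Xr _ _) dm' dq).
      by move=> v; rewrite aS; exact: lev_wt_f.
    move=> v vw f0; apply: (finj v vw); rewrite /aff_f f0.
    exact: (lin0 (Xr _ _)).
  have mm' : m' = m by apply/eqP; rewrite eqn_leq le_mm' le_m'm.
  split; first by rewrite -mm'.
  move=> v vw e0; have [u uw vE] := fsurj le_mm' _ vw.
  by rewrite vE (finj u uw) -?vE //; exact: (lin0 (Xr _ _)).
have [v vw v0] := all_wt p s.
have [N eN] := aff_e_nil (e * j) ra v.
suff [_ _ []] : [/\ hasdim (lev_wt (a + alpha *+ (p + N)) (s + j *+ N)) m,
    lev_wt (a + alpha *+ (p + N)) (s + j *+ N) (iter N (aff_e alpha (e * j)) v) &
    iter N (aff_e alpha (e * j)) v <> 0] by [].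
elim: {eN} N => [|N [dN wN N0]]; first by rewrite addn0 addr0.
have [dS inj] := step _ _ dN.
rewrite addnS [j *+ _]mulrSr addrA; split=> //=; last by move/(inj _ wN).
by rewrite mulrSr addrA; exact: lev_wt_e.
Qed.

(** Lowering from [a + alpha] at height [t] with shift [t - s] would reach the missing weight, and
    it is injective once [t - s] is at least the absolute value of [a] on the coroot. If that value
    is not an integer, [a + alpha] is never a weight. *)
Lemma not_wt_add (alpha a : hdual) s : is_root alpha -> ~ has_wt a s ->
  exists s1, forall t, s1 <= t -> ~ has_wt (a + alpha) t.
Proof.
move=> ra nw; have [_ _ _ aH _] := triple ra.
case: (pselect (exists z : int, a (eH alpha) = z%:~R)) => [[z zE]|nz].
  exists (s + `|z|%N%:Z) => t le_t wt_t; apply: nw.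
  apply: (has_wt_lower (j := t - s) ra); first by rewrite [s + _]addrC subrK.
  rewrite zE -[2]/(2%:~R) [(lev alpha).+1%:R]pmulrn -intrM -!intrD ltr0z.
  by nia.
exists 0 => t _ wt_t; apply: nz; have [z] := has_wt_int ra wt_t.
by rewrite lfunE /= aH => E; exists (z - 2); rewrite intrB -E addrK.
Qed.

(** The missing weight of [exists_not_wt] is carried back to [a] by repeated use of [not_wt_add]
    with [- alpha]. One more step along [alpha] and back turns a single missing height into all
    large ones. *)
Lemma string_bounded (a : hdual) : exists s1, forall t, s1 <= t -> ~ has_wt a t.
Proof.
have [alpha ra] := exists_root g_simple h_cartan rhoI.
have rNa := is_root_opp B rhoI ra.
have [p [s nw]] := exists_not_wt a ra.
have {p nw}[s0 nw] : exists s, ~ has_wt a s.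
  elim: p s nw => [|p IH] s; first by rewrite addr0; exists s.
  move=> /(not_wt_add rNa)[s1 /(_ s1)]; rewrite mulrSr addrA addrK => nw.
  exact: IH (nw (lexx _)).
have [s1 /(_ s1 (lexx _)) nw1] := not_wt_add ra nw.
by have := not_wt_add rNa nw1; rewrite addrK.
Qed.

(** Applied to [alpha] and [- alpha], whose coroots are opposite on functionals, the condition
    bounds [a] on each coroot from both sides. *)
Definition in_alcove (a : hdual) : Prop :=
  forall alpha, is_root alpha -> 0 <= a (eH alpha) + (lev alpha).+1%:R.

(** The weight for the triple of alpha + e delta is negative, so raising is injective; and
    [a (eH alpha) + 1] is negative, so [wnormD] gives a drop of the norm. *)
Lemma has_wt_ascend (alpha a : hdual) s : is_root alpha -> has_wt a s ->
  ~~ (0 <= a (eH alpha) + (lev alpha).+1%:R) ->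
  has_wt (a + alpha) (s + 1) /\ wnorm eH b gam (a + alpha) < wnorm eH b gam a.
Proof.
move=> ra aw; have [z zE] := has_wt_int ra aw.
rewrite zE pmulrn -intrD ler0z -ltNge => lt0; split.
  by apply: has_wt_raise => //; rewrite mul1r zE pmulrn -intrD ltrz0.
have kp := coroot_norm_gt0 rhoI triple b_basis gamP ra.
rewrite (wnormD g_simple h_cartan rhoI triple b_basis gamP) // gtrDl.
rewrite pmulr_rlt0; first by rewrite zE -[1]/(1%:~R) -intrD ltrz0; lia.
by rewrite divr_gt0 // ltr0n.
Qed.

(** Each ascent lowers a natural number, the rescaled norm, while the height only grows. *)
Lemma alcove_reached (a : hdual) s : has_wt a s ->
  exists a' s', [/\ has_wt a' s', s <= s' & in_alcove a'].
Proof.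
have [N N0 NP] := wnorm_nat rhoI triple b_basis gamP.
have natN a' t : has_wt a' t -> exists m : nat, N * wnorm eH b gam a' = m%:R.
  by move=> aw; apply: NP => alpha ra; exact: has_wt_int ra aw.
move=> aw; have [m mE] := natN _ _ aw.
elim/ltn_ind: m a s aw mE => m IH a s aw mE.
case: (pselect (in_alcove a)) => [aal|]; first by exists a, s.
move=> /existsNP[alpha /not_implyP[ra /negP na]].
have [aw' lt_a] := has_wt_ascend ra aw na.
have [m' mE'] := natN _ _ aw'.
have lt_m : (m' < m)%N by rewrite -(ltr_nat F) -mE -mE' ltr_pM2l.
have [a' [s' [w' le_s al']]] := IH m' lt_m _ _ aw' mE'.
by exists a', s'; split=> //; lia.
Qed.

(** The values on coroots are integers between [- N] and [N], where the sum of all levels is a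
    uniform bound; shifting by [N] makes them ordinals. The code makes the finiteness of the alcove
    usable. *)
Lemma alcove_code : exists N : nat, forall a s, has_wt a s -> in_alcove a ->
  exists c : {ffun 'I_n -> 'I_N.*2.+1}, forall i, gam i != 0 ->
    a (eH (gam i)) = (c i : nat)%:R - N%:R.
Proof.
pose N := \sum_i ((lev (gam i)).+1 + (lev (- gam i)).+1)%N; exists N => a s aw al.
suff /choice[c cP] : forall i, exists r : 'I_N.*2.+1, gam i != 0 ->
    a (eH (gam i)) = (r : nat)%:R - N%:R.
  by exists (finfun c) => i /cP ->; rewrite ffunE.
move=> i; case: (altP (gam i =P 0)) => [_|g0]; first by exists ord0.
have ri := is_root_gam b_basis gamP g0.
have [z zE] := has_wt_int ri aw.
have le1 := al _ ri; have le2 := al _ (is_root_opp B rhoI ri).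
rewrite (corootN g_simple h_cartan rhoI triple b_basis gamP) // in le2.
move: le1 le2; rewrite zE [(lev (gam i)).+1%:R]pmulrn [(lev (- gam i)).+1%:R]pmulrn.
rewrite -intrN -!intrD !ler0z => le1 le2.
have le_N : ((lev (gam i)).+1 + (lev (- gam i)).+1 <= N)%N.
  by rewrite /N (bigD1 i) //= leq_addr.
have lt_N : (`|(z + N%:Z)%R| < N.*2.+1)%N by lia.
exists (Ordinal lt_N) => _ /=; rewrite natr_absz ger0_norm; last by lia.
by rewrite intrD -pmulrn addrK.
Qed.

(** A code determines its weight, so [string_bounded] gives one bound [T c] per code; their sum
    bounds all weights in the alcove, and every weight lies below one of these. *)
Lemma height_bounded : exists S : int, forall a s, has_wt a s -> s <= S.
Proof.
have [N codeP] := alcove_code.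
pose coded (c : {ffun 'I_n -> 'I_N.*2.+1}) (a : hdual) :=
  forall i, gam i != 0 -> a (eH (gam i)) = (c i : nat)%:R - N%:R.
have coded_inj c a a' : coded c a -> coded c a' -> a = a'.
  move=> ca ca'; apply: (eq_on_coroots g_simple h_cartan rhoI triple b_basis gamP).
  by move=> i g0; rewrite ca // ca'.
have /choice[T TP] : forall c, exists t : nat,
    forall a s, has_wt a s -> coded c a -> s <= t%:Z.
  move=> c; case: (pselect (exists a, coded c a)) => [[a ca]|na]; last first.
    by exists 0%N => a s _ ca; case: na; exists a.
  have [s1 s1P] := string_bounded a; exists `|s1|%N => a' s aw' ca'.
  rewrite (coded_inj _ _ _ ca' ca) in aw'; rewrite leNgt; apply/negP => lt_s.
  by apply: s1P aw'; lia.
exists (\sum_c T c)%N%:Z => a s aw.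
have [a' [s' [aw' le_s al]]] := alcove_reached aw.
have [c cP] := codeP _ _ aw' al; apply: (le_trans le_s).
apply: (le_trans (TP c _ _ aw' cP)); rewrite lez_nat.
by rewrite (bigD1 c) //= leq_addr.
Qed.

Lemma exists_top : exists a s, has_wt a s /\ forall a' s', has_wt a' s' -> s' <= s.
Proof.
have [S SP] := height_bounded; have [a0 [v0 [v0w v0n]]] := wt0.
have w0 : has_wt a0 0 by exists v0 => //; rewrite /lev_wt mulr0 addr0.
move: (0 : int) a0 w0 {v0w} => s a aw; have [m mE] : exists m : nat, S - s = m%:Z.
  by have := SP _ _ aw; exists `|S - s|%N; lia.
elim/ltn_ind: m s a aw mE => m IH s a aw mE.
case: (pselect (forall a' s', has_wt a' s' -> s' <= s)) => [H|]; first by exists a, s.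
move=> /existsNP[a' /existsNP[s' /not_implyP[aw' /negP lt_s]]].
have le_S := SP _ _ aw'.
apply: (IH `|S - s'|%N _ s' a' aw'); lia.
Qed.

(** At the top height no ascent is possible, so all weights are in the alcove and have codes. If
    each could be increased by a root of [Q], iteration would repeat a code, hence a weight, and a
    nonempty sum of positive roots would vanish. *)
Theorem exists_extremal_weight : exists s, (exists a, has_wt a s) /\
  (forall a' s', has_wt a' s' -> s' <= s) /\
  forall Q : {pred hdual}, positive_system Q -> exists2 a, has_wt a s &
    forall alpha, alpha \in Q -> ~ has_wt (a + alpha) s.
Proof.
have [a0 [s [aw0 top]]] := exists_top; exists s; split; first by exists a0.
split=> // Q Qpos; apply: contrapT => /forall2NP nQ.
have [N codeP] := alcove_code.
have al a : has_wt a s -> in_alcove a.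
  move=> aw alpha ra; apply: contrapT => /negP na.
  by have [/top] := has_wt_ascend ra aw na; lia.
have /choice[nxt nxtP] : forall a, exists alpha, has_wt a s ->
    alpha \in Q /\ has_wt (a + alpha) s.
  move=> a; case: (pselect (has_wt a s)) => [aw|nw]; last by exists 0.
  have [//|/existsNP[alpha /not_implyP[aQ /contrapT aw']]] := nQ a.
  by exists alpha.
pose f a := a + nxt a.
have fw i : has_wt (iter i f a0) s by elim: i => //= i /nxtP[].
have fE i m : iter (i + m) f a0 =
    iter i f a0 + \sum_(alpha <- [seq nxt (iter t f a0) | t <- iota i m]) alpha.
  elim: m => [|m IH]; first by rewrite addn0 big_nil addr0.
  by rewrite -[in iota _ _]addn1 iotaD map_cat big_cat addrA -IH addnS /= big_seq1.
have /choice[c cP] : forall i : nat, exists c : {ffun 'I_n -> 'I_N.*2.+1},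
    forall j, gam j != 0 -> iter i f a0 (eH (gam j)) = (c j : nat)%:R - N%:R.
  by move=> i; exact: codeP (fw i) (al _ (fw i)).
have [i [j [lt_ij cij]]] := finType_repeat c.
have : iter i f a0 = iter j f a0.
  apply: (eq_on_coroots g_simple h_cartan rhoI triple b_basis gamP) => t t0.
  by rewrite !cP // cij.
rewrite -(subnKC (ltnW lt_ij)) fE => /eqP; rewrite -subr_eq0 opprD addNKr oppr_eq0.
apply/negP.
apply: (sum_positive_neq0 rhoI triple b_basis gamP Qpos).
  by rewrite -size_eq0 size_map size_iota -lt0n subn_gt0.
by move=> _ /mapP[t _ ->]; case: (nxtP _ (fw t)).
Qed.

End AffineWeights.

Theorem extremal_affine_weight (F : numClosedFieldType) (g : finLieAlgType F)
    (h : {vspace g}) (V : lmodType F) (B : invForm g)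
    (X : g -> int -> V -> V) (L0 K : V -> V) :
  simple_lie g -> cartan_subalgebra h -> integrable_affine_rep h B X L0 K ->
  exists (e : int) (k d : F), [/\ `|e| = 1,
    forall (a : dual (subvs_of h)) (m : nat) v, (0 < m)%N ->
      aff_weight X L0 K a k (d + (e * m%:Z)%:~R) v -> v = 0 &
    forall Q : {pred dual (subvs_of h)}, positive_system Q ->
      exists2 a : dual (subvs_of h), exists2 v, aff_weight X L0 K a k d v & v <> 0 &
        forall alpha v, alpha \in Q ->
          aff_weight X L0 K (a + alpha) k d v -> v = 0].
Proof.
move=> g_simple h_cartan XI; have rhoI := X0_integrable XI g_simple.
have /choice[t tP] : forall alpha : dual (subvs_of h), exists t : g * g * subvs_of h,
    is_root alpha -> sl2_triple B alpha t.1.1 t.1.2 t.2.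
  move=> alpha; case: (pselect (is_root alpha)) => [ra|nr]; last by exists (0, 0, 0).
  have [x [y [H xyH]]] := sl2_triple_exists B h_cartan rhoI ra.
  by exists (x, y, H).
have [n [b [gam [b_basis gamP]]]] := root_basis rhoI.
have [a0 [k [d0 [v0 [av0 v0n /eqP k0]]]]] := exists_wt XI.
have wt0 : exists (a : dual (subvs_of h)) v, aff_weight X L0 K a k d0 v /\ v <> 0.
  by exists a0, v0.
have [e [e1 eP]] := level_sign XI g_simple h_cartan tP b_basis gamP k0 wt0.
have /choice[lev levP] : forall alpha : dual (subvs_of h), exists p : nat, is_root alpha ->
    e%:~R * (k * B (t alpha).1.1 (t alpha).1.2) = p.+1%:R.
  move=> alpha; case: (pselect (is_root alpha)) => [/eP[p pE]|nr]; last by exists 0%N.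
  by exists p.
have [s [_ [top domi]]] :=
  exists_extremal_weight XI g_simple h_cartan tP b_basis gamP k0 wt0 levP.
exists e, k, (d0 + (e * s)%:~R); split=> // [a m v m_gt0 av|Q /domi[a [v av v0'] aQ]].
  apply: contrapT => v0'; suff : s + m%:Z <= s by lia.
  by apply: (top a); exists v => //; rewrite /lev_wt mulrDr intrD addrA.
exists a; first by exists v.
by move=> alpha w /aQ nw ww; apply: contrapT => w0; apply: nw; exists w.
Qed.

(** * Modules over tau(A) *)

Section TauModule.
Variables (F : numClosedFieldType) (g : finLieAlgType F) (B : invForm g).
Variables (A : comAlgType F) (h : {vspace g}) (V : lieModType (tauA B A)).
Notation hdual := (dual (subvs_of h)).

Lemma tauX_linear n : linear (fun x => tauX B x n).
Proof.
move=> c x y; rewrite /tauX -lie_pi_linear; congr lie_pi.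
apply: injective_projections; apply: injective_projections => /=.
- by rewrite scaler0 addr0.
- by rewrite scaler0 addr0.
- exact: (tens_bilin _ _).1.
- by rewrite scaler0 addr0.
Qed.

Lemma tauA_lieE (x y : tau B) (a c : A) :
  lie (x ⊗ a : tauA B A) (y ⊗ c) = lie x y ⊗ (a * c).
Proof. exact: current_lieE. Qed.

Definition tact (x : tau B) (a : A) (v : V) : V := lact (x ⊗ a : tauA B A) v.

Lemma tact_linear_l a v : linear (fun x => tact x a v).
Proof. by move=> c x y; rewrite /tact (tens_bilin _ _).1; exact: (@lact_bilin _ _ V).1. Qed.

Lemma tact_linear_r x a : linear (tact x a).
Proof. exact: (@lact_bilin _ _ V).2. Qed.

Lemma tact_lie x y a c v :
  tact x a (tact y c v) - tact y c (tact x a v) = tact (lie x y) (a * c) v.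
Proof. by rewrite /tact -lact_lie tauA_lieE. Qed.

Lemma lie_tauK x : lie x (tauK B) = 0.
Proof. by rewrite lieC tauK_central oppr0. Qed.

Lemma tauX0_tauX (gam : hdual) x n (H : subvs_of h) : root_space gam x ->
  lie (tauX B (vsval H) 0) (tauX B x n) = (gam H : F) *: tauX B x n.
Proof.
move=> gx; rewrite tauXX gx (linZ (tauX_linear _)) add0r mul0r if_same scale0r.
by rewrite addr0.
Qed.

Lemma tauX0_tauL x n : lie (tauX B x 0) (tauL B n) = 0.
Proof. by rewrite lieC tauLX scale0r oppr0. Qed.

Lemma tauL0_tauX x n : lie (tauL B 0) (tauX B x n) = n%:~R *: tauX B x n.
Proof. by rewrite tauLX addr0. Qed.

Lemma tauL0_tauL n : lie (tauL B 0) (tauL B n) = n%:~R *: tauL B n.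
Proof. by rewrite tauLL subr0 add0r expr0n subrr mul0r if_same scale0r addr0. Qed.

Notation Xop := (fun x n => tact (tauX B x n) 1).
Notation Lop := (tact (tauL B 0) 1).
Notation Kop := (tact (tauK B) 1).
Notation awt := (@aff_weight F g h V Xop Lop Kop).

(** Weights are taken for operators with coefficient 1, and bracketing with these preserves the
    coefficient [c], so all of [tau(A)] shifts weights as [tau] does. *)
Lemma tact_wt (gam a : hdual) (k d m : F) x c v :
  (forall H : subvs_of h, lie (tauX B (vsval H) 0) x = (gam H : F) *: x) ->
  lie (tauL B 0) x = m *: x -> awt a k d v ->
  awt (a + gam) k (d + m) (tact x c v).
Proof.
move=> Hx Lx [av kv dv]; split=> [H||].
- have := tact_lie (tauX B (vsval H) 0) x 1 c v.
  rewrite Hx (linZ (tact_linear_l _ _)) av (linZ (tact_linear_r _ _)) mul1r.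
  by move=> /(canRL (subrK _)) ->; rewrite -scalerDl lfunE addrC.
- have := tact_lie (tauK B) x 1 c v.
  rewrite tauK_central (lin0 (tact_linear_l _ _)) kv (linZ (tact_linear_r _ _)).
  by move/subr0_eq.
- have := tact_lie (tauL B 0) x 1 c v.
  rewrite Lx (linZ (tact_linear_l _ _)) dv (linZ (tact_linear_r _ _)) mul1r.
  by move=> /(canRL (subrK _)) ->; rewrite -scalerDl addrC.
Qed.

Lemma awt_subspace (a : hdual) k d : is_subspace (awt a k d).
Proof.
split=> [|c u v [au ku du] [av kv dv]].
  by split=> *; rewrite (lin0 (tact_linear_r _ _)) scaler0.
split=> [H||]; rewrite tact_linear_r.
- by rewrite au av scalerDr !scalerA mulrC.
- by rewrite ku kv scalerDr !scalerA mulrC.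
- by rewrite du dv scalerDr !scalerA mulrC.
Qed.

Lemma tact_hbar (x : hbar h) a v : tact (hbar_tau B x) a v =
  tact (tauX B (vsval x.1.1) 0) a v + x.1.2 *: tact (tauK B) a v +
  x.2 *: tact (tauL B 0) a v.
Proof.
by rewrite /hbar_tau !(linD (tact_linear_l _ _)) !(linZ (tact_linear_l _ _)).
Qed.

Lemma tauX00 : tauX B 0 0 = 0.
Proof. exact: (lin0 (tauX_linear 0)). Qed.

Lemma weight_space_awtP (lambda : dual (hbar h)) (a : hdual) (k d : F) v :
  (forall x, lambda x = a x.1.1 + x.1.2 * k + x.2 * d) ->
  weight_space lambda v <-> awt a k d v.
Proof.
move=> lE; split=> [vl|[va vk vd] x].
  split=> [H||].
  - have := vl (H, 0, 0); rewrite -/(tact _ _ _) tact_hbar lE /=.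
    by rewrite !scale0r !mul0r !addr0.
  - have := vl (0, 1, 0); rewrite -/(tact _ _ _) tact_hbar lE /= !linear0 tauX00.
    by rewrite (lin0 (tact_linear_l _ _)) scale1r scale0r mul1r mul0r !addr0 !add0r.
  - have := vl (0, 0, 1); rewrite -/(tact _ _ _) tact_hbar lE /= !linear0 tauX00.
    by rewrite (lin0 (tact_linear_l _ _)) scale1r scale0r mul1r mul0r !addr0 !add0r.
by rewrite -/(tact _ _ _) tact_hbar va vk vd !scalerA -!scalerDl lE.
Qed.

Lemma weight_space_awt (lambda : dual (hbar h)) :
  exists (a : hdual) k d, forall v, weight_space lambda v <-> awt a k d v.
Proof.
have [a aE] : exists a : hdual, forall H, a H = lambda (H, 0, 0).
  apply: dual_of_linear => c H H'; rewrite -linearP; congr (lambda _).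
  by apply: injective_projections; [apply: injective_projections|];
    rewrite /= ?scaler0 ?addr0.
exists a, (lambda (0, 1, 0)), (lambda (0, 0, 1)) => v; apply: weight_space_awtP.
move=> [[H y] z] /=; rewrite aE.
have -> : (H, y, z) = (H, 0, 0) + (y *: (0, 1, 0) + z *: (0, 0, 1)) :> hbar h.
  apply: injective_projections; [apply: injective_projections|] => /=.
  - by rewrite !scaler0 !addr0.
  - by rewrite scaler0 addr0 add0r /GRing.scale /= mulr1.
  - by rewrite scaler0 !add0r /GRing.scale /= mulr1.
by rewrite linearD linearD !linearZ addrA.
Qed.

Lemma awt_weight_space (a : hdual) k d :
  exists lambda : dual (hbar h), forall v, weight_space lambda v <-> awt a k d v.
Proof.
have [lambda lE] : exists lambda : dual (hbar h),
    forall x, lambda x = a x.1.1 + x.1.2 * k + x.2 * d.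
  apply: dual_of_linear => c x y /=; rewrite linearP /= /GRing.scale /=.
  by ring.
by exists lambda => v; exact: weight_space_awtP.
Qed.

Section Integrable.
Hypotheses (V_int : integrable_module h V).
Hypothesis K_nontriv : exists v : V, lact (tauK B ⊗ 1 : tauA B A) v != 0.

Lemma weight_decomp (v : V) : exists (r : seq (dual (hbar h))) (u : dual (hbar h) -> V),
  [/\ uniq r, forall i, weight_space i (u i) & v = \sum_(i <- r) u i].
Proof.
have [[span _] _ _] := V_int; have [r [u [uw ->]]] := span v.
(* An index may be repeated in [r]; its multiplicity is absorbed into the component. *)
exists (undup r), (fun i => u i *+ count_mem i r); split; first exact: undup_uniq.
  move=> i x; have := uw i x; rewrite -!/(tact _ _ _) => ux.
  elim: (count_mem _ _) => [|m IH].
    by rewrite !mulr0n (lin0 (tact_linear_r _ _)) scaler0.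
  by rewrite !mulrS (linD (tact_linear_r _ _)) ux IH scalerDr.
rewrite -big_undup_iterop_count; apply: eq_bigr => i _.
by rewrite Monoid.iteropE iter_addr addr0.
Qed.

(** On the component of weight [i] the operator [D] is multiplication by [i x - c]. Independence of
    weight spaces makes the square of this scalar kill the component, hence the scalar does so
    already. *)
Lemma tact_cartan_ss (H : subvs_of h) (c : F) (v : V) :
  Xop (vsval H) 0 (Xop (vsval H) 0 v - c *: v) -
    c *: (Xop (vsval H) 0 v - c *: v) = 0 -> Xop (vsval H) 0 v - c *: v = 0.
Proof.
have [[_ indep] _ _] := V_int; have [r [u [ur uw vE]]] := weight_decomp v.
pose D (w : V) := tact (tauX B (vsval H) 0) 1 w - c *: w.
have Dl : linear D by exact: sub_scale_linear (tact_linear_r _ _) c.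
pose x : hbar h := (H, 0, 0).
have Du i : D (u i) = (i x - c) *: u i.
  have := uw i x; rewrite -/(tact _ _ _) tact_hbar /= !scale0r !addr0.
  by rewrite /D => ->; rewrite scalerBl.
rewrite -/(D v) -/(D (D v)) vE !(lin_sum Dl) => D0.
have DDu i : D (D (u i)) = ((i x - c) * (i x - c)) *: u i.
  by rewrite Du (linZ Dl) Du scalerA.
have DDw i : weight_space i (D (D (u i))).
  move=> y; rewrite DDu -/(tact _ _ _) (linZ (tact_linear_r _ _)).
  have := uw i y; rewrite -/(tact _ _ _) => ->.
  by rewrite !scalerA mulrC.
rewrite big_seq big1 // => i ir; rewrite Du; apply/eqP.
have /eqP := indep r _ ur DDw D0 i ir; rewrite DDu.
by rewrite !scaler_eq0 mulf_eq0 orbb.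
Qed.

Lemma tact_affine_rep : integrable_affine_rep h B Xop Lop Kop.
Proof.
have [_ fd nil] := V_int; split.
- move=> n; split=> [v|x]; last exact: tact_linear_r.
  by apply: (lin_comp (tact_linear_l _ _)); exact: tauX_linear.
- exact: tact_linear_r.
- exact: tact_linear_r.
- move=> x y n m v; rewrite tact_lie tauXX mulr1 (linD (tact_linear_l _ _)).
  by rewrite (linZ (tact_linear_l _ _)).
- move=> x n v; apply/subr0_eq; rewrite tact_lie tauK_central.
  exact: (lin0 (tact_linear_l _ _)).
- move=> x n v; rewrite tact_lie tauL0_tauX mulr1.
  exact: (linZ (tact_linear_l _ _)).
- move=> v; have [r [u [_ uw ->]]] := weight_decomp v.
  apply: rpred_sum => i _; apply: mem_lspan.
  by have [a [k [d akd]]] := weight_space_awt i; exists a, k, d; apply/akd.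
- exact: tact_cartan_ss.
- move=> a k d; have [lambda lE] := awt_weight_space a k d.
  have [s sP] := fd lambda; apply: (hasdim_of_span (awt_subspace a k d) (s := s)).
  by move=> v /lE /sP.
- by move=> alpha n x v ra ax; exact: nil ra ax.
- by have [v /eqP Kv] := K_nontriv; exists v.
Qed.

Lemma lie_hbar (x y : hbar h) : simple_lie g -> cartan_subalgebra h ->
  lie (hbar_tau B x) (hbar_tau B y) = 0.
Proof.
move=> g_simple h_cartan; have rhoI := X0_integrable tact_affine_rep g_simple.
rewrite /hbar_tau !(linD (lie_bilin.1 _)) !(linZ (lie_bilin.1 _)).
rewrite !(linD (lie_bilin.2 _)) !(linZ (lie_bilin.2 _)) !tauK_central !lie_tauK.
rewrite tauX0_tauL tauL0_tauX tauL0_tauL.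
rewrite (tauX0_tauX _ _ (cartan_root_space0 rhoI _)) lfunE.
by rewrite !(scale0r, scaler0, addr0).
Qed.

Definition tauA_part (Q : {pred hdual}) (e : int) : {pred tauA B A} :=
  lspan (fun x : tauA B A =>
    x \in sub_tens (N_part Q e) \/ x \in sub_tens (L_part e)).

(** The sign [e] is fixed before [Q], so that the positive system can be matched to it
    afterwards. *)
Lemma extremal_weight_exists (g_simple : simple_lie g) (h_cartan : cartan_subalgebra h)
    (V_irr : irreducible_lieMod V) :
  exists2 e : int, `|e| = 1 & forall Q : {pred hdual}, positive_system Q ->
    extremal_weight h V (tauA_part Q e).
Proof.
have XI := tact_affine_rep; have rhoI := X0_integrable XI g_simple.
have [e [k [d [e1 top domi]]]] := extremal_affine_weight g_simple h_cartan XI.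
exists e => // Q /domi[a [v0 v0w v0n] aQ].
(* Root vectors span [g], and each of them would move [v] to a degree beyond the top one. *)
have killX x n c v : (0 < n)%N -> awt a k d v -> tact (tauX B x (e * n%:Z)) c v = 0.
  move=> n0 vw; have := root_vectors_span rhoI x.
  apply: (lspan_subspace (W := fun x => tact (tauX B x (e * n%:Z)) c v = 0)).
    split=> [|b y z y0 z0].
      by rewrite (lin0 (tauX_linear _)) (lin0 (tact_linear_l _ _)).
    by rewrite tauX_linear tact_linear_l y0 z0 scaler0 addr0.
  move=> y [gam gy]; apply: (top (a + gam) n) => //.
  by apply: tact_wt vw => [H|]; [exact: tauX0_tauX|exact: tauL0_tauX].
have killL n c v : (0 < n)%N -> awt a k d v -> tact (tauL B (e * n%:Z)) c v = 0.
  move=> n0 vw; apply: (top (a + 0) n) => //; apply: tact_wt vw => [H|].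
    by rewrite tauX0_tauL lfunE scale0r.
  exact: tauL0_tauL.
have killQ x c v : x \in nil_part Q -> awt a k d v -> tact (tauX B x 0) c v = 0.
  move=> xQ vw; move: x xQ.
  apply: (lspan_subspace (W := fun x => tact (tauX B x 0) c v = 0)).
    split=> [|b y z y0 z0].
      by rewrite tauX00 (lin0 (tact_linear_l _ _)).
    by rewrite tauX_linear tact_linear_l y0 z0 scaler0 addr0.
  move=> y [alpha alQ ay]; apply: (aQ alpha) => //; rewrite -[d]addr0.
  by apply: tact_wt vw => [H|]; [exact: tauX0_tauX|exact: tauL0_tauX].
have kill x v : x \in tauA_part Q e -> awt a k d v -> lact x v = 0.
  move=> xT vw; move: x xT.
  have lact0 (W : {pred tau B}) : (forall y c, y \in W -> tact y c v = 0) ->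
      forall x : tauA B A, x \in sub_tens W -> lact x v = 0.
    move=> W0; apply: (lspan_subspace (W := fun x => lact x v = 0)).
      split=> [|b y z y0 z0]; first exact: (lin0 ((@lact_bilin _ _ V).1 v)).
      by rewrite (@lact_bilin _ _ V).1 y0 z0 scaler0 addr0.
    by move=> _ [y yW [c ->]]; exact: W0.
  have tl c := tact_linear_l c v.
  apply: (lspan_subspace (W := fun x => lact x v = 0)).
    split=> [|b y z y0 z0]; first exact: (lin0 ((@lact_bilin _ _ V).1 v)).
    by rewrite (@lact_bilin _ _ V).1 y0 z0 scaler0 addr0.
  move=> x [] ; apply: lact0 => y c; move: y;
    apply: (lspan_subspace (W := fun y => tact y c v = 0)).
  - by split=> [|b y z y0 z0]; rewrite ?(lin0 (tl c)) // tl y0 z0 scaler0 addr0.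
  - by move=> y [[z zQ ->]|[z [n [n0 ->]]]]; [exact: killQ|exact: killX].
  - by split=> [|b y z y0 z0]; rewrite ?(lin0 (tl c)) // tl y0 z0 scaler0 addr0.
  - by move=> y [n n0 ->]; exact: killL.
(* These operators commute and preserve the finite dimensional weight space, so they have a common
   eigenvector there; its eigenvalues form [psi]. *)
pose f (z : tensor (hbar h) A) (v : V) : V := lact (tauA0_incl B z) v.
have incl_bilin : bilin (fun (x : hbar h) (c : A) => hbar_tau B x ⊗ c : tauA B A).
  split=> [c|x] b y z; last exact: (tens_bilin _ _).2.
  rewrite -(tens_bilin _ _).1; congr (_ ⊗ _); rewrite /hbar_tau.
  have -> : tauX B (vsval (b *: y + z).1.1) 0 =
      b *: tauX B (vsval y.1.1) 0 + tauX B (vsval z.1.1) 0.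
    by rewrite -tauX_linear -linearP.
  by rewrite /= !scalerDl -!scalerA !scalerDr [X in X + _ = _]addrACA [LHS]addrACA.
have incl_linear := tlift_linear incl_bilin.
have fr z : linear (f z) by exact: (@lact_bilin _ _ V).2.
have fl v : linear (f^~ v).
  by move=> b y z; rewrite /f /tauA0_incl incl_linear (@lact_bilin _ _ V).1.
have fE x c v : f (x ⊗ c) v = tact (hbar_tau B x) c v.
  by rewrite /f /tauA0_incl tliftE.
have fW z v : awt a k d v -> awt a k d (f z v).
  have [W0 WD] := awt_subspace a k d; move=> vw; elim/tensor_ind: z => [|y z Wy Wz|x c].
  - by rewrite (lin0 (fl v)).
  - by rewrite (linD (fl v)); exact: is_subspaceD (awt_subspace a k d) _ _ Wy Wz.
  rewrite fE tact_hbar -[a]addr0 -[d]addr0.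
  have Ws := awt_subspace (a + 0) k (d + 0).
  apply: (is_subspaceD Ws); first apply: (is_subspaceD Ws).
  - apply: tact_wt vw => [H|]; first exact: tauX0_tauX (cartan_root_space0 rhoI _).
    exact: tauL0_tauX.
  - apply: (is_subspaceZ Ws); apply: tact_wt vw => [H|].
      by rewrite lie_tauK lfunE scale0r.
    by rewrite lie_tauK scale0r.
  - apply: (is_subspaceZ Ws); apply: tact_wt vw => [H|].
      by rewrite tauX0_tauL lfunE scale0r.
    exact: tauL0_tauL.
have fC y z v : f y (f z v) = f z (f y v).
  apply/subr0_eq; elim/tensor_ind: y => [|y y' Ey Ey'|x c].
  - by rewrite !(lin0 (fl _)) (lin0 (fr _)) subrr.
  - by rewrite !(linD (fl _)) (linD (fr _)) opprD addrACA Ey Ey' addr0.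
  elim/tensor_ind: z => [|z z' Ez Ez'|x' c'].
  - by rewrite !(lin0 (fl _)) (lin0 (fr _)) subrr.
  - by rewrite !(linD (fl _)) (linD (fr _)) opprD addrACA Ez Ez' addr0.
  by rewrite !fE tact_lie lie_hbar // (lin0 (tact_linear_l _ _)).
have [m dm] := aff_fin XI a k d.
have m_gt0 : (0 < m)%N by apply/(hasdim0 dm); exists v0.
have [v [vw vn] veig] := commuting_eigenvector fr dm m_gt0 fW
  (fun y z v _ => fC y z v).
have [psi psiE] := choice veig.
have psi_linear : linear (psi : tensor (hbar h) A -> F^o).
  move=> c y z; apply/eqP; rewrite -subr_eq0; have : (psi (c *: y + z) -
      (c * psi y + psi z)) *: v = 0.
    by rewrite scalerBl scalerDl -scalerA -!psiE fl subrr.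
  by move/eqP; rewrite scaler_eq0; case/orP=> // /eqP.
exists v; split.
- exact/eqP.
- move=> S Ssub vS w; have [_ /(_ S Ssub)[S0|//]] := V_irr.
  by case: vn; exact: S0.
- by move=> x xT; exact: kill.
pose psiL := GRing.isLinear.Build _ _ _ _ (psi : tensor (hbar h) A -> F^o) psi_linear.
pose psiP : {linear tensor (hbar h) A -> F^o} :=
  HB.pack (psi : tensor (hbar h) A -> F^o) psiL.
by exists psiP => x; exact: psiE.
Qed.

Lemma positive_systemN (P : {pred hdual}) : simple_lie g -> positive_system P ->
  positive_system [pred alpha | - alpha \in P].
Proof.
move=> g_simple [Proot Popp PD]; have XI := tact_affine_rep.
have rhoI := X0_integrable XI g_simple.
have rN (alpha : hdual) : is_root (- alpha) -> is_root alpha.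
  by move=> /(is_root_opp B rhoI); rewrite opprK.
split=> [alpha /= /Proot /rN //|alpha /(is_root_opp B rhoI) /Popp|alpha beta].
  by rewrite !inE !opprK.
rewrite !inE => aP bP /(is_root_opp B rhoI); rewrite opprD => rab.
exact: PD.
Qed.

End Integrable.
End TauModule.

Theorem proposition2p1 (R : realType) (g : finLieAlgType R[i])
    (g_simple : simple_lie g) (B : invForm g)
    (A : comAlgType R[i]) (A_fg : fin_gen_alg A)
    (h : {vspace g}) (h_cartan : cartan_subalgebra h)
    (P : {pred dual (subvs_of h)}) (P_pos : positive_system P)
    (V : lieModType (tauA B A))
    (V_irr : irreducible_lieMod V) (V_int : integrable_module h V)
    (K_nontriv : exists v : V, lact (tauK B ⊗ 1 : tauA B A) v != 0) :
  highest_weight_module P V \/ lowest_weight_module P V.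
Proof.
have [e e1 ext] :=
  extremal_weight_exists (F := R[i]) V_int K_nontriv g_simple h_cartan V_irr.
(* For [e = 1] the positive system is [P], which gives [tauA_pos]; for [e = -1] it is the opposite
   of [P], which gives [tauA_neg]. *)
have [eE|eE] : e = 1 \/ e = -1 by lia.
  by left; rewrite eE in ext; exact: ext.
right; rewrite eE in ext; apply: ext.
exact: (positive_systemN (F := R[i]) V_int K_nontriv).
Qed.
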